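(* Let $g_r\neq0$ be a real number. (i) Every meromorphic function $M(\xi)$ on $\mathbb{C}$ satisfying $$(M')^4=\frac{1}{81}M^2\left(3M^2-4g_r\right)^3$$ also satisfies $$\frac14\,(M''')^2-\left(2MM''-(M')^2\right)\left(M^2-g_r\right)^2=0 .$$ (ii) The system $$\begin{cases} 2MM''-(M')^2-4M^2\tilde\psi^2=0,\\[1mm] M\tilde\psi'+\tilde\psi M'-g_rM+M^3=0\end{cases}$$ has a solution $(M,\tilde\psi)$ consisting of meromorphic functions on $\mathbb{C}$ that take real values on the real axis away from their poles, such that $M$ is a nonconstant elliptic function satisfying $(M')^4=\frac{1}{81}M^2(3M^2-4g_r)^3$. In other words, the quintic complex Ginzburg--Landau equation has elliptic wave solutions for these parameter values.
   Context: The one-dimensional quintic complex Ginzburg--Landau equation is $\mathrm{i}\mathcal{A}_t+p\mathcal{A}_{xx}+q|\mathcal{A}|^2\mathcal{A}+r|\mathcal{A}|^4\mathcal{A}-\mathrm{i}\gamma\mathcal{A}=0$ with $p,q,r\in\mathbb{C}$, $\gamma\in\mathbb{R}$. The ansatz $\mathcal{A}(x,t)=\sqrt{M(\xi)}\,e^{\mathrm{i}(\varphi(\xi)-\omega t)}$, $\xi=x-ct$, with $c,\omega\in\mathbb{R}$ and $M$, $\psi=\varphi'$ real, leads to the system $$2MM''-(M')^2-4M^2\tilde\psi^2-2\tilde c\,MM'+4g_iM^2+4d_rM^3+4u_rM^4=0,$$ $$M\tilde\psi'+\tilde\psi\,(M'-\tilde c M)-g_rM+d_iM^2+u_iM^3=0,$$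 where $u_r+\mathrm{i}u_i=r/p$, $d_r+\mathrm{i}d_i=q/p$, $s_r-\mathrm{i}s_i=1/p$, $g_r+\mathrm{i}g_i=(\gamma+\mathrm{i}\omega)(s_r-\mathrm{i}s_i)+\tfrac12c^2s_is_r+\tfrac{\mathrm{i}}{4}c^2s_r^2$, $\tilde\psi=\psi-\tfrac{cs_r}{2}$, $\tilde c=cs_i$. The system in the claim is this one with $u_i=1$, $u_r=\tilde c=d_r=d_i=g_i=0$. The third-order equation in (i) is the one obtained from it by eliminating $\tilde\psi$. Primes denote $d/d\xi$. An elliptic function is a meromorphic function on $\mathbb{C}$ having two periods $\omega_1,\omega_2$ with $\omega_1/\omega_2\notin\mathbb{R}$. *)

(* Defs.v *)
From Stdlib Require Import Reals.
From Coquelicot Require Import Coquelicot.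

(* A meromorphic function on C is represented by a total function C -> C all of
   whose points are regular points or poles; its value at a pole is irrelevant,
   so all identities between such functions are stated at regular points. *)

Definition holomorphic_at (f : C -> C) (z : C) : Prop :=
  locally z (fun w => ex_derive (K := C_AbsRing) (V := C_NormedModule) f w).

Definition pole (f : C -> C) (z : C) : Prop :=
  locally' z (fun w => ex_derive (K := C_AbsRing) (V := C_NormedModule) f w) /\
  filterlim (fun w => Cmod (f w)) (locally' z) (Rbar_locally p_infty).

Definition meromorphic (f : C -> C) : Prop :=
  forall z : C, holomorphic_at f z \/ pole f z.

Definition is_period (f : C -> C) (w : C) : Prop :=
  forall z : C, holomorphic_at f z -> holomorphic_at f (z + w)%C /\ f (z + w)%C = f z.

Definition elliptic (f : C -> C) : Prop :=
  meromorphic f /\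
  exists w1 w2 : C,
    w2 <> RtoC 0 /\ Im (w1 / w2)%C <> 0%R /\ is_period f w1 /\ is_period f w2.

Definition nonconstant (f : C -> C) : Prop :=
  exists z1 z2 : C, holomorphic_at f z1 /\ holomorphic_at f z2 /\ f z1 <> f z2.

Definition real_on_real_axis (f : C -> C) : Prop :=
  forall x : R, holomorphic_at f (RtoC x) -> Im (f (RtoC x)) = 0%R.

(* [C_derive] is total; it is the complex derivative wherever that exists, in
   particular at every order at the points where [holomorphic_at] holds. *)

Definition first_order_eq (gr : R) (M : C -> C) : Prop :=
  forall z : C, holomorphic_at M z ->
    (C_derive M z ^ 4 =
     RtoC (1 / 81) * M z ^ 2 * (RtoC 3 * M z ^ 2 - RtoC 4 * RtoC gr) ^ 3)%C.

Definition third_order_eq (gr : R) (M : C -> C) : Prop :=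
  forall z : C, holomorphic_at M z ->
    let M1 := C_derive M in
    let M2 := C_derive M1 in
    let M3 := C_derive M2 in
    (RtoC (1 / 4) * M3 z ^ 2
     - (RtoC 2 * M z * M2 z - M1 z ^ 2) * (M z ^ 2 - RtoC gr) ^ 2 = RtoC 0)%C.

Definition amplitude_phase_system (gr : R) (M psi : C -> C) : Prop :=
  forall z : C, holomorphic_at M z -> holomorphic_at psi z ->
    let M1 := C_derive M in
    let M2 := C_derive M1 in
    (RtoC 2 * M z * M2 z - M1 z ^ 2 - RtoC 4 * M z ^ 2 * psi z ^ 2 = RtoC 0)%C /\
    (M z * C_derive psi z + psi z * M1 z - RtoC gr * M z + M z ^ 3 = RtoC 0)%C.

(* i A_t + p A_xx + q |A|^2 A + r |A|^4 A - i gamma A = 0 at the point (x, t);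
   A is a complex-valued function of two real variables, and the derivatives
   are real ones. *)
Definition cgle_at (p q r : C) (gamma : R) (A : R -> R -> C) (x t : R) : Prop :=
  exists (Ax : R -> C) (Axx At : C),
    locally x (fun y : R =>
      is_derive (K := R_AbsRing) (V := C_R_NormedModule) (fun s => A s t) y (Ax y)) /\
    is_derive (K := R_AbsRing) (V := C_R_NormedModule) Ax x Axx /\
    is_derive (K := R_AbsRing) (V := C_R_NormedModule) (fun s => A x s) t At /\
    (Ci * At + p * Axx + q * RtoC (Cmod (A x t) ^ 2) * A x t
     + r * RtoC (Cmod (A x t) ^ 4) * A x t - Ci * RtoC gamma * A x t = RtoC 0)%C.

(* 1 / p = s_r - i s_i *)
Definition s_r (p : C) : R := Re (/ p)%C.
Definition s_i (p : C) : R := (- Im (/ p)%C)%R.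

(* g_r + i g_i *)
Definition wave_g (p : C) (gamma c omega : R) : C :=
  ((RtoC gamma + Ci * RtoC omega) * (RtoC (s_r p) - Ci * RtoC (s_i p))
   + RtoC (c ^ 2 * s_i p * s_r p / 2) + Ci * RtoC (c ^ 2 * s_r p ^ 2 / 4))%C.

(* The parameter values u_i = 1, u_r = c~ = d_r = d_i = g_i = 0, where
   u_r + i u_i = r / p, d_r + i d_i = q / p and c~ = c s_i. *)
Definition special_parameters (gr : R) (p q r : C) (gamma c omega : R) : Prop :=
  p <> RtoC 0 /\ (r / p = Ci)%C /\ (q / p = RtoC 0)%C /\ (c * s_i p = 0)%R /\
  wave_g p gamma c omega = RtoC gr.

(* The real intervals on which the amplitude sqrt M and the phase make sense. *)
Definition wave_interval (M psi : C -> C) (a b : R) : Prop :=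
  (a < b)%R /\
  forall x : R, (a < x < b)%R ->
    holomorphic_at M (RtoC x) /\ holomorphic_at psi (RtoC x) /\ (0 < Re (M (RtoC x)))%R.

(* sqrt(M(xi)) exp(i (phi(xi) - omega t)) with xi = x - c t *)
Definition wave (M : C -> C) (phi : R -> R) (c omega : R) (x t : R) : C :=
  let xi := (x - c * t)%R in
  let theta := (phi xi - omega * t)%R in
  (RtoC (sqrt (Re (M (RtoC xi)))) * (cos theta, sin theta))%C.

(* Main.v *)
Require Import Defs.
From Stdlib Require Import Reals.
From Coquelicot Require Import Coquelicot.
From Stdlib Require Import Ranalysis5 Classical_Prop Lra Lia Nsatz.
Open Scope R_scope.

(** Put D = 3 M^2 - 4 g_r. Off the zeros of M and D the function
    w = 9 M'^2 / (M D) is a square root of D, and p = - 3 M' / (2 w) satisfies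
    4 p^2 = M w; the equation becomes the polynomial system M' = - 2/3 w p,
    w' = - 2 M p, p' = g_r/3 - M^2/2, from which the third-order equation is an
    identity. Complex differentiability is only known pointwise: M' is
    continuous there because its fourth power is and, by Darboux's theorem, it
    cannot jump between branches of the fourth root. Where D = 0, the bound
    |M'|^4 <= K |M - e|^3 forces M - e to vanish to fourth order, so M'' and M'''
    vanish. Near a zero of M, p solves a scalar equation with a Lipschitz right
    hand side close to g_r/3; comparing p on two segments issuing from zeros
    shows that the zeros of M near a given one are either isolated or fill a
    ball, and in the isolated case w extends continuously, which gives M''' = 0.

    For existence, let S be the lemniscate sine, S'^2 = 1 - S^4, G = 1/S and
    U = S'/S. Then S' = U S, G' = - U G, U' = - (S^2 + G^2), U^2 = G^2 - S^2, and
    M(z) = (a/2) (G + e S)(k z), psi(z) = (sqrt 3/2) k U(k z) solve the system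
    when e is the sign of g_r, a^2 = 4 |g_r|/3 and k^2 = a^2 / (4 sqrt 3). The
    real lemniscate sine is sin theta with theta' = sqrt (1 + sin^2 theta), a
    global inverse function; the addition theorem extends it to C. *)

(** Off the zeros of [M] and [D], [p] is the phase gradient itself: the polynomial system gives
    [2 M M'' - M'^2 = 4 M^2 p^2] and [M p' + p M' = gr M - M^3]. The obstacle is the exceptional
    values. [holomorphic_at] gives only complex differentiability on a neighbourhood, without power
    series or isolated zeros, and [C_derive] is total, so at a zero of [M] or [D] the values of
    [M''] and [M'''] have to come from estimates. There the fourth root branches and uniqueness
    fails: on a real line a constant solution may be glued to a nonconstant one. At [D = 0] gluing
    is harmless, the contact being of order four; at [M = 0] it is only of order two, so the
    position of the zeros in the plane has to be studied. The elliptic solution fits the same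
    variables: for [V = (a/2) (G - e S)(k z)] the relation [S G = 1] gives [M^2 - V^2 = a^2 e], so
    [D = 3 V^2] once [a^2 e = 4 gr / 3]; then [w = sqrt 3 V], [p = (sqrt 3 / 2) k U], and comparing
    [M' = - k U V] with the equation fixes [48 k^4 = a^4]. *)

Local Notation is_cderive := (is_derive (K := C_AbsRing) (V := C_NormedModule)).

(** * Complex derivatives *)

(** The balls of the uniform structure on C are squares and those of [Cmod] are discs; the factor
    [sqrt 2] passes from one to the other. *)
Lemma locally_C (z : C) (P : C -> Prop) :
  locally z P <-> exists d : R, 0 < d /\ forall w : C, Cmod (w - z) < d -> P w.
Proof.
  split.
  - intros [e He]; exists e; split; [apply cond_pos|]; intros w Hw; apply He.
    apply C_NormedModule_mixin_compat1; exact Hw.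
  - intros [d [Hd H]].
    assert (Hs : 0 < sqrt 2) by (apply sqrt_lt_R0; lra).
    assert (He : 0 < d / sqrt 2) by (apply Rdiv_lt_0_compat; lra).
    exists (mkposreal _ He); intros w Hw; apply H.
    replace d with (sqrt 2 * mkposreal _ He) by (simpl; field; lra).
    apply C_NormedModule_mixin_compat2; exact Hw.
Qed.

Lemma is_cderive_iff (f : C -> C) (z l : C) :
  is_cderive f z l <->
  forall eps : R, 0 < eps -> exists d : R, 0 < d /\ forall w : C,
    Cmod (w - z) < d -> Cmod (f w - f z - (w - z) * l) <= eps * Cmod (w - z).
Proof.
  split.
  - intros [_ H] eps He.
    specialize (H z (fun P HP => HP) (mkposreal eps He)).
    destruct H as [d Hd]; exists d; split; [apply cond_pos|].
    intros w Hw; exact (Hd w Hw).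
  - intros H; split.
    + apply (is_linear_scal_l (K := C_AbsRing) (V := C_NormedModule) l).
    + intros x Hx.
      assert (E : z = x).
      { apply (is_filter_lim_locally_unique (K := C_AbsRing) (V := AbsRing_NormedModule C_AbsRing)); exact Hx. }
      subst x; intros [eps He].
      destruct (H eps He) as [d [Hd Hw]].
      exists (mkposreal d Hd); intros w Hww; exact (Hw w Hww).
Qed.

Lemma filterlim_cmod (f : C -> C) (z l : C) :
  filterlim f (locally z) (locally l) <->
  forall eps : R, 0 < eps -> exists d : R, 0 < d /\ forall w : C,
    Cmod (w - z) < d -> Cmod (f w - l) < eps.
Proof.
  split.
  - intros H eps He.
    assert (L : locally l (fun v : C => Cmod (v - l) < eps)).
    { apply locally_C; exists eps; auto. }
    apply (proj1 (locally_C _ _)), (H _ L).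
  - intros H P HP; apply locally_C in HP; destruct HP as [e [He HP]].
    destruct (H e He) as [d [Hd Hw]].
    apply locally_C; exists d; split; auto.
Qed.

Lemma is_cderive_unique (f : C -> C) (z l : C) : is_cderive f z l -> C_derive f z = l.
Proof. apply is_C_derive_unique. Qed.

Lemma is_cderive_C_derive (f : C -> C) (z : C) :
  ex_derive (K := C_AbsRing) (V := C_NormedModule) f z -> is_cderive f z (C_derive f z).
Proof. intros H; apply C_derive_correct; [exact z|exact H]. Qed.

Lemma locally_C_ex (z : C) (P : C -> Prop) : locally z P -> P z.
Proof.
  intros H; apply locally_C in H; destruct H as [d [Hd H]]; apply H.
  replace (z - z)%C with (RtoC 0) by ring; rewrite Cmod_0; exact Hd.
Qed.

Lemma is_cderive_ext_loc (f g : C -> C) (z l : C) :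
  locally z (fun w => f w = g w) -> is_cderive f z l -> is_cderive g z l.
Proof.
  intros H Hf; pose proof (locally_C_ex _ _ H) as Hz; simpl in Hz.
  apply locally_C in H; destruct H as [d [Hd H]].
  apply is_cderive_iff; intros eps He.
  destruct (proj1 (is_cderive_iff _ _ _) Hf eps He) as [d' [Hd' H']].
  exists (Rmin d d'); split; [apply Rmin_glb_lt; auto|].
  intros w Hw; rewrite <- Hz, <- H; [apply H'|]; apply (Rlt_le_trans _ _ _ Hw); auto using Rmin_l, Rmin_r.
Qed.

Lemma is_cderive_continuous (f : C -> C) (z l : C) :
  is_cderive f z l -> filterlim f (locally z) (locally (f z)).
Proof.
  intros H; apply filterlim_cmod; intros eps He.
  destruct (proj1 (is_cderive_iff _ _ _) H 1 Rlt_0_1) as [d [Hd H1]].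
  pose proof (Cmod_ge_0 l) as Hl.
  assert (He' : 0 < eps / (1 + Cmod l)) by (apply Rdiv_lt_0_compat; lra).
  exists (Rmin d (eps / (1 + Cmod l))); split; [apply Rmin_glb_lt; auto|].
  intros w Hw.
  assert (A : Cmod (w - z) < d) by (exact (Rlt_le_trans _ _ _ Hw (Rmin_l _ _))).
  assert (B : Cmod (w - z) < eps / (1 + Cmod l)) by (exact (Rlt_le_trans _ _ _ Hw (Rmin_r _ _))).
  specialize (H1 w A).
  replace (f w - f z)%C with ((f w - f z - (w - z) * l) + (w - z) * l)%C by ring.
  eapply Rle_lt_trans; [apply Cmod_triangle|]; rewrite Cmod_mult.
  apply Rmult_lt_compat_r with (r := 1 + Cmod l) in B; [|lra].
  unfold Rdiv in B; rewrite Rmult_assoc, Rinv_l in B by lra; lra.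
Qed.

(** The working criterion at the exceptional points, where derivatives come from power estimates and
    not from differentiation rules. No sign is imposed on [K], hence [Rabs K + 1] in the proof. *)
Lemma is_cderive_quadratic (f : C -> C) (z l : C) (K d : R) :
  0 < d ->
  (forall w : C, Cmod (w - z) < d -> Cmod (f w - f z - (w - z) * l) <= K * Cmod (w - z) ^ 2) ->
  is_cderive f z l.
Proof.
  intros Hd H; apply is_cderive_iff; intros eps He.
  assert (HK : 0 < Rabs K + 1) by (pose proof (Rabs_pos K); lra).
  assert (He' : 0 < eps / (Rabs K + 1)) by (apply Rdiv_lt_0_compat; lra).
  exists (Rmin d (eps / (Rabs K + 1))); split; [apply Rmin_glb_lt; auto|].
  intros w Hw.
  assert (A : Cmod (w - z) < d) by (exact (Rlt_le_trans _ _ _ Hw (Rmin_l _ _))).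
  assert (B : Cmod (w - z) < eps / (Rabs K + 1)) by (exact (Rlt_le_trans _ _ _ Hw (Rmin_r _ _))).
  apply Rmult_lt_compat_r with (r := Rabs K + 1) in B; [|lra].
  unfold Rdiv in B; rewrite Rmult_assoc, Rinv_l in B by lra.
  eapply Rle_trans; [apply H, A|].
  pose proof (Cmod_ge_0 (w - z)); pose proof (Rle_abs K).
  simpl; rewrite Rmult_1_r, <- Rmult_assoc; apply Rmult_le_compat_r; nra.
Qed.

Lemma is_cderive_const (a z : C) : is_cderive (fun _ => a) z (RtoC 0).
Proof. apply (is_derive_const (K := C_AbsRing) (V := C_NormedModule)). Qed.

(* The two normed module structures on C have the same norm but different balls. *)
Lemma is_cderive_AbsRing (f : C -> C) (z l : C) :
  is_derive (K := C_AbsRing) (V := AbsRing_NormedModule C_AbsRing) f z l <-> is_cderive f z l.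
Proof.
  split; intros [[L1 L2 L3] H]; (split; [split; [exact L1|exact L2|exact L3]|exact H]).
Qed.

Lemma is_cderive_mult (f g : C -> C) (z a b : C) :
  is_cderive f z a -> is_cderive g z b ->
  is_cderive (fun w => f w * g w)%C z (a * g z + f z * b)%C.
Proof.
  intros Hf Hg; apply is_cderive_AbsRing.
  apply (is_derive_mult (K := C_AbsRing) f g z a b); [now apply is_cderive_AbsRing..|].
  intros n m; apply Cmult_comm.
Qed.

Lemma is_cderive_plus (f g : C -> C) (z a b : C) :
  is_cderive f z a -> is_cderive g z b -> is_cderive (fun w => f w + g w)%C z (a + b)%C.
Proof. apply (is_derive_plus (K := C_AbsRing) (V := C_NormedModule)). Qed.

Lemma is_cderive_scal (k : C) (f : C -> C) (z a : C) :
  is_cderive f z a -> is_cderive (fun w => k * f w)%C z (k * a)%C.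
Proof.
  intros Hf; replace (k * a)%C with (RtoC 0 * f z + k * a)%C by ring.
  apply (is_cderive_mult (fun _ => k) f); [apply is_cderive_const|exact Hf].
Qed.

Lemma is_cderive_comp_scal (k : C) (f : C -> C) (z a : C) :
  is_cderive f (k * z)%C a -> is_cderive (fun w => f (k * w))%C z (k * a)%C.
Proof.
  intros Hf.
  assert (E : is_cderive (fun w => k * w)%C z (k * RtoC 1)%C).
  { apply (is_cderive_scal k (fun w => w)), is_cderive_AbsRing, (is_derive_id (K := C_AbsRing)). }
  rewrite Cmult_1_r in E.
  apply (is_derive_comp (K := C_AbsRing) (V := C_NormedModule) f (fun w => k * w)%C z a k Hf).
  apply is_cderive_AbsRing, E.
Qed.

(* u (w) - u (z) = (v (w) - v (z)) / (u (w) + u (z)) *)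
Lemma is_cderive_sqrt (u v : C -> C) (z l : C) :
  filterlim u (locally z) (locally (u z)) -> u z <> RtoC 0 ->
  locally z (fun w => u w * u w = v w)%C ->
  is_cderive v z (RtoC 2 * u z * l)%C -> is_cderive u z l.
Proof.
  intros Hc Hu Huv Hv.
  assert (Ez : (u z * u z = v z)%C) by exact (locally_C_ex _ _ Huv).
  apply locally_C in Huv; destruct Huv as [d0 [Hd0 Huv]].
  assert (Hm : 0 < Cmod (u z)) by (apply Cmod_gt_0; exact Hu).
  set (m := Cmod (u z)) in *.
  pose proof (Cmod_ge_0 l) as Hl.
  apply is_cderive_iff; intros eps He.
  assert (He1 : 0 < eps * m / 2) by (apply Rdiv_lt_0_compat; nra).
  destruct (proj1 (is_cderive_iff _ _ _) Hv _ He1) as [d1 [Hd1 H1]].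
  assert (He2 : 0 < Rmin (m / 2) (eps * m / (2 * (Cmod l + 1)))).
  { apply Rmin_glb_lt; [lra|]; apply Rdiv_lt_0_compat; nra. }
  destruct (proj1 (filterlim_cmod _ _ _) Hc _ He2) as [d2 [Hd2 H2]].
  exists (Rmin d0 (Rmin d1 d2)); split; [repeat apply Rmin_glb_lt; auto|].
  intros w Hw.
  assert (W0 : Cmod (w - z) < d0) by (exact (Rlt_le_trans _ _ _ Hw (Rmin_l _ _))).
  assert (W1 : Cmod (w - z) < d1).
  { apply (Rlt_le_trans _ _ _ Hw); eapply Rle_trans; [apply Rmin_r|apply Rmin_l]. }
  assert (W2 : Cmod (w - z) < d2).
  { apply (Rlt_le_trans _ _ _ Hw); eapply Rle_trans; [apply Rmin_r|apply Rmin_r]. }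
  specialize (H1 w W1); specialize (H2 w W2); specialize (Huv w W0).
  rewrite <- Huv, <- Ez in H1.
  set (r := (w - z)%C) in *; set (k := (u w - u z)%C) in *.
  assert (Ha : Cmod k < m / 2) by (eapply Rlt_le_trans; [exact H2|apply Rmin_l]).
  assert (Hb : Cmod k < eps * m / (2 * (Cmod l + 1))) by (eapply Rlt_le_trans; [exact H2|apply Rmin_r]).
  (* [u w] is within [m / 2] of [u z], so the sum keeps away from 0 and can be divided out. *)
  assert (Hs : m <= Cmod (u w + u z)).
  { assert (T : Cmod (RtoC 2 * u z) <= Cmod (u w + u z) + Cmod (- k)).
    { replace (RtoC 2 * u z)%C with ((u w + u z) + - k)%C by (unfold k; ring). apply Cmod_triangle. }
    rewrite Cmod_mult, Cmod_opp, Cmod_R, Rabs_right in T by lra. fold m in T; lra. }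
  (* Multiplication by [u w + u z] turns the error of [u] into the error of [v] plus the
     second-order term [r l k]; each of the two receives [eps * m / 2]. *)
  assert (E : ((u w + u z) * (k - r * l) = (u w * u w - u z * u z - r * (RtoC 2 * u z * l)) - r * l * k)%C)
    by (unfold k; ring).
  apply (f_equal Cmod) in E; rewrite Cmod_mult in E.
  assert (B : Cmod (u w + u z) * Cmod (k - r * l) <= eps * m * Cmod r).
  { rewrite E; eapply Rle_trans; [apply Cmod_triangle|]; rewrite Cmod_opp, !Cmod_mult.
    assert (Cmod l * Cmod k <= eps * m / 2).
    { apply Rmult_lt_compat_r with (r := 2 * (Cmod l + 1)) in Hb; [|lra].
      unfold Rdiv in Hb; rewrite Rmult_assoc, Rinv_l in Hb by lra.
      pose proof (Cmod_ge_0 k); nra. }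
    pose proof (Cmod_ge_0 r); nra. }
  pose proof (Cmod_ge_0 (k - r * l)); pose proof (Cmod_ge_0 r).
  apply Rmult_le_reg_l with m; [exact Hm|]; nra.
Qed.

(** * Complex functions along segments *)

(* Continuity and derivative of a complex function of a real variable, tested
   on all real linear functionals [h |-> Re (c h)%C]. *)
Definition path_cont (h : R -> C) (t : R) : Prop :=
  forall c : C, continuity_pt (fun s => Re (c * h s)%C) t.

Definition path_der (h : R -> C) (t : R) (l : C) : Prop :=
  forall c : C, is_derive (fun s => Re (c * h s)%C) t (Re (c * l)%C).

Lemma Cmod_sq (z : C) : Cmod z * Cmod z = Re z * Re z + Im z * Im z.
Proof. pose proof (Cmod2_alt z); simpl in H; lra. Qed.

Lemma is_derive_iff (f : R -> R) (x l : R) :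
  is_derive f x l <->
  forall eps : R, 0 < eps -> exists d : R, 0 < d /\ forall y : R,
    Rabs (y - x) < d -> Rabs (f y - f x - (y - x) * l) <= eps * Rabs (y - x).
Proof.
  split.
  - intros [_ H] eps He.
    specialize (H x (fun P HP => HP) (mkposreal eps He)).
    destruct H as [d Hd]; exists d; split; [apply cond_pos|].
    intros w Hw; exact (Hd w Hw).
  - intros H; split; [apply (is_linear_scal_l (K := R_AbsRing) (V := R_NormedModule) l)|].
    intros y Hy; assert (E : x = y) by (apply is_filter_lim_locally_unique; exact Hy).
    subst y; intros [eps He]; destruct (H eps He) as [d [Hd Hw]].
    exists (mkposreal d Hd); intros w Hww; exact (Hw w Hww).
Qed.

Lemma continuity_pt_iff (f : R -> R) (x : R) :
  continuity_pt f x <->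
  forall eps : R, 0 < eps -> exists d : R, 0 < d /\ forall y : R,
    Rabs (y - x) < d -> Rabs (f y - f x) < eps.
Proof.
  split.
  - intros H eps He; destruct (H eps He) as [d [Hd H1]]; exists d; split; [exact Hd|].
    intros y Hy; destruct (Req_dec x y) as [<-|N].
    + rewrite Rminus_diag, Rabs_R0; exact He.
    + apply H1; split; [split; [exact I|exact N]|exact Hy].
  - intros H eps He; destruct (H eps He) as [d [Hd H1]]; exists d; split; [exact Hd|].
    intros y [_ Hy]; apply H1, Hy.
Qed.

Lemma Re_mult_le (c z : C) : Rabs (Re (c * z)%C) <= Cmod c * Cmod z.
Proof. rewrite <- Cmod_mult; apply re_le_Cmod. Qed.

Lemma path_cont_line (f : C -> C) (p v : C) (t : R) :
  filterlim f (locally (p + RtoC t * v)%C) (locally (f (p + RtoC t * v)%C)) ->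
  path_cont (fun s => f (p + RtoC s * v)%C) t.
Proof.
  intros H c; apply continuity_pt_iff; intros eps He.
  pose proof (Cmod_ge_0 c) as Hc; pose proof (Cmod_ge_0 v) as Hv.
  assert (He' : 0 < eps / (Cmod c + 1)) by (apply Rdiv_lt_0_compat; lra).
  destruct (proj1 (filterlim_cmod _ _ _) H _ He') as [d [Hd H1]].
  assert (Hd' : 0 < d / (Cmod v + 1)) by (apply Rdiv_lt_0_compat; lra).
  exists (d / (Cmod v + 1)); split; [exact Hd'|]; intros y Hy.
  assert (A : Cmod ((p + RtoC y * v) - (p + RtoC t * v)) < d).
  { replace ((p + RtoC y * v) - (p + RtoC t * v))%C with (RtoC (y - t) * v)%C
      by (rewrite RtoC_minus; ring).
    rewrite Cmod_mult, Cmod_R.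
    apply Rmult_lt_compat_r with (r := Cmod v + 1) in Hy; [|lra].
    unfold Rdiv in Hy; rewrite Rmult_assoc, Rinv_l in Hy by lra.
    pose proof (Rabs_pos (y - t)); nra. }
  specialize (H1 _ A).
  replace (Re (c * f (p + RtoC y * v)%C)%C - Re (c * f (p + RtoC t * v)%C)%C)%R with
    (Re (c * (f (p + RtoC y * v)%C - f (p + RtoC t * v)%C))%C)%R by (unfold Re, Cminus, Cplus, Cmult, Copp; simpl; ring).
  eapply Rle_lt_trans; [apply Re_mult_le|].
  apply Rmult_lt_compat_r with (r := Cmod c + 1) in H1; [|lra].
  unfold Rdiv in H1; rewrite Rmult_assoc, Rinv_l in H1 by lra.
  pose proof (Cmod_ge_0 (f (p + RtoC y * v)%C - f (p + RtoC t * v)%C)%C); nra.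
Qed.

Lemma path_der_line (f : C -> C) (p v l : C) (t : R) :
  is_cderive f (p + RtoC t * v)%C l ->
  path_der (fun s => f (p + RtoC s * v)%C) t (v * l)%C.
Proof.
  intros H c; apply is_derive_iff; intros eps He.
  pose proof (Cmod_ge_0 c) as Hc; pose proof (Cmod_ge_0 v) as Hv.
  assert (Hcv : 0 < (Cmod c + 1) * (Cmod v + 1)) by nra.
  assert (He' : 0 < eps / ((Cmod c + 1) * (Cmod v + 1))) by (apply Rdiv_lt_0_compat; lra).
  destruct (proj1 (is_cderive_iff _ _ _) H _ He') as [d [Hd H1]].
  assert (Hd' : 0 < d / (Cmod v + 1)) by (apply Rdiv_lt_0_compat; lra).
  exists (d / (Cmod v + 1)); split; [exact Hd'|]; intros y Hy.
  assert (E : ((p + RtoC y * v) - (p + RtoC t * v) = RtoC (y - t) * v)%C)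
    by (rewrite RtoC_minus; ring).
  assert (A : Cmod ((p + RtoC y * v) - (p + RtoC t * v)) < d).
  { rewrite E, Cmod_mult, Cmod_R.
    apply Rmult_lt_compat_r with (r := Cmod v + 1) in Hy; [|lra].
    unfold Rdiv in Hy; rewrite Rmult_assoc, Rinv_l in Hy by lra.
    pose proof (Rabs_pos (y - t)); nra. }
  specialize (H1 _ A); rewrite E, Cmod_mult, Cmod_R in H1.
  replace (Re (c * f (p + RtoC y * v)%C)%C - Re (c * f (p + RtoC t * v)%C)%C - (y - t) * Re (c * (v * l))%C)%R with
    (Re (c * (f (p + RtoC y * v)%C - f (p + RtoC t * v)%C - RtoC (y - t) * v * l))%C)%R
    by (unfold Re, Cminus, Cplus, Cmult, Copp, RtoC; simpl; ring).
  eapply Rle_trans; [apply Re_mult_le|].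
  set (X := Cmod (f (p + RtoC y * v)%C - f (p + RtoC t * v)%C - RtoC (y - t) * v * l)) in *.
  apply Rmult_le_compat_r with (r := (Cmod c + 1) * (Cmod v + 1)) in H1; [|lra].
  replace (eps / ((Cmod c + 1) * (Cmod v + 1)) * (Rabs (y - t) * Cmod v) * ((Cmod c + 1) * (Cmod v + 1)))
    with (eps * Rabs (y - t) * Cmod v) in H1 by (field; lra).
  pose proof (Rabs_pos (y - t)). assert (0 <= X) by apply Cmod_ge_0.
  assert (0 <= eps * Rabs (y - t)) by nra.
  apply Rmult_le_reg_r with (Cmod v + 1); [lra|].
  nra.
Qed.

Lemma path_cont_minus (h k : R -> C) (t : R) :
  path_cont h t -> path_cont k t -> path_cont (fun s => h s - k s)%C t.
Proof.
  intros Hh Hk c.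
  apply continuity_pt_ext with (fun s => Re (c * h s)%C - Re (c * k s)%C)%R.
  - intros s; unfold Re, Cminus, Cplus, Cmult, Copp; simpl; ring.
  - apply (continuity_pt_minus _ _ _ (Hh c) (Hk c)).
Qed.

Lemma path_der_minus (h k : R -> C) (t : R) (a b : C) :
  path_der h t a -> path_der k t b -> path_der (fun s => h s - k s)%C t (a - b)%C.
Proof.
  intros Hh Hk c.
  replace (Re (c * (a - b))%C)%R with (Re (c * a)%C - Re (c * b)%C)%R
    by (unfold Re, Cminus, Cplus, Cmult, Copp; simpl; ring).
  apply is_derive_ext with (fun s => Re (c * h s)%C - Re (c * k s)%C)%R.
  - intros s; unfold Re, Cminus, Cplus, Cmult, Copp; simpl; ring.
  - apply (is_derive_minus _ _ _ _ _ (Hh c) (Hk c)).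
Qed.

Lemma path_der_linear (a : C) (t : R) : path_der (fun s => RtoC s * a)%C t a.
Proof.
  intros c; apply is_derive_ext with (fun s => s * Re (c * a)%C)%R.
  - intros s; unfold Re, Cmult, RtoC; simpl; ring.
  - auto_derive; [exact I|unfold Re, Cmult; simpl; ring].
Qed.

Lemma path_cont_linear (a : C) (t : R) : path_cont (fun s => RtoC s * a)%C t.
Proof.
  intros c; apply derivable_continuous_pt; eexists; apply is_derive_Reals, path_der_linear.
Qed.

Lemma path_cont_norm (h : R -> C) (t : R) :
  path_cont h t -> continuity_pt (fun s => Cmod (h s) * Cmod (h s)) t.
Proof.
  intros H; apply continuity_pt_ext with
    (fun s => Re (RtoC 1 * h s)%C * Re (RtoC 1 * h s)%C + Re (- Ci * h s)%C * Re (- Ci * h s)%C).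
  - intros s; rewrite Cmod_sq; unfold Re, Im, Cmult, Copp, RtoC, Ci; simpl; ring.
  - apply continuity_pt_plus; apply continuity_pt_mult; apply H.
Qed.

(** Testing [h] on the functional given by the conjugate of [h b - h a] yields the square of
    [Cmod (h b - h a)] as the increment, which reduces the inequality to the real mean value
    theorem. *)
Lemma path_mean_value (h h' : R -> C) (a b K : R) :
  a <= b ->
  (forall t, a <= t <= b -> path_cont h t) ->
  (forall t, a < t < b -> path_der h t (h' t)) ->
  (forall t, a <= t <= b -> Cmod (h' t) <= K) ->
  Cmod (h b - h a) <= K * (b - a).
Proof.
  intros Hab Hc Hd HK.
  set (c := Cconj (h b - h a)).
  destruct (MVT_gen (fun s => Re (c * h s)%C) a b (fun s => Re (c * h' s)%C)) as [s [Hs E]].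
  - rewrite Rmin_left, Rmax_right by lra; intros x Hx; apply Hd, Hx.
  - rewrite Rmin_left, Rmax_right by lra; intros x Hx; apply Hc, Hx.
  - rewrite Rmin_left, Rmax_right in Hs by lra.
    assert (E1 : (Re (c * h b)%C - Re (c * h a)%C = Cmod (h b - h a) * Cmod (h b - h a))%R).
    { rewrite Cmod_sq; unfold c, Re, Im, Cconj, Cminus, Cplus, Cmult, Copp; simpl; ring. }
    rewrite E1 in E; clear E1.
    pose proof (Re_mult_le c (h' s)) as B; unfold c at 2 in B; rewrite Cmod_conj in B.
    apply Rabs_le_between in B.
    specialize (HK s Hs).
    pose proof (Cmod_ge_0 (h b - h a)) as Hm; set (m := Cmod (h b - h a)) in *.
    destruct (Rle_lt_or_eq_dec 0 m Hm) as [Hp|<-].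
    + apply Rmult_le_reg_l with m; [exact Hp|]; rewrite E.
      assert (m * Cmod (h' s) <= m * K) by nra.
      nra.
    + pose proof (Cmod_ge_0 (h' s)%C); nra.
Qed.

Lemma path_max (h : R -> C) (a b : R) :
  a <= b -> (forall t, a <= t <= b -> path_cont h t) ->
  exists s, a <= s <= b /\ forall t, a <= t <= b -> Cmod (h t) <= Cmod (h s).
Proof.
  intros Hab Hc.
  destruct (continuity_ab_maj (fun s => Cmod (h s) * Cmod (h s)) a b Hab) as [s [H1 H2]].
  - intros t Ht; apply path_cont_norm, Hc, Ht.
  - exists s; split; [exact H2|]; intros t Ht; specialize (H1 t Ht); simpl in H1.
    pose proof (Cmod_ge_0 (h t)); pose proof (Cmod_ge_0 (h s)%C); nra.
Qed.

(** [s] is the supremum of the [t] such that [f] has no zero on [0, t]; a nonzero value at [s] would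
    persist beyond [s] by continuity. *)
Lemma first_zero (f : R -> R) :
  (forall t, 0 <= t <= 1 -> continuity_pt f t) -> f 0 <> 0 -> f 1 = 0 ->
  exists s, 0 < s <= 1 /\ f s = 0 /\ forall t, 0 <= t < s -> f t <> 0.
Proof.
  intros Hc H0 H1.
  set (E := fun t => 0 <= t <= 1 /\ forall u, 0 <= u <= t -> f u <> 0).
  destruct (completeness E) as [s [Hs1 Hs2]].
  - exists 1; intros t [Ht _]; lra.
  - exists 0; split; [lra|]; intros u Hu; replace u with 0 by lra; exact H0.
  - assert (Hs0 : 0 <= s) by (apply Hs1; split; [lra|]; intros u Hu; replace u with 0 by lra; exact H0).
    assert (Hs : s <= 1) by (apply Hs2; intros t [Ht _]; lra).
    assert (Hlt : forall t, 0 <= t < s -> f t <> 0).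
    { intros t Ht Hf. assert (s <= t); [|lra].
      apply Hs2; intros u [Hu1 Hu2]; destruct (Rle_lt_dec u t) as [|Hl]; [auto|].
      exfalso; apply (Hu2 t); [lra|exact Hf]. }
    assert (Hfs : f s = 0).
    { destruct (Req_dec (f s) 0) as [|N]; [auto|exfalso].
      destruct (proj1 (continuity_pt_iff f s) (Hc s (conj Hs0 Hs)) (Rabs (f s))) as [d [Hd H]].
      { apply Rabs_pos_lt, N. }
      destruct (Req_dec s 1) as [->|N1]; [contradiction|].
      set (t := Rmin 1 (s + d / 2)).
      assert (Ht1 : t <= 1) by apply Rmin_l.
      assert (Ht2 : t <= s + d / 2) by apply Rmin_r.
      assert (Ht : s < t) by (apply Rmin_glb_lt; lra).
      assert (t <= s); [|lra].
      apply Hs1; split; [lra|]; intros u Hu Hfu.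
      destruct (Rlt_le_dec u s) as [Hl|Hg]; [apply (Hlt u); auto; lra|].
      assert (A : Rabs (u - s) < d) by (rewrite Rabs_right; lra).
      specialize (H u A); rewrite Hfu in H; unfold Rminus in H; rewrite Rplus_0_l, Rabs_Ropp in H; lra. }
    exists s; split; [split; [|exact Hs]|split; [exact Hfs|exact Hlt]].
    destruct (Rle_lt_or_eq_dec 0 s Hs0) as [|<-]; [auto|contradiction].
Qed.

(** The slope of [f t - v t] is positive at [a] and negative at [b], so its maximum on the interval
    is interior. *)
Lemma Darboux (f f' : R -> R) (a b v : R) :
  a < b -> (forall t, a <= t <= b -> is_derive f t (f' t)) ->
  f' b < v < f' a -> exists t, a <= t <= b /\ f' t = v.
Proof.
  intros Hab Hd Hv.
  set (g := fun t => f t - v * t).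
  assert (Hg : forall t, a <= t <= b -> is_derive g t (f' t - v)).
  { intros t Ht; apply (is_derive_minus (V := R_NormedModule)); [apply Hd, Ht|].
    auto_derive; [exact I|ring]. }
  destruct (continuity_ab_maj g a b (Rlt_le _ _ Hab)) as [s [H1 H2]].
  { intros t Ht; apply derivable_continuous_pt; eexists; apply is_derive_Reals, Hg, Ht. }
  exists s; split; [exact H2|].
  assert (Hsa : s <> a).
  { intros ->; destruct (proj1 (is_derive_iff _ _ _) (Hg a H2) ((f' a - v) / 2)) as [d [Hd0 H]]; [lra|].
    set (t := Rmin b (a + d / 2)).
    assert (T1 : t <= b) by apply Rmin_l. assert (T2 : t <= a + d / 2) by apply Rmin_r.
    assert (T3 : a < t) by (apply Rmin_glb_lt; lra).
    specialize (H t); rewrite Rabs_right in H by lra; specialize (H ltac:(lra)).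
    apply Rabs_le_between in H. specialize (H1 t ltac:(lra)). nra. }
  assert (Hsb : s <> b).
  { intros ->; destruct (proj1 (is_derive_iff _ _ _) (Hg b H2) ((v - f' b) / 2)) as [d [Hd0 H]]; [lra|].
    set (t := Rmax a (b - d / 2)).
    assert (T1 : a <= t) by apply Rmax_l. assert (T2 : b - d / 2 <= t) by apply Rmax_r.
    assert (T3 : t < b) by (apply Rmax_lub_lt; lra).
    specialize (H t); rewrite Rabs_left in H by lra; specialize (H ltac:(lra)).
    apply Rabs_le_between in H. specialize (H1 t ltac:(lra)). nra. }
  pose proof (proj1 (is_derive_Reals _ _ _) (Hg s H2)) as Hgs.
  assert (E := deriv_maximum g a b s (exist _ _ Hgs) ltac:(lra) ltac:(lra)
    (fun x Ha Hb => H1 x (conj (Rlt_le _ _ Ha) (Rlt_le _ _ Hb)))).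
  simpl in E; unfold derive_pt in E; simpl in E; lra.
Qed.

(** * Continuity of the derivative *)

Lemma Cmult_cancel_l (a x y : C) : a <> RtoC 0 -> (a * x = a * y)%C -> x = y.
Proof.
  intros Ha H; replace x with (/ a * (a * x))%C by (field; exact Ha).
  rewrite H; field; exact Ha.
Qed.

Lemma Re_le (z : C) : - Cmod z <= Re z <= Cmod z.
Proof. apply Rabs_le_between, re_le_Cmod. Qed.

Lemma Im_le (z : C) : - Cmod z <= Im z <= Cmod z.
Proof.
  apply Rabs_le_between; eapply Rle_trans; [|apply Rmax_Cmod]; apply Rmax_r.
Qed.

Lemma is_cderive_inv (f : C -> C) (z l : C) :
  is_cderive f z l -> f z <> RtoC 0 ->
  is_cderive (fun w => / f w)%C z (- l / (f z * f z))%C.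
Proof.
  intros Hf Hz.
  assert (E : is_cderive Cinv (f z) (- (1) / (f z * f z))%C).
  { set (a := f z) in *.
    assert (Ha : 0 < Cmod a) by (apply Cmod_gt_0, Hz).
    apply is_cderive_quadratic with (K := 2 / Cmod a ^ 3) (d := Cmod a / 2); [lra|].
    intros w Hw.
    assert (Hwa : Cmod a / 2 < Cmod w).
    { pose proof (Cmod_triangle w (- (w - a))%C) as T.
      rewrite Cmod_opp in T; replace (w + - (w - a))%C with a in T by ring; lra. }
    assert (Hw0 : w <> RtoC 0) by (apply Cmod_gt_0; lra).
    replace (/ w - / a - (w - a) * (- (1) / (a * a)))%C with
      ((w - a) * (w - a) * / (w * (a * a)))%C by (field; auto).
    rewrite !Cmod_mult, Cmod_inv, !Cmod_mult by (repeat apply Cmult_neq_0; auto).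
    set (x := Cmod (w - a)%C). assert (0 <= x) by apply Cmod_ge_0.
    assert (/ (Cmod w * (Cmod a * Cmod a)) <= 2 / Cmod a ^ 3).
    { replace (2 / Cmod a ^ 3) with (/ (Cmod a / 2 * (Cmod a * Cmod a))) by (field; lra).
      assert (0 < Cmod a * Cmod a) by nra.
      apply Rinv_le_contravar; [apply Rmult_lt_0_compat; lra|apply Rmult_le_compat_r; lra]. }
    replace (x ^ 2) with (x * x) by ring. nra. }
  replace (- l / (f z * f z))%C with (l * (- (1) / (f z * f z)))%C by (field; exact Hz).
  apply (is_derive_comp (K := C_AbsRing) (V := C_NormedModule) Cinv f z _ l E).
  apply is_cderive_AbsRing, Hf.
Qed.

Lemma filterlim_csquare (f : C -> C) (z : C) :
  filterlim f (locally z) (locally (f z)) ->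
  filterlim (fun w => f w * f w)%C (locally z) (locally (f z * f z)%C).
Proof.
  intros H; apply filterlim_cmod; intros eps He.
  pose proof (Cmod_ge_0 (f z)) as H0.
  assert (He' : 0 < Rmin 1 (eps / (1 + 2 * Cmod (f z)%C))).
  { apply Rmin_glb_lt; [lra|]; apply Rdiv_lt_0_compat; lra. }
  destruct (proj1 (filterlim_cmod _ _ _) H _ He') as [d [Hd H1]]; exists d; split; [exact Hd|].
  intros w Hw; specialize (H1 w Hw).
  pose proof (Rlt_le_trans _ _ _ H1 (Rmin_l _ _)) as A.
  pose proof (Rlt_le_trans _ _ _ H1 (Rmin_r _ _)) as B.
  apply Rmult_lt_compat_r with (r := 1 + 2 * Cmod (f z)%C) in B; [|lra].
  unfold Rdiv in B; rewrite Rmult_assoc, Rinv_l in B by lra.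
  replace (f w * f w - f z * f z)%C with ((f w - f z) * ((f w - f z) + RtoC 2 * f z))%C by ring.
  rewrite Cmod_mult.
  pose proof (Cmod_triangle (f w - f z) (RtoC 2 * f z)) as T.
  rewrite Cmod_mult, Cmod_R, Rabs_right in T by lra.
  pose proof (Cmod_ge_0 (f w - f z)); pose proof (Cmod_ge_0 ((f w - f z) + RtoC 2 * f z)%C). nra.
Qed.

(** The product of the distances from [u] to the four roots is the modulus of [u^4 - 1], so they
    cannot all be at least [eta]. *)
Lemma fourth_root_near (u : C) (eta : R) :
  0 < eta -> Cmod (u * u * (u * u) - 1)%C < eta ^ 4 ->
  exists k : C, (k = RtoC 1 \/ k = RtoC (-1) \/ k = Ci \/ k = (- Ci)%C) /\ Cmod (u - k)%C < eta.
Proof.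
  intros He H.
  replace (u * u * (u * u) - 1)%C with ((u - RtoC 1) * (u - RtoC (-1)) * ((u - Ci) * (u - - Ci)))%C in H.
  2:{ replace (u * u * (u * u) - 1)%C with ((u * u - 1) * (u * u - Ci * Ci))%C; [ring|].
      replace (Ci * Ci)%C with (RtoC (-1)) by (unfold Ci, Cmult, RtoC; simpl; f_equal; ring). ring. }
  rewrite !Cmod_mult in H.
  destruct (Rlt_le_dec (Cmod (u - RtoC 1)%C) eta) as [|H1]; [eexists; split; [|eassumption]; auto|].
  destruct (Rlt_le_dec (Cmod (u - RtoC (-1))%C) eta) as [|H2]; [eexists; split; [|eassumption]; auto|].
  destruct (Rlt_le_dec (Cmod (u - Ci)%C) eta) as [|H3]; [eexists; split; [|eassumption]; auto|].
  destruct (Rlt_le_dec (Cmod (u - - Ci)%C) eta) as [|H4]; [eexists; split; [|eassumption]; auto|].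
  exfalso.
  assert (eta * eta <= Cmod (u - RtoC 1)%C * Cmod (u - RtoC (-1))%C) by (apply Rmult_le_compat; lra).
  assert (eta * eta <= Cmod (u - Ci)%C * Cmod (u - - Ci)%C) by (apply Rmult_le_compat; lra).
  assert (0 <= eta * eta) by nra.
  assert (eta * eta * (eta * eta) <= Cmod (u - RtoC 1)%C * Cmod (u - RtoC (-1))%C * (Cmod (u - Ci)%C * Cmod (u - - Ci)%C))
    by (apply Rmult_le_compat; assumption).
  simpl in H; lra.
Qed.

(* By Darboux's theorem the derivative cannot jump between the four separated
   branches of the fourth root; this replaces Goursat's theorem. *)
Lemma fourth_root_derivative_continuous (M M1 F : C -> C) (z : C) :
  locally z (fun w => is_cderive M w (M1 w) /\ (M1 w * M1 w * (M1 w * M1 w) = F w)%C) ->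
  filterlim F (locally z) (locally (F z)) -> F z <> RtoC 0 ->
  filterlim M1 (locally z) (locally (M1 z)).
Proof.
  intros HM HF HFz.
  assert (Ez := proj2 (locally_C_ex _ _ HM)); simpl in Ez.
  apply locally_C in HM; destruct HM as [d0 [Hd0 HM]].
  set (a := M1 z) in *.
  assert (Ha : a <> RtoC 0) by (intros E; apply HFz; rewrite <- Ez, E; ring).
  assert (Ha' : 0 < Cmod a) by (apply Cmod_gt_0, Ha).
  apply filterlim_cmod; intros eps He.
  (* The bound 1/10 keeps the discs around the four roots of unity apart; the bound [eps / Cmod a]
     is the precision wanted for [M1]. *)
  set (eta := Rmin (1 / 10) (eps / Cmod a)).
  assert (Heta : 0 < eta) by (apply Rmin_glb_lt; [lra|]; apply Rdiv_lt_0_compat; lra).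
  assert (Heta1 : eta <= 1 / 10) by apply Rmin_l.
  assert (Heta2 : eta * Cmod a <= eps).
  { apply Rle_trans with (eps / Cmod a * Cmod a); [|right; field; lra].
    apply Rmult_le_compat_r; [lra|apply Rmin_r]. }
  assert (HFz' : 0 < Cmod (F z)%C) by (apply Cmod_gt_0, HFz).
  assert (He4 : 0 < eta ^ 4 * Cmod (F z)%C) by (apply Rmult_lt_0_compat; [apply pow_lt|]; auto).
  destruct (proj1 (filterlim_cmod _ _ _) HF _ He4) as [d1 [Hd1 HF1]].
  exists (Rmin d0 d1); split; [apply Rmin_glb_lt; auto|]; intros w Hw.
  assert (W0 : Cmod (w - z)%C < d0) by exact (Rlt_le_trans _ _ _ Hw (Rmin_l _ _)).
  assert (W1 : Cmod (w - z)%C < d1) by exact (Rlt_le_trans _ _ _ Hw (Rmin_r _ _)).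
  assert (Hseg : forall t, 0 <= t <= 1 -> Cmod ((z + RtoC t * (w - z)) - z) <= Cmod (w - z)%C).
  { intros t Ht; replace ((z + RtoC t * (w - z)) - z)%C with (RtoC t * (w - z))%C by ring.
    rewrite Cmod_mult, Cmod_R, Rabs_right by lra; pose proof (Cmod_ge_0 (w - z)); nra. }
  assert (Hroot : forall v, Cmod (v - z)%C < d0 -> Cmod (v - z)%C < d1 ->
    exists k : C, (k = RtoC 1 \/ k = RtoC (-1) \/ k = Ci \/ k = (- Ci)%C) /\ Cmod (M1 v / a - k)%C < eta).
  { intros v V0 V1; apply fourth_root_near; [exact Heta|].
    specialize (HF1 v V1); rewrite <- (proj2 (HM v V0)), <- Ez in HF1.
    apply Rmult_lt_reg_r with (Cmod (F z)%C); [exact HFz'|].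
    rewrite <- Cmod_mult, <- Ez.
    replace ((M1 v / a * (M1 v / a) * (M1 v / a * (M1 v / a)) - 1) * (a * a * (a * a)))%C
      with (M1 v * M1 v * (M1 v * M1 v) - a * a * (a * a))%C by (field; exact Ha).
    exact HF1. }
  (* [M1 w / a] is close to a fourth root of unity [k]. For [k = 1] this is the claim; every other
     [k] is excluded below. *)
  destruct (Hroot w W0 W1) as [k [Hk Hk1]].
  destruct (Ceq_dec k (RtoC 1)) as [->|Hk2].
  { replace (M1 w - a)%C with ((M1 w / a - 1) * a)%C by (field; exact Ha).
    rewrite Cmod_mult; apply Rlt_le_trans with (eta * Cmod a); [|exact Heta2].
    apply Rmult_lt_compat_r; auto. }
  exfalso.
  destruct (Ceq_dec w z) as [->|Hwz].
  { fold a in Hk1; replace (a / a)%C with (RtoC 1) in Hk1 by (field; exact Ha).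
    pose proof (Re_le (1 - k)) as R1; pose proof (Im_le (1 - k)) as I1.
    destruct Hk as [->|[->|[->| ->]]]; [apply Hk2; reflexivity|..];
    unfold Re, Im, Cminus, Cplus, Copp, RtoC, Ci in R1, I1; simpl in R1, I1;
    unfold Cminus, Cplus, Copp, RtoC, Ci in Hk1; simpl in Hk1; lra. }
  assert (Hv : (w - z <> 0)%C) by (intros E; apply Hwz; replace w with ((w - z) + z)%C by ring; rewrite E; ring).
  set (v := (w - z)%C) in *.
  (* Multiplication by [2 + Ci] gives the roots 1, -1, [Ci], [- Ci] the distinct real parts 2, -2,
     -1, 1. The value 3/2 lies between that of the root 1, taken at [t = 0], and the others, and an
     error of 1/10 in the root does not reach it. *)
  set (c := ((RtoC 2 + Ci) / (v * a))%C).
  set (f' := fun t => Re ((RtoC 2 + Ci) * (M1 (z + RtoC t * v)%C / a))%C).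
  destruct (Darboux (fun t => Re (c * M (z + RtoC t * v)%C)%C) f' 0 1 (3 / 2)) as [t [Ht Et]]; [lra|..].
  - intros t Ht; unfold f'.
    replace ((RtoC 2 + Ci) * (M1 (z + RtoC t * v)%C / a))%C with (c * (v * M1 (z + RtoC t * v)%C))%C
      by (unfold c; field; auto).
    apply path_der_line, HM; eapply Rle_lt_trans; [apply Hseg, Ht|exact W0].
  - unfold f'; split.
    + replace (z + RtoC 1 * v)%C with w by (unfold v; ring).
      set (u := (M1 w / a)%C) in *.
      pose proof (Re_le (u - k)) as R1; pose proof (Im_le (u - k)) as I1.
      revert Hk1 R1 I1; generalize (Cmod (u - k)%C); intros m Hk1 R1 I1.
      destruct u as [u1 u2].
      destruct Hk as [->|[->|[->| ->]]]; [exfalso; apply Hk2; reflexivity|..];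
      unfold Re, Im, Cminus, Cplus, Copp, Cmult, RtoC, Ci in *; simpl in *; lra.
    + replace (z + RtoC 0 * v)%C with z by ring; fold a.
      replace (a / a)%C with (RtoC 1) by (field; exact Ha).
      unfold Re, Cmult, Cplus, RtoC, Ci; simpl; lra.
  - unfold f' in Et.
    destruct (Hroot (z + RtoC t * v)%C) as [k' [Hk' Hk1']].
    + eapply Rle_lt_trans; [apply Hseg, Ht|exact W0].
    + eapply Rle_lt_trans; [apply Hseg, Ht|exact W1].
    + set (u := (M1 (z + RtoC t * v)%C / a)%C) in *.
      pose proof (Re_le (u - k')) as R1; pose proof (Im_le (u - k')) as I1.
      revert Hk1' R1 I1; generalize (Cmod (u - k')%C); intros m Hk1' R1 I1.
      destruct u as [u1 u2].
      destruct Hk' as [->|[->|[->| ->]]];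
      unfold Re, Im, Cminus, Cplus, Copp, Cmult, RtoC, Ci in *; simpl in *; lra.
Qed.

(** * Regular values *)

Definition disc (gr : R) (M : C -> C) (z : C) : C := (RtoC 3 * (M z * M z) - RtoC 4 * RtoC gr)%C.

Definition solves_at (gr : R) (M : C -> C) (z : C) : Prop :=
  is_cderive M z (C_derive M z) /\
  (RtoC 81 * (C_derive M z * C_derive M z * (C_derive M z * C_derive M z)) =
   M z * M z * (disc gr M z * disc gr M z * disc gr M z))%C.

(* [wfun] is a square root of [disc] and [pfun] a square root of [M wfun / 4];
   in these variables the equation becomes the polynomial system
   M' = - 2/3 w p, w' = - 2 M p, p' = gr/3 - M^2/2. *)
Definition wfun (gr : R) (M : C -> C) (z : C) : C :=
  (RtoC 9 * (C_derive M z * C_derive M z) / (M z * disc gr M z))%C.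

Definition pfun (gr : R) (M : C -> C) (z : C) : C :=
  (RtoC (-3) * C_derive M z / (RtoC 2 * wfun gr M z))%C.

(** The expression of [M''] that the polynomial system yields; [p] disappears through
    [4 p^2 = M w]. *)
Definition M2fun (gr : R) (M : C -> C) (z : C) : C :=
  (wfun gr M z * (RtoC 6 * (M z * M z) - RtoC 2 * RtoC gr) / RtoC 9)%C.

Definition regular_value (gr : R) (M : C -> C) (z : C) : Prop :=
  M z <> RtoC 0 /\ disc gr M z <> RtoC 0.

Lemma RtoC_neq (x : R) : x <> 0 -> RtoC x <> RtoC 0.
Proof. intros H E; apply H; injection E; auto. Qed.

Ltac Cneq0 :=
  repeat match goal with |- Cmult _ _ = _ -> False => apply Cmult_neq_0 | |- Cmult _ _ <> _ => apply Cmult_neq_0 end;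
  first [assumption | apply RtoC_neq; lra].

(** The equation reads [(9 M'^2 / (M D))^2 = D]; the other relations follow from the choice of
    [pfun], and nothing vanishes because [M D] does not. *)
Lemma wfun_pfun_relations (gr : R) (M : C -> C) (z : C) :
  solves_at gr M z -> regular_value gr M z ->
  (wfun gr M z * wfun gr M z = disc gr M z)%C /\ wfun gr M z <> RtoC 0 /\
  pfun gr M z <> RtoC 0 /\
  (RtoC 4 * (pfun gr M z * pfun gr M z) = M z * wfun gr M z)%C /\
  (RtoC 3 * C_derive M z = RtoC (-2) * wfun gr M z * pfun gr M z)%C.
Proof.
  intros [_ H] [HM HD].
  set (m := M z) in *; set (D := disc gr M z) in *; set (m1 := C_derive M z) in *.
  set (w := wfun gr M z).
  assert (H9 : RtoC 9 <> RtoC 0) by (apply RtoC_neq; lra).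
  assert (H2 : RtoC 2 <> RtoC 0) by (apply RtoC_neq; lra).
  assert (H3 : RtoC (-3) <> RtoC 0) by (apply RtoC_neq; lra).
  assert (Hm1 : m1 <> RtoC 0).
  { intros E; assert (E0 : (m * m * (D * D * D) = 0)%C) by (rewrite <- H, E; ring).
    revert E0; Cneq0. }
  assert (Hw : (m * D * w = RtoC 9 * (m1 * m1))%C) by (unfold w, wfun; fold m D m1; field; auto).
  assert (Hw0 : w <> RtoC 0).
  { intros E; assert (E0 : (RtoC 9 * (m1 * m1) = 0)%C) by (rewrite <- Hw, E; ring).
    revert E0; Cneq0. }
  assert (HwD : (w * w = D)%C).
  { apply (Cmult_cancel_l (m * D * (m * D))%C); [Cneq0|].
    replace (m * D * (m * D) * (w * w))%C with ((m * D * w) * (m * D * w))%C by ring.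
    rewrite Hw; replace (RtoC 9 * (m1 * m1) * (RtoC 9 * (m1 * m1)))%C with (RtoC 81 * (m1 * m1 * (m1 * m1)))%C by ring.
    rewrite H; ring. }
  assert (Hp : pfun gr M z = (RtoC (-3) * m1 / (RtoC 2 * w))%C) by reflexivity.
  assert (Hpp : (RtoC 4 * (pfun gr M z * pfun gr M z) = m * w)%C).
  { apply (Cmult_cancel_l (w * w)%C); [apply Cmult_neq_0; exact Hw0|].
    replace (w * w * (RtoC 4 * (pfun gr M z * pfun gr M z)))%C with (RtoC 9 * (m1 * m1))%C
      by (rewrite Hp; field; auto).
    rewrite <- Hw, <- HwD; ring. }
  split; [exact HwD|split; [exact Hw0|split; [|split; [exact Hpp|]]]].
  - intros E; rewrite E in Hpp.
    assert (E0 : (m * w = 0)%C) by (rewrite <- Hpp; ring).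
    revert E0; apply Cmult_neq_0; assumption.
  - rewrite Hp; field; auto.
Qed.

Lemma filterlim_neq_0 (f : C -> C) (z : C) :
  filterlim f (locally z) (locally (f z)) -> f z <> RtoC 0 ->
  locally z (fun w => f w <> RtoC 0).
Proof.
  intros Hf Hz; assert (H0 : 0 < Cmod (f z)) by (apply Cmod_gt_0, Hz).
  destruct (proj1 (filterlim_cmod _ _ _) Hf _ H0) as [d [Hd H]].
  apply locally_C; exists d; split; [exact Hd|]; intros w Hw E; specialize (H w Hw).
  rewrite E in H; replace (0 - f z)%C with (- f z)%C in H by ring; rewrite Cmod_opp in H; lra.
Qed.

Lemma is_cderive_disc (gr : R) (M : C -> C) (z l : C) :
  is_cderive M z l -> is_cderive (disc gr M) z (RtoC 6 * M z * l)%C.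
Proof.
  intros H; replace (RtoC 6 * M z * l)%C with (RtoC 3 * (l * M z + M z * l) + RtoC 0)%C by ring.
  apply (is_cderive_plus (fun w => RtoC 3 * (M w * M w))%C (fun _ => - (RtoC 4 * RtoC gr))%C).
  - apply (is_cderive_scal (RtoC 3) (fun w => M w * M w)%C), is_cderive_mult; exact H.
  - apply is_cderive_const.
Qed.

Lemma regular_value_locally (gr : R) (M : C -> C) (z l : C) :
  is_cderive M z l -> regular_value gr M z -> locally z (fun w => regular_value gr M w).
Proof.
  intros H [H1 H2]; apply filter_and; apply filterlim_neq_0; auto;
    eapply is_cderive_continuous; [|apply is_cderive_disc]; exact H.
Qed.

Lemma is_cderive_rhs (gr : R) (M : C -> C) (z l : C) :
  is_cderive M z l ->
  is_cderive (fun w => RtoC (1 / 81) * (M w * M w * (disc gr M w * disc gr M w * disc gr M w)))%C z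
    (RtoC (1 / 81) * (RtoC 2 * M z * l * (disc gr M z * disc gr M z * disc gr M z)
       + M z * M z * (RtoC 18 * M z * l * (disc gr M z * disc gr M z))))%C.
Proof.
  intros H; apply (is_cderive_scal _ (fun w => M w * M w * (disc gr M w * disc gr M w * disc gr M w))%C).
  pose proof (is_cderive_disc gr M z l H) as HD.
  pose proof (is_cderive_mult _ _ _ _ _ H H) as HMM; simpl in HMM.
  pose proof (is_cderive_mult _ _ _ _ _ (is_cderive_mult _ _ _ _ _ HD HD) HD) as HDDD; simpl in HDDD.
  pose proof (is_cderive_mult _ _ _ _ _ HMM HDDD) as HH; simpl in HH.
  match type of HH with is_derive _ _ ?X => match goal with |- is_derive _ _ ?Y => replace Y with X by ring end end.
  exact HH.
Qed.

Lemma inv81 (x y : C) : (RtoC 81 * x = y)%C <-> (x = RtoC (1 / 81) * y)%C.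
Proof.
  assert (H : RtoC 81 <> RtoC 0) by (apply RtoC_neq; lra).
  replace (RtoC (1 / 81)) with (/ RtoC 81)%C by (rewrite <- RtoC_inv by lra; f_equal; field).
  split; [intros <-|intros ->]; field; exact H.
Qed.

(** [M'^4] is a polynomial in [M], hence differentiable. Once [M'] is known to be continuous, two
    extractions of a square root transfer this to [M'^2] and to [M']. *)
Lemma is_cderive_derivative (gr : R) (M : C -> C) (z : C) :
  locally z (solves_at gr M) -> regular_value gr M z ->
  is_cderive (C_derive M) z (M2fun gr M z).
Proof.
  intros HS HR.
  pose proof (locally_C_ex _ _ HS) as Hz.
  destruct (wfun_pfun_relations gr M z Hz HR) as [HwD [Hw0 [Hp0 [Hp Hm1]]]].
  destruct Hz as [Hd He]; destruct HR as [HM HD].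
  set (F := fun w => (RtoC (1 / 81) * (M w * M w * (disc gr M w * disc gr M w * disc gr M w)))%C).
  assert (H81 : RtoC (1 / 81) <> RtoC 0) by (apply RtoC_neq; lra).
  assert (H2 : RtoC 2 <> RtoC 0) by (apply RtoC_neq; lra).
  assert (H3 : RtoC 3 <> RtoC 0) by (apply RtoC_neq; lra).
  assert (H9 : RtoC 9 <> RtoC 0) by (apply RtoC_neq; lra).
  assert (H0' : RtoC (-2) <> RtoC 0) by (apply RtoC_neq; lra).
  assert (HF0 : F z <> RtoC 0) by (unfold F; Cneq0).
  pose proof (is_cderive_rhs gr M z _ Hd) as HF.
  assert (Hm10 : C_derive M z <> RtoC 0).
  { intros E; rewrite E in Hm1.
    assert (X : (RtoC (-2) * wfun gr M z * pfun gr M z = 0)%C) by (rewrite <- Hm1; ring).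
    revert X; Cneq0. }
  assert (HS' : locally z (fun w => is_cderive M w (C_derive M w) /\
    (C_derive M w * C_derive M w * (C_derive M w * C_derive M w) = F w)%C)).
  { revert HS; apply filter_imp; intros w [A B]; split; [exact A|]; apply inv81, B. }
  assert (Hc : filterlim (C_derive M) (locally z) (locally (C_derive M z))).
  { apply (fourth_root_derivative_continuous M (C_derive M) F z HS'); [|exact HF0].
    eapply is_cderive_continuous; exact HF. }
  apply (is_cderive_sqrt _ (fun w => C_derive M w * C_derive M w)%C); [exact Hc|exact Hm10| |].
  { apply filter_forall; reflexivity. }
  apply (is_cderive_sqrt _ F).
  - apply filterlim_csquare, Hc.
  - apply Cmult_neq_0; assumption.
  - revert HS'; apply filter_imp; intros w [_ A]; exact A.
  - match type of HF with is_derive _ _ ?X => match goal with |- is_derive _ _ ?Y => replace Y with X; [exact HF|] end end.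
    unfold M2fun.
    set (m := M z) in *; set (D := disc gr M z) in *; set (m1 := C_derive M z) in *.
    set (w := wfun gr M z) in *; set (p := pfun gr M z) in *.
    (* [gr], [M'] and [M] are rational functions of [w] and [p]; substituting them leaves an
       identity of rational functions in two free variables. *)
    assert (Eg : (RtoC 2 * RtoC gr = (RtoC 3 * (m * m) - w * w) / RtoC 2)%C).
    { rewrite HwD; unfold D, disc; fold m; field; exact H2. }
    assert (Em1 : m1 = (RtoC (-2) * w * p / RtoC 3)%C) by (rewrite <- Hm1; field; exact H3).
    assert (Em : m = (RtoC 4 * (p * p) / w)%C) by (rewrite Hp; field; exact Hw0).
    replace (RtoC (1 / 81)) with (/ RtoC 81)%C by (rewrite <- RtoC_inv by lra; f_equal; field).
    rewrite Eg, <- HwD, Em1, Em; field.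
    repeat split; Cneq0.
Qed.

Lemma is_cderive_wfun (gr : R) (M : C -> C) (z : C) :
  locally z (solves_at gr M) -> regular_value gr M z ->
  is_cderive (wfun gr M) z (RtoC (-2) * M z * pfun gr M z)%C.
Proof.
  intros HS HR.
  pose proof (locally_C_ex _ _ HS) as Hz.
  destruct (wfun_pfun_relations gr M z Hz HR) as [HwD [Hw0 [Hp0 [Hp Hm1]]]].
  pose proof (is_cderive_derivative gr M z HS HR) as H1.
  destruct Hz as [Hd He].
  assert (H2 : RtoC 2 <> RtoC 0) by (apply RtoC_neq; lra).
  assert (H3 : RtoC 3 <> RtoC 0) by (apply RtoC_neq; lra).
  assert (H9 : RtoC 9 <> RtoC 0) by (apply RtoC_neq; lra).
  pose proof (is_cderive_inv _ _ _ (is_cderive_mult _ _ _ _ _ Hd (is_cderive_disc gr M z _ Hd))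
    (Cmult_neq_0 _ _ (proj1 HR) (proj2 HR))) as Hi; simpl in Hi.
  pose proof (is_cderive_mult _ _ _ _ _ (is_cderive_scal (RtoC 9) _ _ _ (is_cderive_mult _ _ _ _ _ H1 H1)) Hi) as HH; simpl in HH.
  match type of HH with is_derive _ _ ?X => match goal with |- is_derive _ _ ?Y => replace Y with X; [exact HH|] end end.
  unfold M2fun.
  set (m := M z) in *; set (D := disc gr M z) in *; set (m1 := C_derive M z) in *.
  set (w := wfun gr M z) in *; set (p := pfun gr M z) in *.
  assert (Eg : (RtoC 2 * RtoC gr = (RtoC 3 * (m * m) - w * w) / RtoC 2)%C).
  { rewrite HwD; unfold D, disc; fold m; field; exact H2. }
  assert (Em1 : m1 = (RtoC (-2) * w * p / RtoC 3)%C) by (rewrite <- Hm1; field; exact H3).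
  assert (Em : m = (RtoC 4 * (p * p) / w)%C) by (rewrite Hp; field; exact Hw0).
  rewrite Eg, <- HwD, Em1, Em; field.
  repeat split; Cneq0.
Qed.

Lemma is_cderive_pfun (gr : R) (M : C -> C) (z : C) :
  locally z (solves_at gr M) -> regular_value gr M z ->
  is_cderive (pfun gr M) z (RtoC (gr / 3) - RtoC (1 / 2) * (M z * M z))%C.
Proof.
  intros HS HR.
  pose proof (locally_C_ex _ _ HS) as Hz.
  destruct (wfun_pfun_relations gr M z Hz HR) as [HwD [Hw0 [Hp0 [Hp Hm1]]]].
  pose proof (is_cderive_derivative gr M z HS HR) as H1.
  pose proof (is_cderive_wfun gr M z HS HR) as Hw.
  assert (H2 : RtoC 2 <> RtoC 0) by (apply RtoC_neq; lra).
  assert (H3 : RtoC 3 <> RtoC 0) by (apply RtoC_neq; lra).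
  pose proof (is_cderive_inv _ _ _ (is_cderive_scal (RtoC 2) _ _ _ Hw)
    (Cmult_neq_0 _ _ H2 Hw0)) as Hi; simpl in Hi.
  pose proof (is_cderive_mult _ _ _ _ _ (is_cderive_scal (RtoC (-3)) _ _ _ H1) Hi) as HH; simpl in HH.
  match type of HH with is_derive _ _ ?X => match goal with |- is_derive _ _ ?Y => replace Y with X; [exact HH|] end end.
  unfold M2fun.
  set (m := M z) in *; set (D := disc gr M z) in *; set (m1 := C_derive M z) in *.
  set (w := wfun gr M z) in *; set (p := pfun gr M z) in *.
  assert (Eg : (RtoC gr = (RtoC 3 * (m * m) - w * w) / RtoC 4)%C).
  { rewrite HwD; unfold D, disc; fold m; field; apply RtoC_neq; lra. }
  assert (Em1 : m1 = (RtoC (-2) * w * p / RtoC 3)%C) by (rewrite <- Hm1; field; exact H3).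
  assert (Em : m = (RtoC 4 * (p * p) / w)%C) by (rewrite Hp; field; exact Hw0).
  rewrite !RtoC_div by lra; rewrite Eg, Em1, Em; field.
  repeat split; Cneq0.
Qed.

(** Here [M''' = 4 M p (gr - M^2)] and [2 M M'' - M'^2 = M^3 w = 4 M^2 p^2]. The value of [M''] is
    part of the conclusion because the estimates near exceptional points use it. *)
Lemma third_order_at_regular_value (gr : R) (M : C -> C) (z : C) :
  locally z (solves_at gr M) -> regular_value gr M z ->
  C_derive (C_derive M) z = M2fun gr M z /\
  (RtoC (1 / 4) * C_derive (C_derive (C_derive M)) z ^ 2
   - (RtoC 2 * M z * C_derive (C_derive M) z - C_derive M z ^ 2) * (M z ^ 2 - RtoC gr) ^ 2 = RtoC 0)%C.
Proof.
  intros HS HR.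
  pose proof (locally_C_ex _ _ HS) as Hz.
  destruct (wfun_pfun_relations gr M z Hz HR) as [HwD [Hw0 [Hp0 [Hp Hm1]]]].
  pose proof (is_cderive_derivative gr M z HS HR) as H1.
  pose proof (is_cderive_wfun gr M z HS HR) as Hw.
  pose proof (proj1 Hz) as Hd.
  assert (H2 : RtoC 2 <> RtoC 0) by (apply RtoC_neq; lra).
  assert (H3 : RtoC 3 <> RtoC 0) by (apply RtoC_neq; lra).
  assert (E2 : C_derive (C_derive M) z = M2fun gr M z) by (apply is_cderive_unique, H1).
  split; [exact E2|].
  assert (L : locally z (fun y => M2fun gr M y = C_derive (C_derive M) y)).
  { apply locally_locally in HS; pose proof (regular_value_locally gr M z _ Hd HR) as HL.
    generalize (filter_and _ _ HS HL); apply filter_imp; intros y [A B].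
    symmetry; apply is_cderive_unique, is_cderive_derivative; assumption. }
  assert (E3 : C_derive (C_derive (C_derive M)) z = (RtoC 4 * M z * pfun gr M z * (RtoC gr - M z * M z))%C).
  { apply is_cderive_unique; apply (is_cderive_ext_loc _ _ _ _ L).
    pose proof (is_cderive_mult _ _ _ _ _ (is_cderive_mult _ _ _ _ _ Hw
      (is_cderive_plus _ _ _ _ _ (is_cderive_scal (RtoC 6) _ _ _ (is_cderive_mult _ _ _ _ _ Hd Hd))
        (is_cderive_const (- (RtoC 2 * RtoC gr))%C z))) (is_cderive_const (/ RtoC 9)%C z)) as HH.
    simpl in HH.
    match type of HH with is_derive _ _ ?X => match goal with |- is_derive _ _ ?Y => replace Y with X; [exact HH|] end end.
    set (m := M z) in *; set (D := disc gr M z) in *; set (m1 := C_derive M z) in *.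
    set (w := wfun gr M z) in *; set (p := pfun gr M z) in *.
    assert (Eg : (RtoC gr = (RtoC 3 * (m * m) - w * w) / RtoC 4)%C).
    { rewrite HwD; unfold D, disc; fold m; field; apply RtoC_neq; lra. }
    assert (Em1 : m1 = (RtoC (-2) * w * p / RtoC 3)%C) by (rewrite <- Hm1; field; exact H3).
    assert (Em : m = (RtoC 4 * (p * p) / w)%C) by (rewrite Hp; field; exact Hw0).
    rewrite Eg, Em1, Em; field.
    repeat split; Cneq0. }
  rewrite E3, E2; unfold M2fun.
  set (m := M z) in *; set (D := disc gr M z) in *; set (m1 := C_derive M z) in *.
  set (w := wfun gr M z) in *; set (p := pfun gr M z) in *.
  assert (Eg : (RtoC gr = (RtoC 3 * (m * m) - w * w) / RtoC 4)%C).
  { rewrite HwD; unfold D, disc; fold m; field; apply RtoC_neq; lra. }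
  assert (Em1 : m1 = (RtoC (-2) * w * p / RtoC 3)%C) by (rewrite <- Hm1; field; exact H3).
  assert (Em : m = (RtoC 4 * (p * p) / w)%C) by (rewrite Hp; field; exact Hw0).
  rewrite !RtoC_div by lra; rewrite Eg, Em1, Em; field.
  repeat split; Cneq0.
Qed.

(** * Zeros of the discriminant *)

Lemma pow_le_reg (n : nat) (a b : R) : 0 <= b -> a ^ S n <= b ^ S n -> a <= b.
Proof.
  intros Hb H; destruct (Rle_lt_dec a b) as [|L]; [assumption|].
  exfalso; apply (Rle_not_lt _ _ H); clear H; induction n as [|n IH]; [simpl; lra|].
  change (b * b ^ S n < a * a ^ S n).
  pose proof (pow_le b (S n) Hb); nra.
Qed.

Lemma Cmod_segment (z w : C) (t : R) :
  0 <= t <= 1 -> Cmod ((z + RtoC t * (w - z)) - z)%C <= Cmod (w - z)%C.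
Proof.
  intros Ht; replace ((z + RtoC t * (w - z)) - z)%C with (RtoC t * (w - z))%C by ring.
  rewrite Cmod_mult, Cmod_R, Rabs_right by lra; pose proof (Cmod_ge_0 (w - z)%C); nra.
Qed.

(** Let [m] be the maximum of [|M - M z|] on the segment from [z] to [w], of length [rho]. The mean
    value inequality gives [m <= rho (K m^k)^(1/4)]; for [k < 4] a power of [m] cancels and leaves
    [m^(4-k) <= K rho^4]. *)
Lemma flat_at_zero_of_derivative (M M1 : C -> C) (z : C) (r K : R) (k : nat) :
  0 <= K -> (k < 4)%nat ->
  (forall w, Cmod (w - z)%C < r -> is_cderive M w (M1 w)) ->
  (forall w, Cmod (w - z)%C < r -> Cmod (M1 w) ^ 4 <= K * Cmod (M w - M z)%C ^ k) ->
  forall w, Cmod (w - z)%C < r -> Cmod (M w - M z)%C ^ (4 - k) <= K * Cmod (w - z)%C ^ 4.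
Proof.
  intros HK Hk Hd Hb w Hw.
  set (v := (w - z)%C) in *.
  set (rho := Cmod v) in *; assert (Hrho : 0 <= rho) by apply Cmod_ge_0.
  set (h := fun t => (M (z + RtoC t * v) - (fun _ => M z) t)%C).
  assert (Hin : forall t, 0 <= t <= 1 -> Cmod ((z + RtoC t * v) - z)%C < r).
  { intros t Ht; eapply Rle_lt_trans; [apply Cmod_segment, Ht|exact Hw]. }
  assert (Hder : forall t, 0 <= t <= 1 -> path_der h t (v * M1 (z + RtoC t * v)%C - 0)%C).
  { intros t Ht; apply path_der_minus; [apply path_der_line, Hd, Hin, Ht|].
    intros c; replace (Re (c * 0)%C) with 0 by (unfold Re, Cmult, RtoC; simpl; ring).
    apply (is_derive_const (K := R_AbsRing) (V := R_NormedModule)). }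
  assert (Hcont : forall t, 0 <= t <= 1 -> path_cont h t).
  { intros t Ht c; apply derivable_continuous_pt; eexists; apply is_derive_Reals, Hder, Ht. }
  destruct (path_max h 0 1 Rle_0_1 Hcont) as [s [Hs Hmax]].
  set (m := Cmod (h s)) in *; assert (Hm : 0 <= m) by apply Cmod_ge_0.
  assert (Hmk : 0 <= K * m ^ k) by (apply Rmult_le_pos; [exact HK|apply pow_le, Hm]).
  set (q := sqrt (sqrt (K * m ^ k))).
  assert (Hq : 0 <= q) by apply sqrt_pos.
  assert (Hq4 : q ^ 4 = K * m ^ k).
  { replace (q ^ 4) with ((q * q) * (q * q)) by ring; unfold q.
    rewrite !sqrt_sqrt; auto using sqrt_pos. }
  assert (Hh0 : h 0 = RtoC 0) by (unfold h; replace (z + RtoC 0 * v)%C with z by ring; ring).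
  assert (Hle : m <= rho * q).
  { assert (X : Cmod (h s - h 0)%C <= (rho * q) * (s - 0)).
    { apply path_mean_value with (fun t => (v * M1 (z + RtoC t * v)%C - 0)%C).
      - lra.
      - intros t Ht; apply Hcont; lra.
      - intros t Ht; apply Hder; lra.
      - intros t Ht; replace (v * M1 (z + RtoC t * v)%C - 0)%C with (v * M1 (z + RtoC t * v)%C)%C by ring.
        rewrite Cmod_mult; apply Rmult_le_compat_l; [exact Hrho|].
        apply (pow_le_reg 3); [exact Hq|]; rewrite Hq4.
        eapply Rle_trans; [apply Hb, Hin; lra|].
        apply Rmult_le_compat_l; [exact HK|]; apply pow_incr; split; [apply Cmod_ge_0|].
        apply (Hmax t); lra. }
    rewrite Hh0 in X; replace (h s - 0)%C with (h s) in X by ring; fold m in X.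
    assert (0 <= rho * q) by nra. nra. }
  assert (Hfin : m ^ (4 - k) <= K * rho ^ 4).
  { destruct (Rle_lt_or_eq_dec 0 m Hm) as [Hp|<-].
    - assert (Hpk : 0 < m ^ k) by (apply pow_lt, Hp).
      apply Rmult_le_reg_l with (m ^ k); [exact Hpk|].
      rewrite <- pow_add; replace (k + (4 - k))%nat with 4%nat by lia.
      replace (m ^ k * (K * rho ^ 4)) with (rho ^ 4 * q ^ 4) by (rewrite Hq4; ring).
      rewrite <- Rpow_mult_distr; apply pow_incr; split; assumption.
    - rewrite pow_i by lia; apply Rmult_le_pos; [exact HK|apply pow_le, Hrho]. }
  eapply Rle_trans; [|exact Hfin].
  apply pow_incr; split; [apply Cmod_ge_0|].
  specialize (Hmax 1 ltac:(lra)); unfold h in Hmax at 1.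
  replace (z + RtoC 1 * v)%C with w in Hmax by (unfold v; ring); exact Hmax.
Qed.

Lemma solves_modulus (gr : R) (M : C -> C) (w : C) :
  solves_at gr M w ->
  81 * Cmod (C_derive M w) ^ 4 = Cmod (M w) ^ 2 * Cmod (disc gr M w) ^ 3.
Proof.
  intros [_ H]; apply (f_equal Cmod) in H; rewrite !Cmod_mult, Cmod_R, Rabs_right in H by lra.
  simpl; lra.
Qed.

(** The points near [z] with [M = e] are not known to be isolated, so [M - e = O(x^4)] is proved
    around each of them with one constant [K]. It entails [M' = O(x^3)], and [w = O(x^2)] from
    [w^2 = D], hence [M'' = O(x^2)]. *)
Lemma third_order_at_disc_zero (gr : R) (M : C -> C) (z : C) :
  gr <> 0 -> locally z (solves_at gr M) -> disc gr M z = RtoC 0 ->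
  C_derive (C_derive M) z = RtoC 0 /\ C_derive (C_derive (C_derive M)) z = RtoC 0 /\ C_derive M z = RtoC 0.
Proof.
  intros Hg HS HD.
  pose proof (is_cderive_continuous _ _ _ (proj1 (locally_C_ex _ _ HS))) as Hc.
  set (e := M z) in *.
  assert (He : e <> RtoC 0).
  { intros E; unfold disc in HD; fold e in HD; rewrite E in HD.
    assert (X : (RtoC 4 * RtoC gr = 0)%C).
    { replace (RtoC 4 * RtoC gr)%C with (- (RtoC 3 * (0 * 0) - RtoC 4 * RtoC gr))%C by ring.
      rewrite HD; ring. }
    revert X; apply Cmult_neq_0; apply RtoC_neq; lra. }
  assert (He' : 0 < Cmod e) by (apply Cmod_gt_0, He).
  assert (H1 : 0 < Rmin 1 (Cmod e)) by (apply Rmin_glb_lt; lra).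
  destruct (proj1 (filterlim_cmod _ _ _) Hc _ H1) as [d1 [Hd1 Hc1]].
  destruct (proj1 (locally_C _ _) HS) as [d2 [Hd2 HS2]].
  set (r := Rmin 1 (Rmin d1 d2)).
  assert (Hr : 0 < r) by (repeat apply Rmin_glb_lt; lra).
  assert (Hr1 : r <= 1) by apply Rmin_l.
  assert (Hrd1 : r <= d1) by (eapply Rle_trans; [apply Rmin_r|apply Rmin_l]).
  assert (Hrd2 : r <= d2) by (eapply Rle_trans; [apply Rmin_r|apply Rmin_r]).
  assert (HSr : forall w, Cmod (w - z)%C < r -> solves_at gr M w) by (intros w Hw; apply HS2; lra).
  assert (Hne : forall w, Cmod (w - z)%C < r -> Cmod (M w - e)%C < 1 /\ Cmod (M w - e)%C < Cmod e).
  { intros w Hw; specialize (Hc1 w ltac:(lra)); split; eapply Rlt_le_trans; try exact Hc1; [apply Rmin_l|apply Rmin_r]. }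
  (* [3 e^2 = 4 gr], so [D] factors as [3 (M - e) (M + e)]. *)
  assert (Hdisc : forall w, disc gr M w = (RtoC 3 * (M w - e) * ((M w - e) + RtoC 2 * e))%C).
  { intros w; transitivity (disc gr M w - disc gr M z)%C; [rewrite HD; ring|].
    unfold disc; fold e; ring. }
  (* Bounds both [|M|] and [|M + e|], as [|M - e| < 1] on the ball. *)
  set (B := 2 * Cmod e + 1).
  assert (HB : 0 < B) by (unfold B; lra).
  assert (HM : forall w, Cmod (w - z)%C < r -> Cmod (M w) <= B).
  { intros w Hw; pose proof (Cmod_triangle (M w - e)%C e) as T.
    replace (M w - e + e)%C with (M w) in T by ring; destruct (Hne w Hw); unfold B; lra. }
  assert (HDb : forall w, Cmod (w - z)%C < r -> Cmod (disc gr M w) <= 3 * B * Cmod (M w - e)%C).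
  { intros w Hw; rewrite Hdisc, !Cmod_mult, Cmod_R, Rabs_right by lra.
    pose proof (Cmod_triangle (M w - e)%C (RtoC 2 * e)%C) as T.
    rewrite Cmod_mult, Cmod_R, Rabs_right in T by lra; destruct (Hne w Hw).
    pose proof (Cmod_ge_0 (M w - e)%C); unfold B; nra. }
  set (K := B ^ 2 * (3 * B) ^ 3).
  assert (HK : 0 <= K) by (apply Rmult_le_pos; apply pow_le; lra).
  assert (HM1 : forall w, Cmod (w - z)%C < r -> Cmod (C_derive M w) ^ 4 <= K * Cmod (M w - e)%C ^ 3).
  { intros w Hw; pose proof (solves_modulus _ _ _ (HSr w Hw)) as E.
    pose proof (pow_le (Cmod (C_derive M w)) 4 (Cmod_ge_0 _)).
    assert (Cmod (M w) ^ 2 * Cmod (disc gr M w) ^ 3 <= K * Cmod (M w - e)%C ^ 3); [|lra].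
    unfold K; rewrite Rmult_assoc, <- Rpow_mult_distr.
    apply Rmult_le_compat; try (apply pow_le, Cmod_ge_0); apply pow_incr; split; auto using Cmod_ge_0. }
  assert (Hflat : forall u, Cmod (u - z)%C < r / 2 -> M u = e ->
     forall w, Cmod (w - u)%C < r / 2 -> Cmod (M w - e)%C <= K * Cmod (w - u)%C ^ 4).
  { intros u Hu Eu w Hw; rewrite <- (pow_1 (Cmod (M w - e)%C)), <- Eu.
    assert (T : forall y, Cmod (y - u)%C < r / 2 -> Cmod (y - z)%C < r).
    { intros y Hy; replace (y - z)%C with ((y - u) + (u - z))%C by ring.
      eapply Rle_lt_trans; [apply Cmod_triangle|lra]. }
    apply (flat_at_zero_of_derivative M (C_derive M) u (r / 2) K 3); auto with arith.
    - intros y Hy; apply HSr, T, Hy.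
    - intros y Hy; rewrite Eu; apply HM1, T, Hy. }
  assert (Hz0 : C_derive M z = RtoC 0).
  { apply Cmod_eq_0; assert (Z : Cmod (z - z)%C < r) by (replace (z - z)%C with (RtoC 0) by ring; rewrite Cmod_0; lra).
    specialize (HM1 z Z); fold e in HM1; replace (e - e)%C with (RtoC 0) in HM1 by ring.
    rewrite Cmod_0 in HM1; apply Rle_antisym; [|apply Cmod_ge_0].
    apply (pow_le_reg 3); lra. }
  (* Needed at every nearby [u] with [M u = e], since the formula [M2fun] is established only at
     regular values. *)
  assert (Hder0 : forall u, Cmod (u - z)%C < r / 2 -> M u = e -> C_derive (C_derive M) u = RtoC 0).
  { intros u Hu Eu; apply is_cderive_unique.
    apply is_cderive_quadratic with (K := K) (d := r / 2); [lra|].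
    intros w Hw.
    assert (T : Cmod (w - z)%C < r).
    { replace (w - z)%C with ((w - u) + (u - z))%C by ring.
      eapply Rle_lt_trans; [apply Cmod_triangle|lra]. }
    assert (Hu1 : C_derive M u = RtoC 0).
    { apply Cmod_eq_0; specialize (HM1 u ltac:(lra)); rewrite Eu in HM1.
      replace (e - e)%C with (RtoC 0) in HM1 by ring.
      rewrite Cmod_0 in HM1; apply Rle_antisym; [|apply Cmod_ge_0].
      apply (pow_le_reg 3); lra. }
    rewrite Hu1; replace (C_derive M w - 0 - (w - u) * 0)%C with (C_derive M w) by ring.
    pose proof (Cmod_ge_0 (w - u)%C) as Hx; set (x := Cmod (w - u)%C) in *.
    apply (pow_le_reg 3); [apply Rmult_le_pos; [exact HK|apply pow_le, Hx]|].
    eapply Rle_trans; [apply HM1, T|].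
    (* [|M'|^4 <= K^4 x^12], and [x <= 1] turns this into the fourth power of [K x^2]. *)
    apply Rle_trans with (K * (K * x ^ 4) ^ 3).
    { apply Rmult_le_compat_l; [exact HK|]; apply pow_incr; split; [apply Cmod_ge_0|]; apply (Hflat u Hu Eu w Hw). }
    rewrite !Rpow_mult_distr, <- !pow_mult; simpl (4 * 3)%nat; simpl (2 * 4)%nat.
    assert (x ^ 12 <= x ^ 8).
    { replace (x ^ 12) with (x ^ 8 * x ^ 4) by ring.
      assert (x ^ 4 <= 1) by (apply Rle_trans with (1 ^ 4); [apply pow_incr; lra|lra]).
      pose proof (pow_le x 8 Hx); nra. }
    replace (K * (K ^ 3 * x ^ 12)) with (K ^ 4 * x ^ 12) by ring.
    apply Rmult_le_compat_l; [apply pow_le, HK|assumption]. }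
  assert (HM2z : C_derive (C_derive M) z = RtoC 0).
  { apply Hder0; [|reflexivity]; replace (z - z)%C with (RtoC 0) by ring; rewrite Cmod_0; lra. }
  split; [exact HM2z|split; [|exact Hz0]].
  apply is_cderive_unique.
  (* From [|w|^2 = |D| <= 3 B |M - e| <= 3 B K x^4] and [M'' = w (6 M^2 - 2 gr) / 9]; the 9 is
     dropped. *)
  set (L := sqrt (3 * B * K) * (6 * B ^ 2 + 2 * Rabs gr)).
  assert (HL0 : 0 <= 6 * B ^ 2 + 2 * Rabs gr) by (pose proof (Rabs_pos gr); pose proof (pow2_ge_0 B); lra).
  assert (HL : 0 <= L) by (apply Rmult_le_pos; [apply sqrt_pos|exact HL0]).
  apply is_cderive_quadratic with (K := L) (d := r / 2); [lra|].
  intros w Hw; rewrite HM2z.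
  replace (C_derive (C_derive M) w - 0 - (w - z) * 0)%C with (C_derive (C_derive M) w) by ring.
  pose proof (Cmod_ge_0 (w - z)%C) as Hx; set (x := Cmod (w - z)%C) in *.
  destruct (Ceq_dec (M w) e) as [E|N].
  { rewrite (Hder0 w Hw E), Cmod_0; apply Rmult_le_pos; [exact HL|apply pow_le, Hx]. }
  assert (Hwr : Cmod (w - z)%C < r) by (fold x; lra).
  assert (HR : regular_value gr M w).
  { destruct (Hne w Hwr) as [_ A]; split.
    - intros E; rewrite E in A; replace (0 - e)%C with (- e)%C in A by ring; rewrite Cmod_opp in A; lra.
    - rewrite Hdisc; apply Cmult_neq_0; [apply Cmult_neq_0; [apply RtoC_neq; lra|]|].
      + intros E; apply N; replace (M w) with (M w - e + e)%C by ring; rewrite E; ring.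
      + intros E; assert (X : (M w - e = - (RtoC 2 * e))%C).
        { replace (M w - e)%C with (M w - e + RtoC 2 * e - RtoC 2 * e)%C by ring; rewrite E; ring. }
        rewrite X, Cmod_opp, Cmod_mult, Cmod_R, Rabs_right in A by lra; lra. }
  assert (HSw : locally w (solves_at gr M)).
  { apply locally_C; exists (r - x); split; [unfold x; lra|]; intros y Hy; apply HSr.
    replace (y - z)%C with ((y - w) + (w - z))%C by ring.
    eapply Rle_lt_trans; [apply Cmod_triangle|fold x; lra]. }
  destruct (third_order_at_regular_value gr M w HSw HR) as [-> _].
  destruct (wfun_pfun_relations gr M w (HSr w Hwr) HR) as [HwD _].
  apply (f_equal Cmod) in HwD; rewrite Cmod_mult in HwD.
  assert (Hwf : Cmod (wfun gr M w) <= sqrt (3 * B * K) * x ^ 2).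
  { apply (pow_le_reg 1); [apply Rmult_le_pos; [apply sqrt_pos|apply pow_le, Hx]|].
    assert (0 <= 3 * B * K) by (apply Rmult_le_pos; lra).
    replace ((sqrt (3 * B * K) * x ^ 2) ^ 2) with (sqrt (3 * B * K) * sqrt (3 * B * K) * x ^ 4) by ring.
    rewrite sqrt_sqrt by assumption.
    replace (Cmod (wfun gr M w) ^ 2) with (Cmod (wfun gr M w) * Cmod (wfun gr M w)) by ring.
    rewrite HwD; eapply Rle_trans; [apply HDb, Hwr|].
    rewrite !Rmult_assoc; apply Rmult_le_compat_l; [lra|]; apply Rmult_le_compat_l; [lra|].
    apply (Hflat z); [|reflexivity|exact Hw].
    replace (z - z)%C with (RtoC 0) by ring; rewrite Cmod_0; lra. }
  unfold M2fun, Cdiv; rewrite !Cmod_mult, Cmod_inv, Cmod_R, Rabs_right by (try lra; apply RtoC_neq; lra).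
  assert (Hpoly : Cmod (RtoC 6 * (M w * M w) - RtoC 2 * RtoC gr)%C <= 6 * B ^ 2 + 2 * Rabs gr).
  { eapply Rle_trans; [apply Cmod_triangle|]; rewrite Cmod_opp, !Cmod_mult, !Cmod_R, !(Rabs_right 6), !(Rabs_right 2) by lra.
    specialize (HM w Hwr); pose proof (Cmod_ge_0 (M w)); nra. }
  pose proof (Cmod_ge_0 (wfun gr M w)); pose proof (Cmod_ge_0 (RtoC 6 * (M w * M w) - RtoC 2 * RtoC gr)%C).
  set (a := Cmod (wfun gr M w)) in *; set (b := Cmod (RtoC 6 * (M w * M w) - RtoC 2 * RtoC gr)%C) in *.
  assert (a * b <= sqrt (3 * B * K) * x ^ 2 * (6 * B ^ 2 + 2 * Rabs gr)) by (apply Rmult_le_compat; assumption).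
  unfold L; assert (0 <= a * b) by (apply Rmult_le_pos; assumption). lra.
Qed.

(** * Zeros of nearly translational flows *)

Lemma ball_convex (z0 z w : C) (r t : R) :
  Cmod (z - z0)%C < r -> Cmod (w - z0)%C < r -> 0 <= t <= 1 ->
  Cmod ((z + RtoC t * (w - z)) - z0)%C < r.
Proof.
  intros Hz Hw Ht.
  replace ((z + RtoC t * (w - z)) - z0)%C with (RtoC (1 - t) * (z - z0) + RtoC t * (w - z0))%C
    by (rewrite RtoC_minus; ring).
  eapply Rle_lt_trans; [apply Cmod_triangle|].
  rewrite !Cmod_mult, !Cmod_R, !Rabs_right by lra.
  destruct (Rle_lt_dec t (1 / 2)); nra.
Qed.

(* Up to small Lipschitz errors, [p] behaves like w |-> c (w - u) off its zeros. *)
Definition near_translation (p k : C -> C) (z0 c : C) (r L : R) : Prop :=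
  c <> RtoC 0 /\ 0 <= L /\ 16 * (L * r) <= 1 /\
  (forall w, Cmod (w - z0)%C < r -> filterlim p (locally w) (locally (p w))) /\
  (forall w, Cmod (w - z0)%C < r -> p w <> RtoC 0 -> is_cderive p w (k w)) /\
  (forall u v, Cmod (u - z0)%C < r -> Cmod (v - z0)%C < r ->
    Cmod (k u - k v)%C <= L * Cmod (p u - p v)%C) /\
  (forall w, Cmod (w - z0)%C < r -> 4 * Cmod (k w - c)%C <= Cmod c).

(** Both segments are run through simultaneously: [h], the difference of the values of [p], starts
    and ends at 0, although its derivative is close to the constant [(a - b) c]. With [d = |a - b|],
    the maximum [m] of [|h|] satisfies [m <= 5/4 d |c| + m / 8], and the vanishing total increment
    gives [d |c| <= d |c| / 4 + m / 8]; together they force [d = 0]. *)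
Lemma two_rays (p k : C -> C) (z0 c : C) (r L : R) (z u v : C) :
  near_translation p k z0 c r L ->
  Cmod (z - z0)%C < r -> Cmod (u - z0)%C < r -> Cmod (v - z0)%C < r ->
  p u = RtoC 0 -> p v = RtoC 0 ->
  (forall t, 0 < t <= 1 -> p (u + RtoC t * (z - u))%C <> RtoC 0) ->
  (forall t, 0 < t <= 1 -> p (v + RtoC t * (z - v))%C <> RtoC 0) ->
  u = v.
Proof.
  intros (Hc & HL & HLr & Hcont & Hder & Hlip & Hk) Hz Hu Hv Eu Ev Nu Nv.
  set (a := (z - u)%C) in *; set (b := (z - v)%C) in *.
  set (f := fun t : R => (u + RtoC t * a)%C); set (g := fun t : R => (v + RtoC t * b)%C).
  assert (Hf : forall t, 0 <= t <= 1 -> Cmod (f t - z0)%C < r) by (intros t Ht; apply ball_convex; assumption).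
  assert (Hg : forall t, 0 <= t <= 1 -> Cmod (g t - z0)%C < r) by (intros t Ht; apply ball_convex; assumption).
  set (h := fun t => (p (f t) - p (g t))%C).
  set (h' := fun t => (a * k (f t) - b * k (g t))%C).
  assert (Hh : forall t, 0 <= t <= 1 -> path_cont h t).
  { intros t Ht; apply path_cont_minus; apply path_cont_line, Hcont; [apply Hf|apply Hg]; exact Ht. }
  assert (Hh' : forall t, 0 < t < 1 -> path_der h t (h' t)).
  { intros t Ht; apply path_der_minus; apply path_der_line, Hder;
      [apply Hf|apply Nu|apply Hg|apply Nv]; lra. }
  assert (Hc0 : 0 < Cmod c) by (apply Cmod_gt_0, Hc).
  set (g0 := Cmod c) in *.
  (* The segments are at most [2 r] long, and [16 L r <= 1]. *)
  assert (Hb : L * Cmod b <= 1 / 8).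
  { assert (Cmod b <= 2 * r).
    { unfold b; replace (z - v)%C with ((z - z0) + - (v - z0))%C by ring.
      eapply Rle_trans; [apply Cmod_triangle|]; rewrite Cmod_opp; lra. }
    nra. }
  destruct (path_max h 0 1 Rle_0_1 Hh) as [s [Hs Hmax]].
  set (m := Cmod (h s)) in *; assert (Hm : 0 <= m) by apply Cmod_ge_0.
  set (d := Cmod (a - b)%C); assert (Hd : 0 <= d) by apply Cmod_ge_0.
  assert (Hdiff : forall t, 0 <= t <= 1 -> Cmod (b * (k (f t) - k (g t)))%C <= m / 8).
  { intros t Ht; rewrite Cmod_mult.
    specialize (Hlip (f t) (g t) (Hf t Ht) (Hg t Ht)); specialize (Hmax t Ht).
    fold (h t) in Hlip; pose proof (Cmod_ge_0 b); pose proof (Cmod_ge_0 (h t)).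
    apply Rle_trans with (Cmod b * (L * m)); [apply Rmult_le_compat_l; [assumption|nra]|nra]. }
  assert (Hh0 : h 0 = RtoC 0).
  { unfold h, f, g; replace (u + RtoC 0 * a)%C with u by ring; replace (v + RtoC 0 * b)%C with v by ring.
    rewrite Eu, Ev; ring. }
  assert (Hh1 : h 1 = RtoC 0).
  { unfold h, f, g; replace (u + RtoC 1 * a)%C with z by (unfold a; ring).
    replace (v + RtoC 1 * b)%C with z by (unfold b; ring); ring. }
  assert (M1 : m <= d * (5 / 4 * g0) + m / 8).
  { assert (X : Cmod (h s - h 0)%C <= (d * (5 / 4 * g0) + m / 8) * (s - 0)).
    { apply path_mean_value with h'; [lra|intros; apply Hh; lra|intros; apply Hh'; lra|].
      intros t Ht; unfold h'.
      replace (a * k (f t) - b * k (g t))%C with ((a - b) * k (f t) + b * (k (f t) - k (g t)))%C by ring.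
      eapply Rle_trans; [apply Cmod_triangle|]; rewrite Cmod_mult; fold d.
      assert (Cmod (k (f t)) <= 5 / 4 * g0).
      { pose proof (Cmod_triangle (k (f t) - c)%C c) as T.
        replace (k (f t) - c + c)%C with (k (f t)) in T by ring.
        specialize (Hk (f t) (Hf t ltac:(lra))); fold g0 in T; lra. }
      specialize (Hdiff t ltac:(lra)); nra. }
    rewrite Hh0 in X; replace (h s - 0)%C with (h s) in X by ring; fold m in X.
    assert (0 <= d * (5 / 4 * g0) + m / 8) by nra. nra. }
  (* Subtracting the uniform motion leaves a path whose increment over [0, 1] is exactly
     [- (a - b) c]. *)
  set (q := fun t => (h t - RtoC t * ((a - b) * c))%C).
  assert (X : Cmod (q 1 - q 0)%C <= (d * (g0 / 4) + m / 8) * (1 - 0)).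
  { apply path_mean_value with (fun t => (h' t - (a - b) * c)%C); [lra| | |].
    - intros t Ht; apply path_cont_minus; [apply Hh, Ht|apply path_cont_linear].
    - intros t Ht; apply path_der_minus; [apply Hh', Ht|apply path_der_linear].
    - intros t Ht; unfold h'.
      replace (a * k (f t) - b * k (g t) - (a - b) * c)%C with
        ((a - b) * (k (f t) - c) + b * (k (f t) - k (g t)))%C by ring.
      eapply Rle_trans; [apply Cmod_triangle|]; rewrite Cmod_mult; fold d.
      specialize (Hk (f t) (Hf t ltac:(lra))); fold g0 in Hk.
      specialize (Hdiff t ltac:(lra)); nra. }
  assert (Y : Cmod (q 1 - q 0)%C = d * g0).
  { unfold q; rewrite Hh0, Hh1.
    replace (0 - RtoC 1 * ((a - b) * c) - (0 - RtoC 0 * ((a - b) * c)))%C with (- ((a - b) * c))%C by ring.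
    rewrite Cmod_opp, Cmod_mult; reflexivity. }
  assert (Hd0 : d = 0).
  { rewrite Y in X; apply Rle_antisym; [|exact Hd].
    apply Rmult_le_reg_r with g0; [exact Hc0|]; nra. }
  apply Cmod_eq_0 in Hd0; unfold a, b in Hd0.
  replace u with (v - ((z - u) - (z - v)))%C by ring; rewrite Hd0; ring.
Qed.

(** This is the first zero met on the way from [z] to [u]: the way back from it to [z] meets no
    other, as [two_rays] requires. *)
Lemma visible_zero (p : C -> C) (z0 z u : C) (r : R) :
  (forall w, Cmod (w - z0)%C < r -> filterlim p (locally w) (locally (p w))) ->
  Cmod (z - z0)%C < r -> Cmod (u - z0)%C < r -> p z <> RtoC 0 -> p u = RtoC 0 ->
  exists s : R, 0 < s <= 1 /\ p (z + RtoC s * (u - z))%C = RtoC 0 /\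
    forall t, 0 < t <= 1 ->
      p ((z + RtoC s * (u - z)) + RtoC t * (z - (z + RtoC s * (u - z))))%C <> RtoC 0.
Proof.
  intros Hcont Hz Hu Nz Eu.
  set (h := fun t => p (z + RtoC t * (u - z))%C).
  assert (Hsq : forall t, Cmod (h t) * Cmod (h t) = 0 <-> h t = RtoC 0).
  { intros t; split; [intros H|intros ->; rewrite Cmod_0; ring].
    apply Cmod_eq_0; destruct (Rmult_integral _ _ H); assumption. }
  destruct (first_zero (fun t => Cmod (h t) * Cmod (h t))) as [s [Hs [Es Ns]]].
  - intros t Ht; apply path_cont_norm, path_cont_line, Hcont, ball_convex; assumption.
  - rewrite Hsq; unfold h; replace (z + RtoC 0 * (u - z))%C with z by ring; exact Nz.
  - apply Hsq; unfold h; replace (z + RtoC 1 * (u - z))%C with u by ring; exact Eu.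
  - exists s; split; [exact Hs|split; [apply Hsq, Es|]].
    intros t Ht.
    replace ((z + RtoC s * (u - z)) + RtoC t * (z - (z + RtoC s * (u - z))))%C with
      (z + RtoC (s * (1 - t)) * (u - z))%C by (rewrite RtoC_mult, RtoC_minus; ring).
    intros E; apply (Ns (s * (1 - t))); [nra|]; apply Hsq, E.
Qed.

(* The zeros seen from a non-zero z coincide by [two_rays], hence two distinct
   zeros force every non-zero onto the line through them. *)
Lemma two_zeros_all_zero (p k : C -> C) (z0 c : C) (r L : R) (u v : C) :
  near_translation p k z0 c r L ->
  Cmod (u - z0)%C < r -> Cmod (v - z0)%C < r -> u <> v -> p u = RtoC 0 -> p v = RtoC 0 ->
  forall z, Cmod (z - z0)%C < r -> p z = RtoC 0.
Proof.
  intros HT Hu Hv Huv Eu Ev.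
  pose proof HT as (Hc & HL & HLr & Hcont & Hder & Hlip & Hk).
  assert (Hline : forall z, Cmod (z - z0)%C < r -> p z <> RtoC 0 ->
    Re (u - z)%C * Im (v - z)%C = Im (u - z)%C * Re (v - z)%C).
  { intros z Hz Nz.
    destruct (visible_zero p z0 z u r Hcont Hz Hu Nz Eu) as [s [Hs [Es Ns]]].
    destruct (visible_zero p z0 z v r Hcont Hz Hv Nz Ev) as [s' [Hs' [Es' Ns']]].
    assert (E : (z + RtoC s * (u - z) = z + RtoC s' * (v - z))%C).
    { apply (two_rays p k z0 c r L z); auto; apply ball_convex; auto; lra. }
    assert (E1 : (RtoC s * (u - z) = RtoC s' * (v - z))%C).
    { replace (RtoC s * (u - z))%C with (z + RtoC s * (u - z) - z)%C by ring; rewrite E; ring. }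
    destruct (u - z)%C as [u1 u2]; destruct (v - z)%C as [v1 v2].
    unfold Cmult, RtoC in E1; simpl in E1; injection E1; intros E2 E3; simpl.
    apply Rmult_eq_reg_l with s; [|lra].
    replace (s * (u1 * v2)) with ((s * u1 - 0 * u2) * v2) by ring; rewrite E3.
    replace (s * (u2 * v1)) with ((s * u2 + 0 * u1) * v1) by ring; rewrite E2; ring. }
  intros z Hz; destruct (Ceq_dec (p z) (RtoC 0)) as [|Nz]; [assumption|exfalso].
  destruct (proj1 (locally_C _ _) (filterlim_neq_0 p z (Hcont z Hz) Nz)) as [d [Hd Hnz]].
  set (v0 := (v - u)%C).
  assert (Hv0 : 0 < Cmod v0).
  { apply Cmod_gt_0; intros E; apply Huv; replace v with (v - u + u)%C by ring; unfold v0 in E; rewrite E; ring. }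
  (* [Ci * RtoC eta * v0] moves [z] perpendicularly to the line through [u] and [v], by so little
     that [p] remains nonzero; [Hline] then fails at one of the two points. *)
  set (eta := Rmin d (r - Cmod (z - z0)%C) / (2 * Cmod v0)).
  assert (He : 0 < eta) by (apply Rdiv_lt_0_compat; [apply Rmin_glb_lt; lra|lra]).
  set (z' := (z + Ci * RtoC eta * v0)%C).
  assert (Hz' : Cmod (z' - z)%C = Rmin d (r - Cmod (z - z0)%C) / 2).
  { unfold z'; replace (z + Ci * RtoC eta * v0 - z)%C with (Ci * RtoC eta * v0)%C by ring.
    rewrite !Cmod_mult, Cmod_Ci, Cmod_R, Rabs_right by lra; unfold eta; field; lra. }
  assert (Hmin : 0 < Rmin d (r - Cmod (z - z0)%C)) by (apply Rmin_glb_lt; lra).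
  pose proof (Rmin_l d (r - Cmod (z - z0)%C)); pose proof (Rmin_r d (r - Cmod (z - z0)%C)).
  assert (Hz'r : Cmod (z' - z0)%C < r).
  { replace (z' - z0)%C with ((z' - z) + (z - z0))%C by ring.
    eapply Rle_lt_trans; [apply Cmod_triangle|lra]. }
  pose proof (Hline z Hz Nz) as L1.
  pose proof (Hline z' Hz'r (Hnz z' ltac:(lra))) as L2.
  assert (Hsq : 0 < Re v0 * Re v0 + Im v0 * Im v0) by (rewrite <- Cmod_sq; nra).
  unfold z', v0 in *.
  destruct u as [u1 u2]; destruct v as [v1 v2]; destruct z as [z1 z2].
  unfold Re, Im, Cmult, Cplus, Cminus, Copp, Ci, RtoC in *; simpl in *.
  assert (eta * ((v1 + - u1) * (v1 + - u1) + (v2 + - u2) * (v2 + - u2)) = 0) by nra.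
  assert (0 < eta * ((v1 + - u1) * (v1 + - u1) + (v2 + - u2) * (v2 + - u2))) by (apply Rmult_lt_0_compat; lra).
  lra.
Qed.

(** * Zeros of the amplitude *)

(* A ball around a zero of M on which the constants needed for
   [near_translation] are available. *)
Definition small_ball (gr : R) (M : C -> C) (z0 : C) (r : R) : Prop :=
  0 < r <= 1 /\ 512 * r <= Rabs gr /\
  forall w, Cmod (w - z0)%C < r ->
    solves_at gr M w /\ 6 * Cmod (M w) ^ 2 <= Rabs gr /\ Rabs gr * Cmod (M w) ^ 2 <= 1.

Lemma small_ball_exists (gr : R) (M : C -> C) (z0 : C) :
  gr <> 0 -> locally z0 (solves_at gr M) -> M z0 = RtoC 0 ->
  exists r, small_ball gr M z0 r.
Proof.
  intros Hg HS E.
  assert (HG : 0 < Rabs gr) by (apply Rabs_pos_lt, Hg).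
  pose proof (is_cderive_continuous _ _ _ (proj1 (locally_C_ex _ _ HS))) as Hc.
  destruct (proj1 (locally_C _ _) HS) as [d2 [Hd2 HS2]].
  (* [|M| < e <= 1] gives [|M|^2 <= e], so one bound on [|M|] serves both estimates. *)
  set (e := Rmin 1 (Rmin (Rabs gr / 6) (/ Rabs gr))).
  assert (He : 0 < e) by (repeat apply Rmin_glb_lt; [lra|lra|apply Rinv_0_lt_compat, HG]).
  destruct (proj1 (filterlim_cmod _ _ _) Hc _ He) as [d1 [Hd1 Hc1]].
  set (r := Rmin (Rmin d1 d2) (Rmin 1 (Rabs gr / 512))).
  assert (Hr : 0 < r) by (repeat apply Rmin_glb_lt; lra).
  assert (Hr1 : r <= 1) by (eapply Rle_trans; [apply Rmin_r|apply Rmin_l]).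
  assert (Hr2 : r <= Rabs gr / 512) by (eapply Rle_trans; [apply Rmin_r|apply Rmin_r]).
  assert (Hrd1 : r <= d1) by (eapply Rle_trans; [apply Rmin_l|apply Rmin_l]).
  assert (Hrd2 : r <= d2) by (eapply Rle_trans; [apply Rmin_l|apply Rmin_r]).
  exists r; split; [split; lra|split; [lra|]].
  intros w Hw; split; [apply HS2; lra|].
  specialize (Hc1 w ltac:(lra)); rewrite E in Hc1.
  replace (M w - 0)%C with (M w) in Hc1 by ring.
  assert (e <= 1) by apply Rmin_l.
  assert (e <= Rabs gr / 6) by (eapply Rle_trans; [apply Rmin_r|apply Rmin_l]).
  assert (e <= / Rabs gr) by (eapply Rle_trans; [apply Rmin_r|apply Rmin_r]).
  pose proof (Cmod_ge_0 (M w)).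
  assert (Cmod (M w) ^ 2 <= e) by nra.
  split; [lra|].
  apply Rle_trans with (Rabs gr * / Rabs gr); [|right; field; lra].
  apply Rmult_le_compat_l; lra.
Qed.

Lemma small_ball_disc (gr : R) (M : C -> C) (z0 : C) (r : R) (w : C) :
  gr <> 0 -> small_ball gr M z0 r -> Cmod (w - z0)%C < r ->
  2 * Rabs gr <= Cmod (disc gr M w) <= 6 * Rabs gr.
Proof.
  intros Hg (_ & _ & H) Hw; destruct (H w Hw) as (_ & H1 & _).
  assert (HG : 0 < Rabs gr) by (apply Rabs_pos_lt, Hg).
  assert (E3 : Cmod (RtoC 3 * (M w * M w))%C = 3 * Cmod (M w) ^ 2)
    by (rewrite !Cmod_mult, Cmod_R, Rabs_right by lra; ring).
  assert (E4 : Cmod (RtoC 4 * RtoC gr)%C = 4 * Rabs gr)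
    by (rewrite !Cmod_mult, !Cmod_R, (Rabs_right 4) by lra; ring).
  unfold disc; split.
  - pose proof (Cmod_triangle (RtoC 3 * (M w * M w))%C (- (RtoC 3 * (M w * M w) - RtoC 4 * RtoC gr))%C) as T.
    rewrite Cmod_opp, E3 in T.
    replace (RtoC 3 * (M w * M w) + - (RtoC 3 * (M w * M w) - RtoC 4 * RtoC gr))%C
      with (RtoC 4 * RtoC gr)%C in T by ring.
    lra.
  - eapply Rle_trans; [apply Cmod_triangle|]; rewrite Cmod_opp; lra.
Qed.

Lemma small_ball_regular (gr : R) (M : C -> C) (z0 : C) (r : R) (w : C) :
  gr <> 0 -> small_ball gr M z0 r -> Cmod (w - z0)%C < r -> M w <> RtoC 0 ->
  locally w (solves_at gr M) /\ regular_value gr M w.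
Proof.
  intros Hg HB Hw HM; split; [|split; [exact HM|]].
  - apply locally_C; exists (r - Cmod (w - z0)%C); split; [lra|]; intros y Hy; apply HB.
    replace (y - z0)%C with ((y - w) + (w - z0))%C by ring.
    eapply Rle_lt_trans; [apply Cmod_triangle|lra].
  - intros E; pose proof (small_ball_disc gr M z0 r w Hg HB Hw) as [H _].
    rewrite E, Cmod_0 in H; assert (0 < Rabs gr) by (apply Rabs_pos_lt, Hg); lra.
Qed.

Lemma C_derive_at_zero (gr : R) (M : C -> C) (w : C) :
  solves_at gr M w -> M w = RtoC 0 -> C_derive M w = RtoC 0.
Proof.
  intros HS E; apply solves_modulus in HS; rewrite E, Cmod_0 in HS.
  apply Cmod_eq_0, Rle_antisym; [|apply Cmod_ge_0].
  apply (pow_le_reg 3); simpl in *; lra.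
Qed.

(** [wfun] has a zero denominator here; the factor [M'] in the numerator of [pfun] makes its value
    independent of the convention for division by zero. On a small ball, 0 is also the limit of
    [pfun] there. *)
Lemma pfun_at_zero (gr : R) (M : C -> C) (w : C) :
  solves_at gr M w -> M w = RtoC 0 -> pfun gr M w = RtoC 0.
Proof.
  intros HS E; unfold pfun, Cdiv; rewrite (C_derive_at_zero gr M w HS E); ring.
Qed.

(** Being free of [wfun], the relation [16 p^4 = M^2 D] persists at the zeros of [M]; it bounds [p]
    and makes [M^2] a Lipschitz function of [p]. *)
Lemma pfun_fourth_power (gr : R) (M : C -> C) (z0 : C) (r : R) (w : C) :
  gr <> 0 -> small_ball gr M z0 r -> Cmod (w - z0)%C < r ->
  (RtoC 16 * (pfun gr M w * pfun gr M w * (pfun gr M w * pfun gr M w)) = M w * M w * disc gr M w)%C.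
Proof.
  intros Hg HB Hw; destruct (Ceq_dec (M w) (RtoC 0)) as [E|N].
  - rewrite (pfun_at_zero gr M w); [|apply HB, Hw|exact E]; rewrite E; ring.
  - destruct (small_ball_regular gr M z0 r w Hg HB Hw N) as [_ HR].
    destruct (wfun_pfun_relations gr M w (proj1 (proj2 (proj2 HB) w Hw)) HR) as (H1 & _ & _ & H2 & _).
    rewrite <- H1.
    transitivity ((RtoC 4 * (pfun gr M w * pfun gr M w)) * (RtoC 4 * (pfun gr M w * pfun gr M w)))%C; [ring|].
    rewrite H2; ring.
Qed.

Lemma pfun_zero_iff (gr : R) (M : C -> C) (z0 : C) (r : R) (w : C) :
  gr <> 0 -> small_ball gr M z0 r -> Cmod (w - z0)%C < r ->
  pfun gr M w = RtoC 0 <-> M w = RtoC 0.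
Proof.
  intros Hg HB Hw; split; [|apply pfun_at_zero, HB, Hw].
  intros E; destruct (Ceq_dec (M w) (RtoC 0)) as [|N]; [assumption|exfalso].
  destruct (small_ball_regular gr M z0 r w Hg HB Hw N) as [_ HR].
  destruct (wfun_pfun_relations gr M w (proj1 (proj2 (proj2 HB) w Hw)) HR) as (_ & _ & H & _).
  apply H, E.
Qed.

Lemma pfun_bound (gr : R) (M : C -> C) (z0 : C) (r : R) (w : C) :
  gr <> 0 -> small_ball gr M z0 r -> Cmod (w - z0)%C < r ->
  Cmod (pfun gr M w) ^ 4 <= Rabs gr * Cmod (M w) ^ 2 /\ Cmod (pfun gr M w) <= 1.
Proof.
  intros Hg HB Hw.
  pose proof (pfun_fourth_power gr M z0 r w Hg HB Hw) as E.
  apply (f_equal Cmod) in E; rewrite !Cmod_mult, Cmod_R, Rabs_right in E by lra.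
  pose proof (small_ball_disc gr M z0 r w Hg HB Hw) as HD.
  destruct HB as (_ & _ & H); destruct (H w Hw) as (_ & _ & H1).
  set (p := Cmod (pfun gr M w)) in *; set (m := Cmod (M w)) in *.
  assert (0 <= m * m) by nra. assert (0 < Rabs gr) by (apply Rabs_pos_lt, Hg).
  assert (A : p ^ 4 <= Rabs gr * m ^ 2) by (simpl; nra).
  split; [exact A|]. apply (pow_le_reg 3); lra.
Qed.

Lemma pfun_continuous (gr : R) (M : C -> C) (z0 : C) (r : R) (w : C) :
  gr <> 0 -> small_ball gr M z0 r -> Cmod (w - z0)%C < r ->
  filterlim (pfun gr M) (locally w) (locally (pfun gr M w)).
Proof.
  intros Hg HB Hw; destruct (Ceq_dec (M w) (RtoC 0)) as [E|N].
  - rewrite (pfun_at_zero gr M w); [|apply HB, Hw|exact E].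
    apply filterlim_cmod; intros eps He.
    assert (HG : 0 < Rabs gr) by (apply Rabs_pos_lt, Hg).
    pose proof (is_cderive_continuous _ _ _ (proj1 (proj1 (proj2 (proj2 HB) w Hw)))) as Hc.
    (* Since [|p|^4 <= |gr| |M|^2 <= ((|gr| + 1) |M|)^2], this bound on [|M|] gives [|p| < eps]. *)
    assert (He2 : 0 < eps ^ 2 / (Rabs gr + 1)) by (apply Rdiv_lt_0_compat; [apply pow_lt, He|lra]).
    destruct (proj1 (filterlim_cmod _ _ _) Hc _ He2) as [d [Hd H]].
    exists (Rmin d (r - Cmod (w - z0)%C)); split; [apply Rmin_glb_lt; lra|]; intros y Hy.
    pose proof (Rmin_l d (r - Cmod (w - z0)%C)); pose proof (Rmin_r d (r - Cmod (w - z0)%C)).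
    assert (Hyr : Cmod (y - z0)%C < r).
    { replace (y - z0)%C with ((y - w) + (w - z0))%C by ring.
      eapply Rle_lt_trans; [apply Cmod_triangle|lra]. }
    specialize (H y ltac:(lra)); rewrite E in H; replace (M y - 0)%C with (M y) in H by ring.
    replace (pfun gr M y - 0)%C with (pfun gr M y) by ring.
    destruct (pfun_bound gr M z0 r y Hg HB Hyr) as [B _].
    set (p := Cmod (pfun gr M y)) in *; set (m := Cmod (M y)) in *.
    assert (Hm : 0 <= m) by apply Cmod_ge_0.
    destruct (Rlt_le_dec p eps) as [|L]; [assumption|exfalso].
    apply Rmult_lt_compat_r with (r := Rabs gr + 1) in H; [|lra].
    unfold Rdiv in H; rewrite Rmult_assoc, Rinv_l, Rmult_1_r in H by lra.
    assert (A1 : eps ^ 4 <= p ^ 4) by (apply pow_incr; lra).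
    assert (A2 : (m * (Rabs gr + 1)) * (m * (Rabs gr + 1)) < eps ^ 2 * eps ^ 2)
      by (apply Rmult_le_0_lt_compat; try assumption; nra).
    assert (A3 : Rabs gr * m ^ 2 <= (m * (Rabs gr + 1)) * (m * (Rabs gr + 1))).
    { replace ((m * (Rabs gr + 1)) * (m * (Rabs gr + 1))) with ((Rabs gr + 1) ^ 2 * m ^ 2) by ring.
      apply Rmult_le_compat_r; [apply pow2_ge_0|]; nra. }
    replace (eps ^ 4) with (eps ^ 2 * eps ^ 2) in A1 by ring. lra.
  - destruct (small_ball_regular gr M z0 r w Hg HB Hw N) as [HS HR].
    eapply is_cderive_continuous, is_cderive_pfun; assumption.
Qed.

(** The derivative [gr / 3 - M^2 / 2] of [p] contains [M] only through [M^2]. Subtracting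
    [16 p^4 = M^2 D] at two points shows that [M^2] is Lipschitz in [p] with constant [64 / |gr|],
    whatever the branch of [w] at these points. *)
Lemma pfun_near_translation (gr : R) (M : C -> C) (z0 : C) (r : R) :
  gr <> 0 -> small_ball gr M z0 r ->
  near_translation (pfun gr M) (fun z => RtoC (gr / 3) - RtoC (1 / 2) * (M z * M z))%C
    z0 (RtoC (gr / 3)) r (32 / Rabs gr).
Proof.
  intros Hg HB.
  assert (HG : 0 < Rabs gr) by (apply Rabs_pos_lt, Hg).
  pose proof HB as (Hr & Hr2 & HB').
  refine (conj _ (conj _ (conj _ (conj _ (conj _ (conj _ _)))))).
  - apply RtoC_neq; intros E; apply Hg; lra.
  - apply Rlt_le, Rdiv_lt_0_compat; lra.
  (* With [L = 32 / |gr|] the bound [16 L r <= 1] becomes [512 r <= |gr|], the origin of 512 in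
     [small_ball]. *)
  - replace (16 * (32 / Rabs gr * r)) with (512 * r / Rabs gr) by (field; lra).
    apply Rmult_le_reg_r with (Rabs gr); [exact HG|].
    unfold Rdiv; rewrite Rmult_assoc, Rinv_l by lra; lra.
  - intros w Hw; apply (pfun_continuous gr M z0 r w Hg HB Hw).
  - intros w Hw Np.
    assert (N : M w <> RtoC 0) by (intros E; apply Np, (pfun_zero_iff gr M z0 r w Hg HB Hw), E).
    destruct (small_ball_regular gr M z0 r w Hg HB Hw N) as [HS HR].
    apply is_cderive_pfun; assumption.
  - intros u v Hu Hv.
    pose proof (pfun_fourth_power gr M z0 r u Hg HB Hu) as Eu.
    pose proof (pfun_fourth_power gr M z0 r v Hg HB Hv) as Ev.
    destruct (pfun_bound gr M z0 r u Hg HB Hu) as [_ Bu].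
    destruct (pfun_bound gr M z0 r v Hg HB Hv) as [_ Bv].
    destruct (HB' u Hu) as (_ & Mu & _). destruct (HB' v Hv) as (_ & Mv & _).
    unfold disc in Eu, Ev.
    set (pu := pfun gr M u) in *; set (pv := pfun gr M v) in *.
    set (mu := (M u * M u)%C) in *; set (mv := (M v * M v)%C) in *.
    assert (Hmu : 6 * Cmod mu <= Rabs gr) by (unfold mu; rewrite Cmod_mult; lra).
    assert (Hmv : 6 * Cmod mv <= Rabs gr) by (unfold mv; rewrite Cmod_mult; lra).
    assert (E : ((mu - mv) * (RtoC 3 * (mu + mv) - RtoC 4 * RtoC gr) =
      RtoC 16 * ((pu - pv) * ((pu + pv) * (pu * pu + pv * pv))))%C).
    { transitivity (mu * (RtoC 3 * mu - RtoC 4 * RtoC gr) - mv * (RtoC 3 * mv - RtoC 4 * RtoC gr))%C; [ring|].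
      rewrite <- Eu, <- Ev; ring. }
    apply (f_equal Cmod) in E; rewrite !Cmod_mult, Cmod_R, Rabs_right in E by lra.
    assert (E1 : Rabs gr <= Cmod (RtoC 3 * (mu + mv) - RtoC 4 * RtoC gr)%C).
    { pose proof (Cmod_triangle (RtoC 3 * (mu + mv))%C (- (RtoC 3 * (mu + mv) - RtoC 4 * RtoC gr))%C) as T.
      rewrite Cmod_opp in T.
      replace (RtoC 3 * (mu + mv) + - (RtoC 3 * (mu + mv) - RtoC 4 * RtoC gr))%C
        with (RtoC 4 * RtoC gr)%C in T by ring.
      rewrite !Cmod_mult, !Cmod_R, (Rabs_right 4), (Rabs_right 3) in T by lra.
      pose proof (Cmod_triangle mu mv). lra. }
    assert (E2 : Cmod (pu + pv)%C * Cmod (pu * pu + pv * pv)%C <= 4).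
    { replace 4 with (2 * 2) by ring; apply Rmult_le_compat; try apply Cmod_ge_0.
      - eapply Rle_trans; [apply Cmod_triangle|lra].
      - eapply Rle_trans; [apply Cmod_triangle|]; rewrite !Cmod_mult.
        pose proof (Cmod_ge_0 pu); pose proof (Cmod_ge_0 pv); nra. }
    replace (RtoC (gr / 3) - RtoC (1 / 2) * mu - (RtoC (gr / 3) - RtoC (1 / 2) * mv))%C
      with (RtoC (1 / 2) * - (mu - mv))%C by ring.
    rewrite Cmod_mult, Cmod_opp, Cmod_R, Rabs_right by lra.
    set (x := Cmod (mu - mv)%C) in *; set (y := Cmod (pu - pv)%C) in *.
    assert (Hx : 0 <= x) by apply Cmod_ge_0. assert (Hy : 0 <= y) by apply Cmod_ge_0.
    apply Rmult_le_reg_l with (Rabs gr); [exact HG|].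
    replace (Rabs gr * (32 / Rabs gr * y)) with (32 * y) by (field; lra).
    assert (x * Rabs gr <= 64 * y).
    { eapply Rle_trans; [apply Rmult_le_compat_l; [exact Hx|exact E1]|]; rewrite E.
      assert (y * (Cmod (pu + pv)%C * Cmod (pu * pu + pv * pv)%C) <= y * 4) by (apply Rmult_le_compat_l; assumption).
      lra. }
    lra.
  - intros w Hw; destruct (HB' w Hw) as (_ & Hm & _).
    replace (RtoC (gr / 3) - RtoC (1 / 2) * (M w * M w) - RtoC (gr / 3))%C
      with (RtoC (- (1 / 2)) * (M w * M w))%C by (rewrite RtoC_opp; ring).
    rewrite !Cmod_mult, !Cmod_R, Rabs_Ropp, (Rabs_right (1 / 2)) by lra.
    unfold Rdiv; rewrite Rabs_mult, (Rabs_right (/ 3)) by lra. lra.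
Qed.

(** * Branches of the square root of the discriminant near an isolated zero of the amplitude *)

Lemma square_root_of_real (a : R) : exists w : C, (w * w = RtoC a)%C.
Proof.
  destruct (Rle_lt_dec 0 a) as [H|H].
  - exists (RtoC (sqrt a)); rewrite <- RtoC_mult, sqrt_sqrt by exact H; reflexivity.
  - exists (Ci * RtoC (sqrt (- a)))%C.
    replace (Ci * RtoC (sqrt (- a)) * (Ci * RtoC (sqrt (- a))))%C
      with (Ci * Ci * RtoC (sqrt (- a) * sqrt (- a)))%C by (rewrite RtoC_mult; ring).
    rewrite sqrt_sqrt by lra; unfold Ci, Cmult, RtoC; simpl; f_equal; ring.
Qed.

Lemma same_sign (f : R -> R) :
  (forall t, 0 <= t <= 1 -> continuity_pt f t) -> (forall t, 0 <= t <= 1 -> f t <> 0) ->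
  0 < f 0 * f 1.
Proof.
  intros Hc Hn.
  pose proof (Hn 0 ltac:(lra)); pose proof (Hn 1 ltac:(lra)).
  destruct (Rlt_le_dec 0 (f 0 * f 1)) as [|L]; [assumption|exfalso].
  destruct (Rlt_le_dec (f 0) 0) as [L0|L0].
  - destruct (IVT_interv f 0 1 Hc Rlt_0_1 L0) as [t [Ht Et]]; [nra|]; apply (Hn t Ht Et).
  - destruct (IVT_interv (fun t => - f t) 0 1) as [t [Ht Et]];
      [intros t Ht; apply continuity_pt_opp, Hc, Ht|lra|lra|nra|].
    apply (Hn t Ht); lra.
Qed.

(** A punctured ball is path connected: if the segment from [u] to [v] meets the centre, the detour
    through [x], a quarter turn of [u] around [z0], avoids it. *)
Lemma punctured_ball_same_sign (f : C -> C) (c z0 : C) (r : R) :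
  (forall w, Cmod (w - z0)%C < r -> w <> z0 ->
    filterlim f (locally w) (locally (f w)) /\ Re (c * f w)%C <> 0) ->
  forall u v, Cmod (u - z0)%C < r -> Cmod (v - z0)%C < r -> u <> z0 -> v <> z0 ->
  0 < Re (c * f u)%C * Re (c * f v)%C.
Proof.
  intros H.
  assert (Hseg : forall u v, Cmod (u - z0)%C < r -> Cmod (v - z0)%C < r ->
    (forall t, 0 <= t <= 1 -> (u + RtoC t * (v - u))%C <> z0) -> 0 < Re (c * f u)%C * Re (c * f v)%C).
  { intros u v Hu Hv Hz.
    pose proof (same_sign (fun t => Re (c * f (u + RtoC t * (v - u))%C)%C)) as S.
    cbv beta in S; replace (u + RtoC 0 * (v - u))%C with u in S by ring.
    replace (u + RtoC 1 * (v - u))%C with v in S by ring.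
    apply S; intros t Ht.
    - apply path_cont_line, H; [apply ball_convex; assumption|apply Hz, Ht].
    - apply H; [apply ball_convex; assumption|apply Hz, Ht]. }
  intros u v Hu Hv Nu Nv.
  destruct (classic (exists t, 0 <= t <= 1 /\ (u + RtoC t * (v - u))%C = z0)) as [[t [Ht Et]]|N].
  2:{ apply Hseg; auto; intros t Ht E; apply N; exists t; auto. }
  assert (Hzu : (u - z0)%C <> RtoC 0).
  { intros E; apply Nu; replace u with (u - z0 + z0)%C by ring; rewrite E; ring. }
  assert (Ht0 : t <> 0) by (intros ->; apply Nu; rewrite <- Et; ring).
  assert (Ht1 : t <> 1) by (intros ->; apply Nv; rewrite <- Et; ring).
  set (x := (z0 + Ci * (u - z0))%C).
  assert (Hx : Cmod (x - z0)%C < r).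
  { unfold x; replace (z0 + Ci * (u - z0) - z0)%C with (Ci * (u - z0))%C by ring.
    rewrite Cmod_mult, Cmod_Ci, Rmult_1_l; exact Hu. }
  assert (Hfac : forall a : C, a <> RtoC 0 -> (z0 + a * (u - z0))%C <> z0).
  { intros a Ha E; apply (Cmult_neq_0 _ _ Ha Hzu).
    replace (a * (u - z0))%C with (z0 + a * (u - z0) - z0)%C by ring; rewrite E; ring. }
  assert (S1 : 0 < Re (c * f u)%C * Re (c * f x)%C).
  { apply Hseg; auto; intros s Hs.
    replace (u + RtoC s * (x - u))%C with (z0 + (RtoC (1 - s) + RtoC s * Ci) * (u - z0))%C
      by (unfold x; rewrite RtoC_minus; ring).
    apply Hfac; intros E; unfold RtoC, Cplus, Cmult, Ci in E; simpl in E; injection E; intros; lra. }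
  (* [v] lies on the ray from [z0] opposite to [u]. *)
  assert (Ev : (v = z0 + RtoC (- ((1 - t) / t)) * (u - z0))%C).
  { rewrite <- Et, RtoC_opp, RtoC_div, RtoC_minus by exact Ht0; field; apply RtoC_neq, Ht0. }
  assert (S2 : 0 < Re (c * f x)%C * Re (c * f v)%C).
  { apply Hseg; auto; intros s Hs.
    set (l := (1 - t) / t) in *.
    assert (Hl : 0 < l) by (apply Rdiv_lt_0_compat; lra).
    replace (x + RtoC s * (v - x))%C with (z0 + (RtoC (- (s * l)) + RtoC (1 - s) * Ci) * (u - z0))%C
      by (rewrite Ev; unfold x; rewrite RtoC_minus, !RtoC_opp, RtoC_mult; ring).
    apply Hfac; intros E; unfold RtoC, Cplus, Cmult, Ci in E; simpl in E; injection E; intros E1 E2.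
    assert (s = 1) by lra; subst s; lra. }
  assert (0 < Re (c * f x)%C * Re (c * f x)%C).
  { destruct (Req_dec (Re (c * f x)%C) 0) as [E|E]; [rewrite E in S2; lra|nra]. }
  nra.
Qed.

Lemma Re_plus_one (q : C) : Re (q + 1)%C = Re q + 1.
Proof. reflexivity. Qed.

Lemma Re_minus_one (q : C) : Re (q - 1)%C = Re q - 1.
Proof. reflexivity. Qed.

(** With [w0^2 = - 4 gr] and [q = w / w0], the relation [w^2 = D] becomes
    [(q - 1) (q + 1) = - 3 M^2 / (4 gr)]. The right-hand side is too small for [q] to reach the
    imaginary axis, so by connectedness [q] stays on one side of it, near 1 or near -1. *)
Lemma wfun_near_branch (gr : R) (M : C -> C) (z0 : C) (r : R) :
  gr <> 0 -> small_ball gr M z0 r ->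
  (forall w, Cmod (w - z0)%C < r -> w <> z0 -> M w <> RtoC 0) ->
  exists w0 : C, forall w, Cmod (w - z0)%C < r -> w <> z0 ->
    Rabs gr * Cmod (wfun gr M w - w0)%C <= Cmod w0 * Cmod (M w) ^ 2.
Proof.
  intros Hg HB HM.
  assert (HG : 0 < Rabs gr) by (apply Rabs_pos_lt, Hg).
  destruct (square_root_of_real (- (4 * gr))) as [w0 Hw0].
  assert (N0 : w0 <> RtoC 0).
  { intros E; rewrite E in Hw0; replace (0 * 0)%C with (RtoC 0) in Hw0 by ring.
    injection Hw0; lra. }
  assert (Hreg : forall w, Cmod (w - z0)%C < r -> w <> z0 ->
    locally w (solves_at gr M) /\ regular_value gr M w).
  { intros w Hw Nw; apply (small_ball_regular gr M z0 r w Hg HB Hw), HM; assumption. }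
  assert (Hsq : forall w, Cmod (w - z0)%C < r -> w <> z0 ->
    ((/ w0 * wfun gr M w - 1) * (/ w0 * wfun gr M w + 1) = RtoC (- 3 / (4 * gr)) * (M w * M w))%C).
  { intros w Hw Nw.
    destruct (wfun_pfun_relations gr M w (proj1 (proj2 (proj2 HB) w Hw)) (proj2 (Hreg w Hw Nw))) as [E _].
    apply (Cmult_cancel_l (w0 * w0)%C); [apply Cmult_neq_0; exact N0|].
    transitivity (wfun gr M w * wfun gr M w - w0 * w0)%C; [field; exact N0|].
    rewrite E, Hw0; unfold disc.
    replace (RtoC (- (4 * gr))) with (- (RtoC 4 * RtoC gr))%C by (rewrite RtoC_opp, RtoC_mult; reflexivity).
    replace (RtoC (-3 / (4 * gr))) with (RtoC (-3) / (RtoC 4 * RtoC gr))%C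
      by (rewrite <- RtoC_mult, <- RtoC_div by lra; reflexivity).
    field; repeat split; apply RtoC_neq; lra. }
  assert (Hmod : forall w, Cmod (w - z0)%C < r -> w <> z0 ->
    4 * (Rabs gr * (Cmod (/ w0 * wfun gr M w - 1)%C * Cmod (/ w0 * wfun gr M w + 1)%C)) = 3 * Cmod (M w) ^ 2).
  { intros w Hw Nw; rewrite <- Cmod_mult, Hsq, !Cmod_mult, Cmod_R by assumption.
    unfold Rdiv; rewrite Rabs_mult, Rabs_inv, Rabs_mult, (Rabs_left (-3)), (Rabs_right 4) by lra.
    field; lra. }
  (* On the imaginary axis both factors have modulus at least 1, against [6 |M|^2 <= |gr|]. *)
  assert (Hre : forall w, Cmod (w - z0)%C < r -> w <> z0 -> Re (/ w0 * wfun gr M w)%C <> 0).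
  { intros w Hw Nw E; specialize (Hmod w Hw Nw).
    pose proof (proj1 (proj2 (proj2 (proj2 HB) w Hw))) as Hs.
    set (q := (/ w0 * wfun gr M w)%C) in *.
    assert (A1 : 1 <= Cmod (q - 1)%C).
    { pose proof (Re_le (q - 1)%C) as R1; rewrite Re_minus_one, E in R1; lra. }
    assert (A2 : 1 <= Cmod (q + 1)%C).
    { pose proof (Re_le (q + 1)%C) as R1; rewrite Re_plus_one, E in R1; lra. }
    assert (1 * 1 <= Cmod (q - 1)%C * Cmod (q + 1)%C) by (apply Rmult_le_compat; lra).
    nra. }
  assert (Hsign : forall u v, Cmod (u - z0)%C < r -> Cmod (v - z0)%C < r -> u <> z0 -> v <> z0 ->
    0 < Re (/ w0 * wfun gr M u)%C * Re (/ w0 * wfun gr M v)%C).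
  { apply punctured_ball_same_sign; intros w Hw Nw; split; [|apply Hre; assumption].
    destruct (Hreg w Hw Nw); eapply is_cderive_continuous, is_cderive_wfun; eassumption. }
  set (u := (z0 + RtoC (r / 2))%C).
  assert (Hr : 0 < r) by apply HB.
  assert (Hu : Cmod (u - z0)%C < r).
  { unfold u; replace (z0 + RtoC (r / 2) - z0)%C with (RtoC (r / 2)) by ring; rewrite Cmod_R, Rabs_right; lra. }
  assert (Nu : u <> z0).
  { intros E; assert (X : RtoC (r / 2) = RtoC 0) by (replace (RtoC (r / 2)) with (u - z0)%C by (unfold u; ring); rewrite E; ring).
    injection X; lra. }
  (* To the right of the imaginary axis [|q + 1| >= 1], so the product controls [|q - 1|]. *)
  assert (Hone : forall q : C, 0 < Re q -> Cmod (q - 1)%C <= Cmod (q - 1)%C * Cmod (q + 1)%C).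
  { intros q Hq; pose proof (Re_le (q + 1)%C) as R1; rewrite Re_plus_one in R1.
    assert (1 <= Cmod (q + 1)%C) by lra.
    pose proof (Cmod_ge_0 (q - 1)%C); nra. }
  destruct (Rlt_le_dec 0 (Re (/ w0 * wfun gr M u)%C)) as [L|L].
  - exists w0; intros w Hw Nw.
    specialize (Hsign u w Hu Hw Nu Nw); specialize (Hmod w Hw Nw).
    assert (P : 0 < Re (/ w0 * wfun gr M w)%C) by nra.
    specialize (Hone _ P).
    replace (wfun gr M w - w0)%C with (w0 * (/ w0 * wfun gr M w - 1))%C by (field; exact N0).
    rewrite Cmod_mult; pose proof (Cmod_ge_0 w0); pose proof (pow2_ge_0 (Cmod (M w))).
    assert (Rabs gr * Cmod (/ w0 * wfun gr M w - 1)%C <= Cmod (M w) ^ 2) by nra.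
    nra.
  - exists (- w0)%C; intros w Hw Nw.
    specialize (Hsign u w Hu Hw Nu Nw); specialize (Hmod w Hw Nw).
    assert (P : 0 < Re (- (/ w0 * wfun gr M w))%C).
    { unfold Re, Copp in *; simpl in *; nra. }
    specialize (Hone _ P).
    replace (- (/ w0 * wfun gr M w) - 1)%C with (- (/ w0 * wfun gr M w + 1))%C in Hone by ring.
    replace (- (/ w0 * wfun gr M w) + 1)%C with (- (/ w0 * wfun gr M w - 1))%C in Hone by ring.
    rewrite !Cmod_opp in Hone.
    replace (wfun gr M w - - w0)%C with (w0 * (/ w0 * wfun gr M w + 1))%C by (field; exact N0).
    rewrite Cmod_opp, Cmod_mult; pose proof (Cmod_ge_0 w0); pose proof (pow2_ge_0 (Cmod (M w))).
    assert (Rabs gr * Cmod (/ w0 * wfun gr M w + 1)%C <= Cmod (M w) ^ 2) by nra.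
    nra.
Qed.

(** Let [x] be the distance to [z0]. From [M^2 = O(x^4)], of which [O(x^2)] suffices, [wfun] is
    [w0 + O(x^2)] and integration of [p'] gives [pfun] as [c] times the displacement, up to
    [O(x^2)]. So [M''] at [z0] is [- 2/3 w0 c]; the formula for [M''] off [z0] differs from this
    value by [O(x^2)], and the next derivative is 0. *)
Lemma third_derivative_at_isolated_zero (gr : R) (M : C -> C) (z0 : C) (r : R) :
  gr <> 0 -> small_ball gr M z0 r -> M z0 = RtoC 0 ->
  (forall w, Cmod (w - z0)%C < r -> w <> z0 -> M w <> RtoC 0) ->
  C_derive (C_derive (C_derive M)) z0 = RtoC 0.
Proof.
  intros Hg HB E0 HM.
  assert (HG : 0 < Rabs gr) by (apply Rabs_pos_lt, Hg).
  pose proof HB as ((Hr & Hr1) & _ & HB').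
  destruct (wfun_near_branch gr M z0 r Hg HB HM) as [w0 Hw0].
  destruct (pfun_near_translation gr M z0 r Hg HB) as (_ & _ & _ & Hcont & Hder & _).
  (* [81 |M'|^4 = |M|^2 |D|^3 <= 216 |gr|^3 |M|^2], and [216 / 81 <= 3]. *)
  set (K := 3 * Rabs gr ^ 3).
  assert (HK : 0 <= K) by (apply Rmult_le_pos; [lra|apply pow_le; lra]).
  assert (Hz : Cmod (z0 - z0)%C < r) by (replace (z0 - z0)%C with (RtoC 0) by ring; rewrite Cmod_0; exact Hr).
  assert (Hflat : forall w, Cmod (w - z0)%C < r -> Cmod (M w) ^ 2 <= K * Cmod (w - z0)%C ^ 4).
  { intros w Hw.
    replace (Cmod (M w) ^ 2) with (Cmod (M w - M z0)%C ^ (4 - 2))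
      by (rewrite E0; replace (M w - 0)%C with (M w) by ring; reflexivity).
    apply (flat_at_zero_of_derivative M (C_derive M) z0 r K 2); auto with arith.
    - intros y Hy; apply HB', Hy.
    - intros y Hy; rewrite E0; replace (M y - 0)%C with (M y) by ring.
      pose proof (solves_modulus _ _ _ (proj1 (HB' y Hy))) as S.
      destruct (small_ball_disc gr M z0 r y Hg HB Hy) as [_ D].
      assert (D3 : Cmod (disc gr M y) ^ 3 <= (6 * Rabs gr) ^ 3) by (apply pow_incr; split; [apply Cmod_ge_0|exact D]).
      rewrite Rpow_mult_distr in D3.
      pose proof (pow2_ge_0 (Cmod (M y))).
      assert (Cmod (M y) ^ 2 * Cmod (disc gr M y) ^ 3 <= Cmod (M y) ^ 2 * (6 ^ 3 * Rabs gr ^ 3))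
        by (apply Rmult_le_compat_l; assumption).
      pose proof (pow_le (Rabs gr) 3 (Rlt_le _ _ HG)).
      unfold K; nra. }
  assert (Hflat2 : forall w, Cmod (w - z0)%C < r -> Cmod (M w) ^ 2 <= K * Cmod (w - z0)%C ^ 2).
  { intros w Hw; eapply Rle_trans; [apply Hflat, Hw|]; apply Rmult_le_compat_l; [exact HK|].
    pose proof (Cmod_ge_0 (w - z0)%C); set (x := Cmod (w - z0)%C) in *.
    assert (x ^ 2 <= 1) by nra. replace (x ^ 4) with (x ^ 2 * x ^ 2) by ring.
    pose proof (pow2_ge_0 x); nra. }
  set (c := RtoC (gr / 3)).
  assert (Hp : forall w, Cmod (w - z0)%C < r ->
    Cmod (pfun gr M w - (w - z0) * c)%C <= K * Cmod (w - z0)%C ^ 2).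
  { intros w Hw; destruct (Ceq_dec w z0) as [->|Nw].
    { rewrite (pfun_at_zero gr M z0); [|apply HB', Hz|exact E0].
      replace (0 - (z0 - z0) * c)%C with (RtoC 0) by ring; rewrite Cmod_0.
      apply Rmult_le_pos; [exact HK|apply pow2_ge_0]. }
    set (v := (w - z0)%C) in *.
    assert (Nv : v <> RtoC 0).
    { intros E; apply Nw; replace w with (v + z0)%C by (unfold v; ring); rewrite E; ring. }
    assert (Hin : forall t, 0 <= t <= 1 -> Cmod ((z0 + RtoC t * v) - z0)%C <= Cmod v)
      by (intros t Ht; apply Cmod_segment, Ht).
    set (q := fun t => (pfun gr M (z0 + RtoC t * v) - RtoC t * (v * c))%C).
    assert (X : Cmod (q 1 - q 0)%C <= (K * Cmod v ^ 2) * (1 - 0)).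
    { apply path_mean_value with
        (fun t => (v * (c - RtoC (1 / 2) * (M (z0 + RtoC t * v) * M (z0 + RtoC t * v))) - v * c)%C); [lra| | |].
      - intros t Ht; apply path_cont_minus; [|apply path_cont_linear].
        apply path_cont_line, Hcont; specialize (Hin t Ht); lra.
      - intros t Ht; apply path_der_minus; [|apply path_der_linear].
        apply path_der_line, Hder; [specialize (Hin t ltac:(lra)); lra|].
        intros E; apply (HM (z0 + RtoC t * v)%C).
        + specialize (Hin t ltac:(lra)); lra.
        + intros E1; apply (Cmult_neq_0 (RtoC t) v); [apply RtoC_neq; lra|exact Nv|].
          replace (RtoC t * v)%C with (z0 + RtoC t * v - z0)%C by ring; rewrite E1; ring.
        + apply (pfun_zero_iff gr M z0 r _ Hg HB); [specialize (Hin t ltac:(lra)); lra|exact E].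
      - intros t Ht; set (y := (z0 + RtoC t * v)%C).
        replace (v * (c - RtoC (1 / 2) * (M y * M y)) - v * c)%C with (- (v * (RtoC (1 / 2) * (M y * M y))))%C by ring.
        rewrite Cmod_opp, !Cmod_mult, Cmod_R, Rabs_right by lra.
        assert (Y : Cmod (y - z0)%C <= Cmod v) by (apply Hin; lra).
        specialize (Hflat2 y ltac:(lra)).
        pose proof (Cmod_ge_0 (y - z0)%C). pose proof (Cmod_ge_0 v).
        assert (Cmod (y - z0)%C ^ 2 <= Cmod v ^ 2) by (apply pow_incr; lra).
        assert (A1 : Cmod (M y) ^ 2 <= K * Cmod v ^ 2) by (eapply Rle_trans; [exact Hflat2|apply Rmult_le_compat_l; assumption]).
        assert (A2 : 0 <= K * Cmod v ^ 2) by (apply Rmult_le_pos; [exact HK|apply pow2_ge_0]).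
        pose proof (pow2_ge_0 (Cmod (M y))).
        replace (Cmod (M y) * Cmod (M y)) with (Cmod (M y) ^ 2) by ring. nra. }
    unfold q in X; replace (z0 + RtoC 1 * v)%C with w in X by (unfold v; ring).
    replace (z0 + RtoC 0 * v)%C with z0 in X by ring.
    rewrite (pfun_at_zero gr M z0) in X; [|apply HB', Hz|exact E0].
    replace (pfun gr M w - RtoC 1 * (v * c) - (0 - RtoC 0 * (v * c)))%C with (pfun gr M w - v * c)%C in X by ring.
    lra. }
  assert (Hw0' : forall w, Cmod (w - z0)%C < r -> w <> z0 ->
    Cmod (wfun gr M w - w0)%C <= Cmod w0 / Rabs gr * K * Cmod (w - z0)%C ^ 2).
  { intros w Hw Nw; specialize (Hw0 w Hw Nw); specialize (Hflat2 w Hw).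
    apply Rmult_le_reg_l with (Rabs gr); [exact HG|].
    replace (Rabs gr * (Cmod w0 / Rabs gr * K * Cmod (w - z0)%C ^ 2)) with (Cmod w0 * (K * Cmod (w - z0)%C ^ 2)) by (field; lra).
    eapply Rle_trans; [exact Hw0|]; apply Rmult_le_compat_l; [apply Cmod_ge_0|assumption]. }
  set (K1 := Cmod w0 / Rabs gr * K) in *.
  assert (HK1 : 0 <= K1).
  { apply Rmult_le_pos; [|exact HK]; apply Rmult_le_pos; [apply Cmod_ge_0|apply Rlt_le, Rinv_0_lt_compat, HG]. }
  assert (H2 : C_derive (C_derive M) z0 = (RtoC (- (2 / 3)) * (w0 * c))%C).
  { apply is_cderive_unique, is_cderive_quadratic with (K := K1 + Cmod w0 * K) (d := r); [exact Hr|].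
    intros w Hw; rewrite (C_derive_at_zero gr M z0 (proj1 (HB' z0 Hz)) E0).
    destruct (Ceq_dec w z0) as [->|Nw].
    { rewrite (C_derive_at_zero gr M z0 (proj1 (HB' z0 Hz)) E0).
      replace (0 - 0 - (z0 - z0) * (RtoC (- (2 / 3)) * (w0 * c)))%C with (RtoC 0) by ring; rewrite Cmod_0.
      apply Rmult_le_pos; [|apply pow2_ge_0]; pose proof (Cmod_ge_0 w0); nra. }
    destruct (small_ball_regular gr M z0 r w Hg HB Hw (HM w Hw Nw)) as [_ HR].
    destruct (wfun_pfun_relations gr M w (proj1 (HB' w Hw)) HR) as (_ & _ & _ & _ & E1).
    assert (E2 : C_derive M w = (RtoC (- (2 / 3)) * (wfun gr M w * pfun gr M w))%C).
    { apply (Cmult_cancel_l (RtoC 3)); [apply RtoC_neq; lra|]; rewrite E1.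
      replace (RtoC (- (2 / 3))) with (RtoC (-2) / RtoC 3)%C by (rewrite <- RtoC_div by lra; f_equal; field).
      field; apply RtoC_neq; lra. }
    rewrite E2; set (W := wfun gr M w) in *; set (P := pfun gr M w) in *.
    replace (RtoC (- (2 / 3)) * (W * P) - 0 - (w - z0) * (RtoC (- (2 / 3)) * (w0 * c)))%C
      with (RtoC (- (2 / 3)) * ((W - w0) * P + w0 * (P - (w - z0) * c)))%C by ring.
    rewrite Cmod_mult, Cmod_R, Rabs_Ropp, Rabs_right by lra.
    pose proof (Cmod_triangle ((W - w0) * P)%C (w0 * (P - (w - z0) * c))%C) as T.
    rewrite !Cmod_mult in T.
    destruct (pfun_bound gr M z0 r w Hg HB Hw) as [_ BP]; fold P in BP.
    specialize (Hp w Hw); fold P in Hp; specialize (Hw0' w Hw Nw); fold W in Hw0'.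
    pose proof (Cmod_ge_0 w0); pose proof (Cmod_ge_0 (W - w0)%C); pose proof (Cmod_ge_0 P).
    pose proof (Cmod_ge_0 ((W - w0) * P + w0 * (P - (w - z0) * c))%C).
    assert (Cmod w0 * Cmod (P - (w - z0) * c)%C <= Cmod w0 * (K * Cmod (w - z0)%C ^ 2)) by (apply Rmult_le_compat_l; assumption).
    assert (Cmod (W - w0)%C * Cmod P <= Cmod (W - w0)%C) by nra.
    lra. }
  apply is_cderive_unique, is_cderive_quadratic with
    (K := (Cmod w0 + K1) * K + 2 * Rabs gr * K1) (d := r); [exact Hr|].
  intros w Hw.
  pose proof (Cmod_ge_0 w0) as Hw0p.
  assert (HL : 0 <= (Cmod w0 + K1) * K + 2 * Rabs gr * K1) by nra.
  destruct (Ceq_dec w z0) as [->|Nw].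
  { replace (C_derive (C_derive M) z0 - C_derive (C_derive M) z0 - (z0 - z0) * 0)%C with (RtoC 0) by ring.
    rewrite Cmod_0; apply Rmult_le_pos; [exact HL|apply pow2_ge_0]. }
  destruct (small_ball_regular gr M z0 r w Hg HB Hw (HM w Hw Nw)) as [HS HR].
  rewrite (proj1 (third_order_at_regular_value gr M w HS HR)), H2; unfold M2fun, c.
  specialize (Hw0' w Hw Nw); specialize (Hflat2 w Hw).
  set (W := wfun gr M w) in *.
  replace (W * (RtoC 6 * (M w * M w) - RtoC 2 * RtoC gr) / RtoC 9 - RtoC (- (2 / 3)) * (w0 * RtoC (gr / 3))
     - (w - z0) * 0)%C with (/ RtoC 9 * (RtoC 6 * (W * (M w * M w)) + RtoC (-2) * (RtoC gr * (W - w0))))%C.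
  2:{ rewrite RtoC_opp, !RtoC_div by lra; field; repeat split; apply RtoC_neq; lra. }
  rewrite Cmod_mult, Cmod_inv, Cmod_R, (Rabs_right 9) by (try lra; apply RtoC_neq; lra).
  pose proof (Cmod_triangle (RtoC 6 * (W * (M w * M w)))%C (RtoC (-2) * (RtoC gr * (W - w0)))%C) as T.
  rewrite !Cmod_mult, !Cmod_R, (Rabs_right 6), (Rabs_left (-2)) in T by lra.
  set (x := Cmod (w - z0)%C) in *; assert (Hx : 0 <= x) by apply Cmod_ge_0.
  assert (Hx2 : 0 <= x ^ 2 <= 1) by (simpl; split; nra).
  assert (HWb : Cmod W <= Cmod w0 + K1).
  { pose proof (Cmod_triangle (W - w0)%C w0) as T'; replace (W - w0 + w0)%C with W in T' by ring.
    assert (K1 * x ^ 2 <= K1) by nra. lra. }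
  assert (A1 : Cmod W * (Cmod (M w) * Cmod (M w)) <= (Cmod w0 + K1) * (K * x ^ 2)).
  { apply Rmult_le_compat; [apply Cmod_ge_0|apply Rmult_le_pos; apply Cmod_ge_0|exact HWb|].
    replace (Cmod (M w) * Cmod (M w)) with (Cmod (M w) ^ 2) by ring; exact Hflat2. }
  assert (A2 : Rabs gr * Cmod (W - w0)%C <= Rabs gr * (K1 * x ^ 2)) by (apply Rmult_le_compat_l; lra).
  assert (A3 : 0 <= (Cmod w0 + K1) * (K * x ^ 2)) by (apply Rmult_le_pos; [lra|apply Rmult_le_pos; lra]).
  assert (A4 : 0 <= Rabs gr * (K1 * x ^ 2)) by (apply Rmult_le_pos; [lra|apply Rmult_le_pos; lra]).
  nra.
Qed.

Lemma third_order_at_zero (gr : R) (M : C -> C) (z0 : C) :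
  gr <> 0 -> locally z0 (solves_at gr M) -> M z0 = RtoC 0 ->
  C_derive M z0 = RtoC 0 /\ C_derive (C_derive (C_derive M)) z0 = RtoC 0.
Proof.
  intros Hg HS E0; split; [exact (C_derive_at_zero gr M z0 (locally_C_ex _ _ HS) E0)|].
  destruct (small_ball_exists gr M z0 Hg HS E0) as [r HB].
  assert (Hr : 0 < r) by apply HB.
  destruct (classic (exists u, Cmod (u - z0)%C < r /\ u <> z0 /\ M u = RtoC 0)) as [[u [Hu [Nu Eu]]]|N].
  - assert (Hz : Cmod (z0 - z0)%C < r) by (replace (z0 - z0)%C with (RtoC 0) by ring; rewrite Cmod_0; exact Hr).
    pose proof (two_zeros_all_zero _ _ _ _ _ _ u z0 (pfun_near_translation gr M z0 r Hg HB) Hu Hz Nu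
      (proj2 (pfun_zero_iff gr M z0 r u Hg HB Hu) Eu) (proj2 (pfun_zero_iff gr M z0 r z0 Hg HB Hz) E0)) as A.
    assert (L1 : forall w, Cmod (w - z0)%C < r -> C_derive M w = RtoC 0).
    { intros w Hw; apply (C_derive_at_zero gr M w); [apply HB, Hw|].
      apply (pfun_zero_iff gr M z0 r w Hg HB Hw), A, Hw. }
    assert (Step : forall f : C -> C, (forall w, Cmod (w - z0)%C < r -> f w = RtoC 0) ->
      forall w, Cmod (w - z0)%C < r -> C_derive f w = RtoC 0).
    { intros f Hf w Hw; apply is_cderive_unique, is_cderive_ext_loc with (fun _ => RtoC 0); [|apply is_cderive_const].
      apply locally_C; exists (r - Cmod (w - z0)%C); split; [lra|]; intros y Hy; symmetry; apply Hf.
      replace (y - z0)%C with ((y - w) + (w - z0))%C by ring.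
      eapply Rle_lt_trans; [apply Cmod_triangle|lra]. }
    apply Step; [|exact Hz]; apply Step, L1.
  - apply (third_derivative_at_isolated_zero gr M z0 r Hg HB E0).
    intros w Hw Nw E; apply N; exists w; auto.
Qed.

Lemma first_order_implies_third_order (gr : R) (M : C -> C) :
  gr <> 0 -> first_order_eq gr M -> third_order_eq gr M.
Proof.
  intros Hg H z Hz; cbv zeta.
  assert (HS : locally z (solves_at gr M)).
  { pose proof Hz as Hz'; unfold holomorphic_at in Hz'; apply locally_locally in Hz'.
    generalize (filter_and _ _ Hz Hz'); apply filter_imp; intros w [A B].
    split; [apply is_cderive_C_derive, A|].
    specialize (H w B); apply inv81.
    unfold disc; simpl in H.
    transitivity (C_derive M w * (C_derive M w * (C_derive M w * (C_derive M w * 1))))%C; [ring|].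
    rewrite H; ring. }
  destruct (Ceq_dec (M z) (RtoC 0)) as [E|N1].
  { destruct (third_order_at_zero gr M z Hg HS E) as [-> ->]; rewrite E; simpl; ring. }
  destruct (Ceq_dec (disc gr M z) (RtoC 0)) as [E|N2].
  { destruct (third_order_at_disc_zero gr M z Hg HS E) as [-> [-> ->]]; simpl; ring. }
  apply third_order_at_regular_value; [exact HS|split; assumption].
Qed.

(** * The lemniscate sine *)

(** The lower bound on the slope gives [|a - b| <= 2 |F a - F b|], from which injectivity,
    surjectivity and the Lipschitz continuity of the inverse follow. *)
Lemma inverse_of_expanding (F f : R -> R) :
  (forall x, is_derive F x (f x)) -> (forall x, 1 / 2 <= f x) ->
  exists G : R -> R, (forall x, F (G x) = x) /\ (forall x y, F x = F y -> x = y) /\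
    forall x, is_derive G x (/ f (G x)).
Proof.
  intros HF Hf.
  assert (Hexp : forall a b, a <= b -> (b - a) / 2 <= F b - F a).
  { intros a b Hab; destruct (MVT_gen F a b f) as [c [_ E]].
    - intros; apply HF.
    - intros; apply derivable_continuous_pt; eexists; apply is_derive_Reals, HF.
    - rewrite E; specialize (Hf c); nra. }
  assert (Habs : forall a b, Rabs (a - b) <= 2 * Rabs (F a - F b)).
  { intros a b; destruct (Rle_lt_dec a b) as [H|H].
    - pose proof (Hexp a b H); rewrite !Rabs_left1 by lra; lra.
    - pose proof (Hexp b a (Rlt_le _ _ H)); rewrite !Rabs_right by lra; lra. }
  assert (Hinj : forall x y, F x = F y -> x = y).
  { intros x y E; specialize (Habs x y); rewrite E, Rminus_diag, Rabs_R0 in Habs.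
    pose proof (Rabs_pos (x - y)); assert (E0 : Rabs (x - y) = 0) by lra.
    destruct (Req_dec x y) as [|N]; [assumption|].
    exfalso; apply (Rabs_no_R0 (x - y)); [lra|exact E0]. }
  (* In [sig] form, so that the inverse is obtained by [proj1_sig]. At distance [2 |x - F 0|] on
     either side of 0 the values of [F] enclose [x]. *)
  assert (Hsur : forall x, {t | F t = x}).
  { intros x.
    set (b := 2 * Rabs (x - F 0)).
    assert (Hb : 0 <= b) by (pose proof (Rabs_pos (x - F 0)); unfold b; lra).
    pose proof (Hexp (- b) 0 ltac:(lra)) as H1; pose proof (Hexp 0 b Hb) as H2.
    assert (H3 := Rabs_le_between (x - F 0) (Rabs (x - F 0))).
    assert (H4 : F (- b) <= x <= F b) by (unfold b in *; destruct H3 as [H3 _]; specialize (H3 (Rle_refl _)); lra).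
    destruct (IVT_gen F (- b) b x) as [t [_ Ht]].
    - intros y; apply derivable_continuous_pt; eexists; apply is_derive_Reals, HF.
    - rewrite Rmin_left, Rmax_right by lra; exact H4.
    - exists t; exact Ht. }
  exists (fun x => proj1_sig (Hsur x)).
  assert (HG : forall x, F (proj1_sig (Hsur x)) = x) by (intros x; destruct (Hsur x); assumption).
  split; [exact HG|split; [exact Hinj|]].
  intros x; apply is_derive_iff; intros eps He; cbv beta.
  set (G := fun x => proj1_sig (Hsur x)) in *; fold (G x).
  set (k := f (G x)); assert (Hk : 1 / 2 <= k) by apply Hf.
  (* One factor 2 is lost in [|D| <= 2 |X|] and another in [/ k <= 2]. *)
  destruct (proj1 (is_derive_iff _ _ _) (HF (G x)) (eps / 4)) as [d [Hd H]]; [lra|].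
  exists (d / 2); split; [lra|]; intros y Hy; fold (G y).
  pose proof (Habs (G y) (G x)) as A; unfold G in A at 3 4; rewrite !HG in A.
  specialize (H (G y) ltac:(lra)); unfold G in H at 1 2; rewrite !HG in H; fold k in H.
  set (D := G y - G x) in *; set (X := y - x) in *.
  replace (D - X * / k) with (- (/ k) * (X - D * k)) by (field; lra).
  rewrite Rabs_mult, Rabs_Ropp, Rabs_inv, (Rabs_right k) by lra.
  assert (Hik : 0 < / k <= 2).
  { split; [apply Rinv_0_lt_compat; lra|].
    apply Rmult_le_reg_l with k; [lra|]; rewrite Rinv_r by lra; lra. }
  pose proof (Rabs_pos (X - D * k)); pose proof (Rabs_pos D).
  assert (Rabs (X - D * k) <= eps / 2 * Rabs X) by nra.
  nra.
Qed.

(* The lemniscate sine is sin (theta) where theta' = sqrt (1 + sin^2 theta). *)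
Lemma lemniscate_sine_exists :
  exists (s d : R -> R) (L : R), 0 < L /\
    (forall x, is_derive s x (d x)) /\ (forall x, is_derive d x (- 2 * s x ^ 3)) /\
    (forall x, d x ^ 2 = 1 - s x ^ 4) /\
    (forall x, s (x + L) = s x) /\ (forall x, d (x + L) = d x) /\
    s 0 = 0 /\ d 0 = 1 /\ (forall v, - 1 <= v <= 1 -> exists x, s x = v).
Proof.
  set (f := fun t => / sqrt (1 + sin t ^ 2)).
  assert (Hpos : forall t, 1 <= 1 + sin t ^ 2 <= 2).
  { intros t; pose proof (pow2_ge_0 (sin t)); pose proof (sin2_cos2 t) as E; unfold Rsqr in E.
    pose proof (pow2_ge_0 (cos t)); simpl in *; lra. }
  assert (Hsq : forall t, 1 <= sqrt (1 + sin t ^ 2) <= 2).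
  { intros t; specialize (Hpos t); split.
    - rewrite <- sqrt_1 at 1; apply sqrt_le_1; lra.
    - apply Rle_trans with (sqrt 4); [apply sqrt_le_1; lra|].
      replace 4 with (2 * 2) by ring; rewrite sqrt_square; lra. }
  assert (Hf : forall t, 1 / 2 <= f t).
  { intros t; unfold f, Rdiv; rewrite Rmult_1_l; apply Rinv_le_contravar; specialize (Hsq t); lra. }
  assert (Hcont : forall t, continuous f t).
  { intros t; apply (ex_derive_continuous f); unfold f; auto_derive.
    specialize (Hpos t); specialize (Hsq t); simpl in *; repeat split; lra. }
  set (F := (fun x => RInt f 0 x) : R -> R).
  assert (HF : forall x, is_derive F x (f x)).
  { intros x; apply (is_derive_RInt f F 0 x); [|apply Hcont].
    apply filter_forall; intros y; apply (RInt_correct f), (ex_RInt_continuous f); intros z _; apply Hcont. }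
  destruct (inverse_of_expanding F f HF Hf) as [th [HFt [Hinj Hth]]].
  assert (F0 : F 0 = 0) by exact (RInt_point (V := R_CompleteNormedModule) 0 f).
  (* The integrand has period [2 PI], so [F (x + 2 PI) - F x] is constant; this makes [F (2 PI)] a
     period of the lemniscate sine. *)
  assert (Hper : forall x, F (x + 2 * PI) = F x + F (2 * PI)).
  { intros x.
    destruct (MVT_gen (fun y => F (y + 2 * PI) - F y) 0 x (fun _ => 0)) as [c [_ E]].
    - intros y _; replace 0 with (1 * f (y + 2 * PI) - f y)
        by (unfold f; rewrite sin_plus, sin_2PI, cos_2PI; rewrite Rmult_1_r, Rmult_0_r, Rplus_0_r; ring).
      apply (is_derive_minus (V := R_NormedModule)); [|apply HF].
      apply (is_derive_comp F (fun y => y + 2 * PI)); [apply HF|auto_derive; [exact I|ring]].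
    - intros y _; apply derivable_continuous_pt; eexists; apply is_derive_Reals.
      apply (is_derive_minus (V := R_NormedModule)); [|apply HF].
      apply (is_derive_comp F (fun y => y + 2 * PI)); [apply HF|auto_derive; [exact I|reflexivity]].
    - rewrite Rplus_0_l, F0 in E; lra. }
  assert (Hth' : forall x, is_derive th x (sqrt (1 + sin (th x) ^ 2))).
  { intros x; specialize (Hth x); unfold f in Hth; rewrite Rinv_inv in Hth; exact Hth. }
  assert (Hthp : forall x, th (x + F (2 * PI)) = th x + 2 * PI).
  { intros x; apply Hinj; rewrite HFt, Hper, HFt; reflexivity. }
  assert (Hth0 : th 0 = 0) by (apply Hinj; rewrite HFt, F0; reflexivity).
  assert (Hder : forall x, Derive th x = sqrt (1 + sin (th x) ^ 2)).
  { intros x; apply is_derive_unique, Hth'. }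
  exists (fun x => sin (th x)), (fun x => cos (th x) * sqrt (1 + sin (th x) ^ 2)), (F (2 * PI)).
  split.
  { unfold F; apply RInt_gt_0; [pose proof PI_RGT_0; lra| |].
    - intros x _; specialize (Hf x); lra.
    - intros x _; apply Hcont. }
  split.
  { intros x; auto_derive; [eexists; apply Hth'|rewrite Hder; ring]. }
  split.
  { intros x; auto_derive.
    - specialize (Hpos (th x)); simpl in Hpos; repeat split; try lra; eexists; apply Hth'.
    - rewrite Hder.
      pose proof (Hsq (th x)) as Hq; pose proof (Hpos (th x)) as Hp.
      assert (E : sqrt (1 + sin (th x) ^ 2) * sqrt (1 + sin (th x) ^ 2) = 1 + sin (th x) ^ 2) by (apply sqrt_sqrt; lra).
      pose proof (sin2_cos2 (th x)) as C2; unfold Rsqr in C2.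
      replace (1 + sin (th x) * (sin (th x) * 1)) with (1 + sin (th x) ^ 2) by ring.
      set (q := sqrt (1 + sin (th x) ^ 2)) in *; set (a := sin (th x)) in *; set (b := cos (th x)) in *.
      assert (Eb : b * b = 1 - a * a) by lra.
      apply Rmult_eq_reg_l with q; [|lra].
      transitivity (- a * (q * q) * q + (b * b) * a * q); [field; lra|].
      rewrite E, Eb; ring. }
  split.
  { intros x; specialize (Hpos (th x)).
    pose proof (sin2_cos2 (th x)) as C2; unfold Rsqr in C2.
    rewrite Rpow_mult_distr; replace (sqrt (1 + sin (th x) ^ 2) ^ 2) with (1 + sin (th x) ^ 2)
      by (rewrite pow2_sqrt by lra; reflexivity).
    replace (cos (th x) ^ 2) with (1 - sin (th x) ^ 2) by (simpl; lra). ring. }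
  split; [intros x; rewrite Hthp, sin_plus, sin_2PI, cos_2PI; ring|].
  split.
  { intros x; rewrite Hthp.
    replace (sin (th x + 2 * PI)) with (sin (th x)) by (rewrite sin_plus, sin_2PI, cos_2PI; ring).
    rewrite cos_plus, sin_2PI, cos_2PI; ring. }
  split; [rewrite Hth0; apply sin_0|].
  split; [rewrite Hth0, sin_0, cos_0; replace (1 + 0 ^ 2) with 1 by ring; rewrite sqrt_1; ring|].
  intros v Hv; exists (F (asin v)).
  replace (th (F (asin v))) with (asin v); [apply sin_asin, Hv|].
  apply Hinj; rewrite HFt; reflexivity.
Qed.

(** * Real differentiability in two variables and the Cauchy-Riemann equations *)

Lemma differentiable_linear (a b x y : R) :
  differentiable_pt_lim (fun u v => a * u + b * v) x y a b.
Proof.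
  intros eps; exists eps; intros u v _ _.
  replace (a * u + b * v - (a * x + b * y) - (a * (u - x) + b * (v - y))) with 0 by ring.
  rewrite Rabs_R0; apply Rmult_le_pos; [apply Rlt_le, cond_pos|].
  eapply Rle_trans; [apply Rabs_pos|apply Rmax_l].
Qed.

(** Lets [differentiate] compute the partial derivatives into existential variables, to be compared
    with the expected values afterwards. *)
Lemma differentiable_eq (f : R -> R -> R) (x y a b a' b' : R) :
  differentiable_pt_lim f x y a b -> a = a' -> b = b' -> differentiable_pt_lim f x y a' b'.
Proof. intros H <- <-; exact H. Qed.

Lemma differentiable_fst (f : R -> R) (x y l : R) :
  is_derive f x l -> differentiable_pt_lim (fun u _ => f u) x y l 0.
Proof. intros H; apply differentiable_pt_lim_proj1_0, is_derive_Reals, H. Qed.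

Lemma differentiable_snd (f : R -> R) (x y l : R) :
  is_derive f y l -> differentiable_pt_lim (fun _ v => f v) x y 0 l.
Proof.
  intros H.
  pose proof (differentiable_pt_lim_comp (fun u _ => f u) (fun u v => 0 * u + 1 * v) (fun u v => 0 * u + 0 * v)
    x y l 0 0 1 0 0) as D.
  replace 0 with (l * 0 + 0 * 0) by ring; replace l with (l * 1 + 0 * 0) at 2 by ring.
  apply differentiable_pt_lim_ext with (fun u v : R => f (0 * u + 1 * v)).
  - exists (mkposreal 1 Rlt_0_1); intros u v _ _; f_equal; ring.
  - apply D; try apply differentiable_linear.
    replace (0 * x + 1 * y) with y by ring; apply differentiable_fst, H.
Qed.

Lemma differentiable_comp1 (g : R -> R) (f : R -> R -> R) (x y l fx fy : R) :
  is_derive g (f x y) l -> differentiable_pt_lim f x y fx fy ->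
  differentiable_pt_lim (fun u v => g (f u v)) x y (l * fx) (l * fy).
Proof.
  intros Hg Hf.
  pose proof (differentiable_pt_lim_comp (fun u _ => g u) f f x y l 0 fx fy fx fy) as D.
  replace (l * fx) with (l * fx + 0 * fx) by ring; replace (l * fy) with (l * fy + 0 * fy) by ring.
  apply D; [apply differentiable_fst|..]; assumption.
Qed.

Lemma differentiable_plus (f g : R -> R -> R) (x y fx fy gx gy : R) :
  differentiable_pt_lim f x y fx fy -> differentiable_pt_lim g x y gx gy ->
  differentiable_pt_lim (fun u v => f u v + g u v) x y (fx + gx) (fy + gy).
Proof.
  intros Hf Hg.
  pose proof (differentiable_pt_lim_comp (fun u v => 1 * u + 1 * v) f g x y 1 1 fx fy gx gy
    (differentiable_linear _ _ _ _) Hf Hg) as D.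
  replace (fx + gx) with (1 * fx + 1 * gx) by ring; replace (fy + gy) with (1 * fy + 1 * gy) by ring.
  revert D; apply differentiable_pt_lim_ext.
  exists (mkposreal 1 Rlt_0_1); intros u v _ _; ring.
Qed.

Lemma differentiable_mult (f g : R -> R -> R) (x y fx fy gx gy : R) :
  differentiable_pt_lim f x y fx fy -> differentiable_pt_lim g x y gx gy ->
  differentiable_pt_lim (fun u v => f u v * g u v) x y (fx * g x y + f x y * gx) (fy * g x y + f x y * gy).
Proof.
  intros Hf Hg.
  apply filterdiff_differentiable_pt_lim in Hf; apply filterdiff_differentiable_pt_lim in Hg.
  apply filterdiff_differentiable_pt_lim.
  pose proof (filterdiff_mult_fct (K := R_AbsRing) (U := prod_NormedModule R_AbsRing R_NormedModule R_NormedModule)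
    (fun u => f (fst u) (snd u)) (fun u => g (fst u) (snd u)) (x, y) _ _ Rmult_comm Hf Hg) as D.
  eapply filterdiff_ext_lin; [exact D|].
  intros [u v]; simpl; unfold plus, mult; simpl; ring.
Qed.

Lemma Cauchy_Riemann (u v : R -> R -> R) (x y a b : R) :
  differentiable_pt_lim u x y a (- b) -> differentiable_pt_lim v x y b a ->
  is_cderive (fun z => (u (fst z) (snd z), v (fst z) (snd z))) (x, y) (a, b).
Proof.
  intros Hu Hv; apply is_cderive_iff; intros eps He.
  (* The halving pays for the factor [sqrt 2 <= 2] between the modulus and the maximum of the
     coordinates. *)
  assert (He' : 0 < eps / 2) by lra.
  destruct (Hu (mkposreal _ He')) as [d1 H1]; destruct (Hv (mkposreal _ He')) as [d2 H2].
  exists (Rmin d1 d2); split; [apply Rmin_glb_lt; apply cond_pos|].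
  intros [w1 w2] Hw; unfold fst, snd.
  pose proof (Rmin_l d1 d2); pose proof (Rmin_r d1 d2).
  pose proof (Rmax_Cmod ((w1, w2) - (x, y))%C) as HM; simpl in HM.
  fold (w1 - x) (w2 - y) in HM.
  pose proof (Rmax_l (Rabs (w1 - x)) (Rabs (w2 - y))); pose proof (Rmax_r (Rabs (w1 - x)) (Rabs (w2 - y))).
  specialize (H1 w1 w2 ltac:(lra) ltac:(lra)); specialize (H2 w1 w2 ltac:(lra) ltac:(lra)); simpl in H1, H2.
  set (m := Cmod ((w1, w2) - (x, y))%C) in *.
  eapply Rle_trans; [apply Cmod_2Rmax|].
  assert (Hs : sqrt 2 <= 2).
  { apply Rle_trans with (sqrt 4); [apply sqrt_le_1; lra|].
    replace 4 with (2 * 2) by ring; rewrite sqrt_square; lra. }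
  match goal with |- _ * ?X <= _ => assert (HX : 0 <= X <= eps / 2 * m); [split|] end.
  - eapply Rle_trans; [apply Rabs_pos|apply Rmax_l].
  - apply Rmax_lub.
    + eapply Rle_trans; [|apply Rle_trans with (1 := H1)].
      * right; unfold Cminus, Cplus, Cmult, Copp; simpl; f_equal; ring.
      * apply Rmult_le_compat_l; lra.
    + eapply Rle_trans; [|apply Rle_trans with (1 := H2)].
      * right; unfold Cminus, Cplus, Cmult, Copp; simpl; f_equal; ring.
      * apply Rmult_le_compat_l; lra.
  - pose proof (sqrt_pos 2). nra.
Qed.

(** * The complex lemniscate sine, its reciprocal and its logarithmic derivative *)

Definition lemniscate_pair (s d : R -> R) : Prop :=
  (forall x, is_derive s x (d x)) /\ (forall x, is_derive d x (- 2 * s x ^ 3)) /\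
  (forall x, d x ^ 2 = 1 - s x ^ 4).

(* The addition theorem with s (i y) = i s (y) extends s to x + i y as
   (s x d y + i s y d x) / (1 - (s x)^2 (s y)^2). *)
Definition csl (s d : R -> R) (z : C) : C :=
  (s (fst z) * d (snd z) * / (1 + - 1 * (s (fst z) ^ 2 * s (snd z) ^ 2)),
   s (snd z) * d (fst z) * / (1 + - 1 * (s (fst z) ^ 2 * s (snd z) ^ 2))).

(* The reciprocal of [csl]. *)
Definition csl_inv (s d : R -> R) (z : C) : C :=
  (s (fst z) * d (snd z) * / (s (fst z) ^ 2 + s (snd z) ^ 2),
   - 1 * (s (snd z) * d (fst z)) * / (s (fst z) ^ 2 + s (snd z) ^ 2)).

(** For a lemniscate pair the first factor vanishes at the zeros of [csl] and the second at its
    poles; together these are the poles of [csl_log] and of [csl_inv] plus or minus [csl]. *)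
Definition csl_den (s : R -> R) (z : C) : R :=
  (s (fst z) ^ 2 + s (snd z) ^ 2) * (1 + - 1 * (s (fst z) ^ 2 * s (snd z) ^ 2)).

(* The logarithmic derivative of [csl]. *)
Definition csl_log (s d : R -> R) (z : C) : C :=
  (s (fst z) * d (fst z) * (1 + s (snd z) ^ 4)
     * / (s (fst z) ^ 2 + s (snd z) ^ 2) * / (1 + - 1 * (s (fst z) ^ 2 * s (snd z) ^ 2)),
   - 1 * (s (snd z) * d (snd z) * (1 + s (fst z) ^ 4))
     * / (s (fst z) ^ 2 + s (snd z) ^ 2) * / (1 + - 1 * (s (fst z) ^ 2 * s (snd z) ^ 2))).

Lemma csl_den_neq_0 (s : R -> R) (z : C) :
  csl_den s z <> 0 <->
  s (fst z) ^ 2 + s (snd z) ^ 2 <> 0 /\ 1 + - 1 * (s (fst z) ^ 2 * s (snd z) ^ 2) <> 0.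
Proof.
  unfold csl_den; split.
  - intros H; split; intros E; apply H; rewrite E; ring.
  - intros [H1 H2]; apply Rmult_integral_contrapositive; auto.
Qed.

Lemma is_derive_Rconst (c x : R) : is_derive (fun _ : R => c) x 0.
Proof. apply (is_derive_const (V := R_NormedModule)). Qed.

Lemma is_derive_Rinv (x : R) : x <> 0 -> is_derive Rinv x (- (/ x * / x)).
Proof. intros H; auto_derive; [exact H|field; exact H]. Qed.

Lemma is_derive_pow2 (x : R) : is_derive (fun t => t ^ 2) x (2 * x).
Proof. auto_derive; [exact I|ring]. Qed.

Lemma is_derive_pow4 (x : R) : is_derive (fun t => t ^ 4) x (4 * x ^ 3).
Proof. auto_derive; [exact I|ring]. Qed.

(** Only sums, products, inverses and the powers 2 and 4 are recognised, hence the form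
    [1 + - 1 * t] instead of [1 - t] in the formulas for [csl]. *)
Ltac differentiate :=
  match goal with
  | |- differentiable_pt_lim (fun u v => @?f u v + @?g u v) _ _ _ _ => apply (differentiable_plus f g); differentiate
  | |- differentiable_pt_lim (fun u v => @?f u v * @?g u v) _ _ _ _ => apply (differentiable_mult f g); differentiate
  | |- differentiable_pt_lim (fun u v => / @?f u v) _ _ _ _ =>
      apply (differentiable_comp1 Rinv f); [apply is_derive_Rinv; assumption|differentiate]
  | |- differentiable_pt_lim (fun u v => (@?f u v) ^ 2) _ _ _ _ =>
      apply (differentiable_comp1 (fun t => t ^ 2) f); [apply is_derive_pow2|differentiate]
  | |- differentiable_pt_lim (fun u v => (@?f u v) ^ 4) _ _ _ _ =>
      apply (differentiable_comp1 (fun t => t ^ 4) f); [apply is_derive_pow4|differentiate]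
  | |- differentiable_pt_lim (fun u v => ?f u) _ _ _ _ => apply differentiable_fst; eassumption
  | |- differentiable_pt_lim (fun u v => ?f v) _ _ _ _ => apply differentiable_snd; eassumption
  | |- differentiable_pt_lim (fun u v => ?c) _ _ _ _ => apply (differentiable_fst (fun _ => c)), is_derive_Rconst
  end.

(** The inverses of the two denominators become variables subject to [Hi] and [Hj]; with
    [d^2 = 1 - s^4] at both coordinates the Cauchy-Riemann equations are then polynomial
    consequences, decided by [nsatz]. *)
Ltac CR u v :=
  match goal with
  | Ex : ?d ?x ^ 2 = 1 - ?s ?x ^ 4, Ey : ?d ?y ^ 2 = 1 - ?s ?y ^ 4,
    Hi : _ = 1, Hj : _ = 1 |- is_derive _ (?x, ?y) ?l =>
    replace l with (fst l, snd l) by (symmetry; apply surjective_pairing);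
    apply (Cauchy_Riemann u v);
    (eapply differentiable_eq; [differentiate|..]);
    unfold csl_log, csl_inv, csl, Cmult, Cplus, Copp; cbn [fst snd];
    clear - Ex Ey Hi Hj; revert Ex Ey Hi Hj;
    generalize (/ (s x ^ 2 + s y ^ 2)); generalize (/ (1 + - 1 * (s x ^ 2 * s y ^ 2)));
    generalize (s x) (s y) (d x) (d y); cbn [pow]; intros; nsatz
  end.

Lemma is_cderive_csl (s d : R -> R) (z : C) :
  lemniscate_pair s d -> csl_den s z <> 0 ->
  is_cderive (csl s d) z (csl_log s d z * csl s d z)%C /\
  is_cderive (csl_inv s d) z (- (csl_log s d z * csl_inv s d z))%C /\
  is_cderive (csl_log s d) z (- (csl s d z * csl s d z + csl_inv s d z * csl_inv s d z))%C.
Proof.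
  intros (Hs & Hd & Hsd) HQ; apply csl_den_neq_0 in HQ; destruct HQ as [H1 H2].
  destruct z as [x y]; simpl fst in *; simpl snd in *.
  pose proof (Hsd x) as Ex; pose proof (Hsd y) as Ey.
  pose proof (Hs x) as Hsx; pose proof (Hs y) as Hsy; pose proof (Hd x) as Hdx; pose proof (Hd y) as Hdy.
  pose proof (Rinv_l _ H1) as Hj; pose proof (Rinv_l _ H2) as Hi.
  split; [|split].
  { CR (fun x y => s x * d y * / (1 + - 1 * (s x ^ 2 * s y ^ 2)))
      (fun x y => s y * d x * / (1 + - 1 * (s x ^ 2 * s y ^ 2))). }
  { CR (fun x y => s x * d y * / (s x ^ 2 + s y ^ 2))
      (fun x y => - 1 * (s y * d x) * / (s x ^ 2 + s y ^ 2)). }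
  { CR (fun x y => s x * d x * (1 + s y ^ 4) * / (s x ^ 2 + s y ^ 2) * / (1 + - 1 * (s x ^ 2 * s y ^ 2)))
      (fun x y => - 1 * (s y * d y * (1 + s x ^ 4)) * / (s x ^ 2 + s y ^ 2) * / (1 + - 1 * (s x ^ 2 * s y ^ 2))). }
Qed.

(** * Poles and meromorphy *)

Lemma locally'_C (z : C) (P : C -> Prop) :
  locally' z P <-> exists d : R, 0 < d /\ forall w : C, Cmod (w - z)%C < d -> w <> z -> P w.
Proof. unfold locally', within; apply locally_C. Qed.

Lemma filterlim_p_infty_C (f : C -> C) (z : C) :
  filterlim (fun w => Cmod (f w)) (locally' z) (Rbar_locally p_infty) <->
  forall B : R, exists d : R, 0 < d /\
    forall w : C, Cmod (w - z)%C < d -> w <> z -> B < Cmod (f w).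
Proof.
  split.
  - intros H B; apply locally'_C, (H (fun y => B < y)); exists B; auto.
  - intros H P [B HB]; destruct (H B) as [d [Hd H1]].
    apply locally'_C; exists d; split; auto.
Qed.

(** Differentiability at [z] would bound [f] nearby. This identifies the points at which the
    equations for the elliptic solution have to be checked. *)
Lemma pole_not_holomorphic (f : C -> C) (z : C) : pole f z -> ~ holomorphic_at f z.
Proof.
  intros [_ HP] HH; apply locally_C_ex in HH.
  pose proof (is_cderive_continuous _ _ _ (is_cderive_C_derive _ _ HH)) as Hc.
  destruct (proj1 (filterlim_cmod _ _ _) Hc 1 Rlt_0_1) as [d1 [Hd1 H1]].
  destruct (proj1 (filterlim_p_infty_C _ _) HP (Cmod (f z) + 1)) as [d2 [Hd2 H2]].
  set (e := Rmin d1 d2 / 2).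
  assert (Hm : 0 < Rmin d1 d2) by (apply Rmin_glb_lt; assumption).
  pose proof (Rmin_l d1 d2); pose proof (Rmin_r d1 d2).
  set (w := (z + RtoC e)%C).
  assert (Hw : Cmod (w - z)%C = e).
  { unfold w; replace (z + RtoC e - z)%C with (RtoC e) by ring; rewrite Cmod_R, Rabs_right; unfold e; lra. }
  assert (Hwz : w <> z).
  { intros E; rewrite E in Hw; replace (z - z)%C with (RtoC 0) in Hw by ring; rewrite Cmod_0 in Hw; unfold e in Hw; lra. }
  unfold e in *; specialize (H1 w ltac:(lra)); specialize (H2 w ltac:(lra) Hwz).
  pose proof (Cmod_triangle (f w - f z)%C (f z)) as T.
  replace (f w - f z + f z)%C with (f w) in T by ring; lra.
Qed.

Lemma Cmod_scale (k : R) (w z : C) : 0 < k -> Cmod (RtoC k * w - RtoC k * z)%C = k * Cmod (w - z)%C.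
Proof.
  intros Hk; replace (RtoC k * w - RtoC k * z)%C with (RtoC k * (w - z))%C by ring.
  rewrite Cmod_mult, Cmod_R, Rabs_right; lra.
Qed.

Lemma ex_cderive_rescale (a : C) (k : R) (f : C -> C) (z : C) :
  ex_derive (K := C_AbsRing) (V := C_NormedModule) f (RtoC k * z)%C ->
  ex_derive (K := C_AbsRing) (V := C_NormedModule) (fun w => a * f (RtoC k * w))%C z.
Proof.
  intros [l Hl]; eexists; apply (is_cderive_scal a (fun w => f (RtoC k * w)%C)).
  apply (is_cderive_comp_scal (RtoC k) f z l Hl).
Qed.

Lemma locally_rescale (k : R) (z : C) (P : C -> Prop) :
  0 < k -> locally (RtoC k * z)%C P -> locally z (fun w => P (RtoC k * w)%C).
Proof.
  intros Hk H; apply locally_C in H; destruct H as [d [Hd H]]; apply locally_C.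
  exists (d / k); split; [apply Rdiv_lt_0_compat; assumption|]; intros w Hw.
  apply H; rewrite Cmod_scale by exact Hk.
  apply Rmult_lt_reg_r with (/ k); [apply Rinv_0_lt_compat, Hk|].
  replace (k * Cmod (w - z)%C * / k) with (Cmod (w - z)%C) by (field; lra); exact Hw.
Qed.

Lemma pole_rescale (a : C) (k : R) (f : C -> C) (z : C) :
  a <> RtoC 0 -> 0 < k -> pole f (RtoC k * z)%C -> pole (fun w => a * f (RtoC k * w))%C z.
Proof.
  intros Ha Hk [H1 H2].
  assert (Hinj : forall w, w <> z -> (RtoC k * w)%C <> (RtoC k * z)%C).
  { intros w N E; apply N; apply (Cmult_cancel_l (RtoC k)); [apply RtoC_neq; lra|exact E]. }
  split.
  - unfold locally', within in *; apply (locally_rescale k z _ Hk) in H1; revert H1; apply filter_imp.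
    intros w Hw N; apply ex_cderive_rescale, Hw, Hinj, N.
  - apply filterlim_p_infty_C; intros B.
    assert (Ha' : 0 < Cmod a) by (apply Cmod_gt_0, Ha).
    destruct (proj1 (filterlim_p_infty_C _ _) H2 (B / Cmod a)) as [d [Hd Hw]].
    exists (d / k); split; [apply Rdiv_lt_0_compat; assumption|]; intros w Hwz N.
    assert (A : Cmod (RtoC k * w - RtoC k * z)%C < d).
    { rewrite Cmod_scale by exact Hk; apply Rmult_lt_reg_r with (/ k); [apply Rinv_0_lt_compat, Hk|].
      replace (k * Cmod (w - z)%C * / k) with (Cmod (w - z)%C) by (field; lra); exact Hwz. }
    specialize (Hw _ A (Hinj w N)); rewrite Cmod_mult.
    apply Rmult_lt_reg_r with (/ Cmod a); [apply Rinv_0_lt_compat, Ha'|].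
    replace (Cmod a * Cmod (f (RtoC k * w)%C) * / Cmod a) with (Cmod (f (RtoC k * w)%C)) by (field; lra).
    exact Hw.
Qed.

Lemma meromorphic_rescale (a : C) (k : R) (f : C -> C) :
  a <> RtoC 0 -> 0 < k -> meromorphic f -> meromorphic (fun w => a * f (RtoC k * w))%C.
Proof.
  intros Ha Hk H z; destruct (H (RtoC k * z)%C) as [HH|HP].
  - left; unfold holomorphic_at; apply (locally_rescale k z _ Hk) in HH; revert HH; apply filter_imp.
    intros w; apply ex_cderive_rescale.
  - right; apply pole_rescale; assumption.
Qed.

Lemma is_period_of_invariant (f : C -> C) (p : C) : (forall z, f (z + p)%C = f z) -> is_period f p.
Proof.
  intros H z Hz; split; [|apply H].
  apply locally_C in Hz; destruct Hz as [d [Hd Hz]]; apply locally_C; exists d; split; [exact Hd|].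
  intros w Hw; destruct (Hz (w - p)%C) as [l Hl].
  { replace (w - p - z)%C with (w - (z + p))%C by ring; exact Hw. }
  exists l; apply is_cderive_iff; intros eps He.
  destruct (proj1 (is_cderive_iff _ _ _) Hl eps He) as [d' [Hd' H']]; exists d'; split; [exact Hd'|].
  intros y Hy; specialize (H' (y - p)%C).
  replace (y - p - (w - p))%C with (y - w)%C in H' by ring.
  rewrite <- (H (y - p)%C), <- (H (w - p)%C) in H'.
  replace (y - p + p)%C with y in H' by ring; replace (w - p + p)%C with w in H' by ring.
  apply H', Hy.
Qed.

Lemma isolated_zero (f : R -> R) (x l : R) :
  f x = 0 -> is_derive f x l -> l <> 0 ->
  exists d, 0 < d /\ forall y, Rabs (y - x) < d -> y <> x -> f y <> 0.
Proof.
  intros E H Hl.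
  assert (Hl' : 0 < Rabs l) by (apply Rabs_pos_lt, Hl).
  destruct (proj1 (is_derive_iff _ _ _) H (Rabs l / 2)) as [d [Hd H1]]; [lra|].
  exists d; split; [exact Hd|]; intros y Hy N Ey; specialize (H1 y Hy).
  rewrite Ey, E in H1; replace (0 - 0 - (y - x) * l) with (- ((y - x) * l)) in H1 by ring.
  rewrite Rabs_Ropp, Rabs_mult in H1.
  assert (0 < Rabs (y - x)) by (apply Rabs_pos_lt; lra). nra.
Qed.

Lemma continuous_near (f : R -> R) (x l : R) (eps : R) :
  is_derive f x l -> 0 < eps -> exists d, 0 < d /\ forall y, Rabs (y - x) < d -> Rabs (f y - f x) < eps.
Proof.
  intros H He; apply continuity_pt_iff; [|exact He].
  apply derivable_continuous_pt; eexists; apply is_derive_Reals, H.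
Qed.

Lemma lemniscate_bounds (s d : R -> R) (x : R) : lemniscate_pair s d -> 0 <= s x ^ 2 <= 1.
Proof.
  intros (_ & _ & H); specialize (H x); pose proof (pow2_ge_0 (d x)); pose proof (pow2_ge_0 (s x)).
  split; [assumption|]; replace (s x ^ 4) with (s x ^ 2 * s x ^ 2) in H by ring. nra.
Qed.

Lemma csl_den_nonneg (s d : R -> R) (z : C) :
  lemniscate_pair s d ->
  0 <= s (fst z) ^ 2 + s (snd z) ^ 2 /\ 0 <= 1 + - 1 * (s (fst z) ^ 2 * s (snd z) ^ 2).
Proof.
  intros H; pose proof (lemniscate_bounds s d (fst z) H); pose proof (lemniscate_bounds s d (snd z) H).
  split; nra.
Qed.

Lemma csl_den_continuous (s d : R -> R) (z : C) (eps : R) :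
  lemniscate_pair s d -> 0 < eps ->
  exists e, 0 < e /\ forall w, Cmod (w - z)%C < e -> Rabs (csl_den s w - csl_den s z) < eps.
Proof.
  intros (Hs & _) He; destruct z as [x y].
  pose proof (Hs x) as Hx; pose proof (Hs y) as Hy.
  assert (HD : differentiable_pt (fun x y => (s x ^ 2 + s y ^ 2) * (1 + - 1 * (s x ^ 2 * s y ^ 2))) x y).
  { eexists; eexists; differentiate. }
  apply differentiable_continuity_pt in HD; destruct (HD (mkposreal eps He)) as [e H].
  exists e; split; [apply cond_pos|]; intros [u v] Hw.
  pose proof (Rmax_Cmod ((u, v) - (x, y))%C) as HM; simpl in HM.
  pose proof (Rmax_l (Rabs (u + - x)) (Rabs (v + - y))); pose proof (Rmax_r (Rabs (u + - x)) (Rabs (v + - y))).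
  apply H; unfold Rminus; (eapply Rle_lt_trans; [|exact Hw]); (eapply Rle_trans; [|exact HM]); assumption.
Qed.

Lemma csl_den_open (s d : R -> R) (z : C) :
  lemniscate_pair s d -> csl_den s z <> 0 -> locally z (fun w => csl_den s w <> 0).
Proof.
  intros H N; apply locally_C.
  destruct (csl_den_continuous s d z (Rabs (csl_den s z)) H) as [e [He Hw]]; [apply Rabs_pos_lt, N|].
  exists e; split; [exact He|]; intros w Hww E; specialize (Hw w Hww); rewrite E in Hw.
  unfold Rminus in Hw; rewrite Rplus_0_l, Rabs_Ropp in Hw; lra.
Qed.

Lemma pair_neq (u v x y : R) : (u, v) <> (x, y) -> u <> x \/ v <> y.
Proof.
  intros N; destruct (Req_dec u x) as [->|]; [right|left; assumption].
  intros ->; apply N; reflexivity.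
Qed.

Lemma square_zero (x : R) : x ^ 2 = 0 -> x = 0.
Proof. intros H; apply Rsqr_0_uniq; unfold Rsqr; simpl in H; lra. Qed.

(** Either [s] vanishes at both coordinates, and its zeros are simple because [d^2 = 1] there, or
    [s^2 = 1] at both, and the zeros of [d] are simple because [d' = - 2 s^3]. In each case the
    factor of [csl_den] that does not vanish is kept nonzero by continuity of [s]. *)
Lemma csl_den_zero_isolated (s d : R -> R) (z : C) :
  lemniscate_pair s d -> csl_den s z = 0 ->
  exists e, 0 < e /\ forall w, Cmod (w - z)%C < e -> w <> z -> csl_den s w <> 0.
Proof.
  intros HL E; pose proof HL as (Hs & Hd & Hsd); destruct z as [x y].
  pose proof (lemniscate_bounds s d x HL) as Bx; pose proof (lemniscate_bounds s d y HL) as By.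
  assert (Hcoord : forall e u v, Cmod ((u, v) - (x, y))%C < e -> Rabs (u - x) < e /\ Rabs (v - y) < e).
  { intros e u v Hw; pose proof (Rmax_Cmod ((u, v) - (x, y))%C) as HM; simpl in HM.
    pose proof (Rmax_l (Rabs (u + - x)) (Rabs (v + - y))); pose proof (Rmax_r (Rabs (u + - x)) (Rabs (v + - y))).
    unfold Rminus; split; lra. }
  unfold csl_den in E; simpl fst in E; simpl snd in E.
  destruct (Rmult_integral _ _ E) as [E1|E1].
  - assert (Zx : s x = 0) by (apply square_zero; lra).
    assert (Zy : s y = 0) by (apply square_zero; lra).
    assert (Nx : d x <> 0) by (intros N; pose proof (Hsd x) as D; rewrite N, Zx in D; simpl in D; lra).
    assert (Ny : d y <> 0) by (intros N; pose proof (Hsd y) as D; rewrite N, Zy in D; simpl in D; lra).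
    destruct (isolated_zero s x _ Zx (Hs x) Nx) as [d1 [Hd1 I1]].
    destruct (isolated_zero s y _ Zy (Hs y) Ny) as [d2 [Hd2 I2]].
    destruct (continuous_near s x _ 1 (Hs x) Rlt_0_1) as [d3 [Hd3 C3]].
    exists (Rmin d1 (Rmin d2 d3)); split; [repeat apply Rmin_glb_lt; assumption|].
    intros [u v] Hw N; apply Hcoord in Hw; destruct Hw as [Hu Hv].
    pose proof (Rmin_l d1 (Rmin d2 d3)); pose proof (Rmin_r d1 (Rmin d2 d3)).
    pose proof (Rmin_l d2 d3); pose proof (Rmin_r d2 d3).
    specialize (C3 u ltac:(lra)); rewrite Zx, Rminus_0_r in C3; apply Rabs_lt_between in C3.
    pose proof (lemniscate_bounds s d u HL); pose proof (lemniscate_bounds s d v HL).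
    apply csl_den_neq_0; simpl fst; simpl snd; split.
    + apply pair_neq in N; destruct N as [N|N].
      * specialize (I1 u ltac:(lra) N); assert (0 < s u ^ 2) by (apply pow2_gt_0, I1); lra.
      * specialize (I2 v ltac:(lra) N); assert (0 < s v ^ 2) by (apply pow2_gt_0, I2); lra.
    + assert (s u ^ 2 < 1) by nra. nra.
  - assert (Zx : s x ^ 2 = 1) by nra. assert (Zy : s y ^ 2 = 1) by nra.
    assert (Ex : d x = 0).
    { pose proof (Hsd x) as D; replace (s x ^ 4) with (s x ^ 2 * s x ^ 2) in D by ring; rewrite Zx in D; apply square_zero; lra. }
    assert (Ey : d y = 0).
    { pose proof (Hsd y) as D; replace (s y ^ 4) with (s y ^ 2 * s y ^ 2) in D by ring; rewrite Zy in D; apply square_zero; lra. }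
    assert (Nx : - 2 * s x ^ 3 <> 0).
    { intros N; assert (s x * s x ^ 2 = 0) by (simpl in *; lra); rewrite Zx, Rmult_1_r in *; rewrite H in Zx; simpl in Zx; lra. }
    assert (Ny : - 2 * s y ^ 3 <> 0).
    { intros N; assert (s y * s y ^ 2 = 0) by (simpl in *; lra); rewrite Zy, Rmult_1_r in *; rewrite H in Zy; simpl in Zy; lra. }
    destruct (isolated_zero d x _ Ex (Hd x) Nx) as [d1 [Hd1 I1]].
    destruct (isolated_zero d y _ Ey (Hd y) Ny) as [d2 [Hd2 I2]].
    destruct (continuous_near s x _ 1 (Hs x) Rlt_0_1) as [d3 [Hd3 C3]].
    exists (Rmin d1 (Rmin d2 d3)); split; [repeat apply Rmin_glb_lt; assumption|].
    intros [u v] Hw N; apply Hcoord in Hw; destruct Hw as [Hu Hv].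
    pose proof (Rmin_l d1 (Rmin d2 d3)); pose proof (Rmin_r d1 (Rmin d2 d3)).
    pose proof (Rmin_l d2 d3); pose proof (Rmin_r d2 d3).
    specialize (C3 u ltac:(lra)).
    assert (Nu : s u <> 0).
    { intros Z; rewrite Z in C3; unfold Rminus in C3; rewrite Rplus_0_l, Rabs_Ropp in C3.
      assert (Rabs (s x) ^ 2 = 1) by (rewrite pow2_abs; exact Zx); pose proof (Rabs_pos (s x)); nra. }
    assert (0 < s u ^ 2) by (apply pow2_gt_0, Nu).
    pose proof (lemniscate_bounds s d u HL); pose proof (lemniscate_bounds s d v HL).
    apply csl_den_neq_0; simpl fst; simpl snd; split; [lra|].
    apply pair_neq in N; destruct N as [N|N].
    + specialize (I1 u ltac:(lra) N); assert (P : 0 < d u ^ 2) by (apply pow2_gt_0, I1).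
      rewrite Hsd in P; replace (s u ^ 4) with (s u ^ 2 * s u ^ 2) in P by ring. nra.
    + specialize (I2 v ltac:(lra) N); assert (P : 0 < d v ^ 2) by (apply pow2_gt_0, I2).
      rewrite Hsd in P; replace (s v ^ 4) with (s v ^ 2 * s v ^ 2) in P by ring. nra.
Qed.

(** As [csl_den] is continuous with isolated zeros, the lower bound by its inverse drives [|f|] to
    infinity at each of them. *)
Lemma meromorphic_of_csl_den (s d : R -> R) (f : C -> C) :
  lemniscate_pair s d ->
  (forall z, csl_den s z <> 0 ->
     ex_derive (K := C_AbsRing) (V := C_NormedModule) f z /\ / csl_den s z - 2 <= Cmod (f z) ^ 2) ->
  meromorphic f /\ forall z, csl_den s z = 0 -> pole f z.
Proof.
  intros HL H.
  assert (HP : forall z, csl_den s z = 0 -> pole f z).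
  { intros z E; destruct (csl_den_zero_isolated s d z HL E) as [e [He HI]]; split.
    - apply locally'_C; exists e; split; [exact He|]; intros w Hw N; apply H, HI; assumption.
    - apply filterlim_p_infty_C; intros B.
      (* [csl_den < 1 / (B^2 + 3)] gives [|f|^2 >= B^2 + 3 - 2 > B^2]. *)
      assert (He2 : 0 < / (B ^ 2 + 3)) by (apply Rinv_0_lt_compat; pose proof (pow2_ge_0 B); lra).
      destruct (csl_den_continuous s d z _ HL He2) as [e' [He' HC]].
      exists (Rmin e e'); split; [apply Rmin_glb_lt; assumption|]; intros w Hw N.
      pose proof (Rmin_l e e'); pose proof (Rmin_r e e').
      assert (NQ : csl_den s w <> 0) by (apply HI; [lra|exact N]).
      destruct (H w NQ) as [_ HB].
      specialize (HC w ltac:(lra)); rewrite E, Rminus_0_r in HC.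
      destruct (csl_den_nonneg s d w HL) as [P1 P2].
      assert (P : 0 < csl_den s w).
      { assert (0 <= csl_den s w) by (apply Rmult_le_pos; assumption); lra. }
      rewrite Rabs_right in HC by lra.
      assert (B ^ 2 + 3 < / csl_den s w).
      { rewrite <- (Rinv_inv (B ^ 2 + 3)); apply Rinv_lt_contravar; [|exact HC].
        apply Rmult_lt_0_compat; [exact P|exact He2]. }
      pose proof (Cmod_ge_0 (f w)).
      destruct (Rlt_le_dec B (Cmod (f w))) as [|L]; [assumption|exfalso].
      assert (Cmod (f w) ^ 2 <= B ^ 2) by (apply pow_incr; lra). lra. }
  split; [|exact HP].
  intros z; destruct (Req_dec (csl_den s z) 0) as [E|N]; [right; apply HP, E|left; unfold holomorphic_at].
  generalize (csl_den_open s d z HL N); apply filter_imp; intros w Hw; apply H, Hw.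
Qed.

Lemma csl_relations (s d : R -> R) (z : C) :
  lemniscate_pair s d -> csl_den s z <> 0 ->
  (csl s d z * csl_inv s d z = 1)%C /\
  (csl_log s d z * csl_log s d z = csl_inv s d z * csl_inv s d z - csl s d z * csl s d z)%C.
Proof.
  intros (_ & _ & Hsd) HQ; apply csl_den_neq_0 in HQ; destruct HQ as [H1 H2].
  destruct z as [x y]; cbn [fst snd] in *.
  pose proof (Hsd x) as Ex; pose proof (Hsd y) as Ey.
  pose proof (Rinv_l _ H1) as Hj; pose proof (Rinv_l _ H2) as Hi.
  unfold csl_log, csl_inv, csl, Cminus, Cplus, Cmult, Copp, RtoC; cbn [fst snd].
  clear - Ex Ey Hi Hj; revert Ex Ey Hi Hj.
  generalize (/ (s x ^ 2 + s y ^ 2)); generalize (/ (1 + - 1 * (s x ^ 2 * s y ^ 2))).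
  generalize (s x) (s y) (d x) (d y); cbn [pow]; intros.
  split; f_equal; nsatz.
Qed.

(** In the square of the modulus the diagonal terms add up to [(1 + s(x)^4) (1 + s(y)^4) / csl_den],
    at least [1 / csl_den]. The cross term is at least -2, because [(s(x)^2 d(y)^2 + s(y)^2 d(x)^2)
    / csl_den = 1]. *)
Lemma csl_amplitude_large (s d : R -> R) (eps : R) (z : C) :
  lemniscate_pair s d -> eps ^ 2 = 1 -> csl_den s z <> 0 ->
  / csl_den s z - 2 <= Cmod (csl_inv s d z + RtoC eps * csl s d z)%C ^ 2.
Proof.
  intros HL He HQ; destruct (csl_den_nonneg s d z HL) as [P1 P2].
  pose proof (lemniscate_bounds s d (fst z) HL) as Bx; pose proof (lemniscate_bounds s d (snd z) HL) as By.
  apply csl_den_neq_0 in HQ; destruct HQ as [H1 H2]; destruct HL as (_ & _ & Hsd).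
  destruct z as [x y]; cbn [fst snd] in *.
  pose proof (Hsd x) as Ex; pose proof (Hsd y) as Ey.
  unfold csl_den; cbn [fst snd]; rewrite Rinv_mult, Cmod2_alt.
  unfold csl_inv, csl, Re, Im, Cmult, Cplus, RtoC; cbn [fst snd].
  pose proof (Rinv_l _ H1) as Hj; pose proof (Rinv_l _ H2) as Hi.
  assert (Hj0 : 0 < / (s x ^ 2 + s y ^ 2)) by (apply Rinv_0_lt_compat; lra).
  assert (Hi0 : 0 < / (1 + - 1 * (s x ^ 2 * s y ^ 2))) by (apply Rinv_0_lt_compat; lra).
  revert Hj Hi Hj0 Hi0; clear - Ex Ey He Bx By.
  generalize (/ (s x ^ 2 + s y ^ 2)); generalize (/ (1 + - 1 * (s x ^ 2 * s y ^ 2))).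
  (* [a], [p] are the values of [s] and [b], [q] those of [d] at [x], [y]; [i * j] is the inverse of
     [csl_den]. *)
  revert Ex Ey Bx By; generalize (s x) (s y) (d x) (d y); intros a p b q Ex Ey Bx By i j Hj Hi Hj0 Hi0.
  assert (E : (a * q * j + (eps * (a * q * i) - 0 * (p * b * i))) ^ 2 +
    (-1 * (p * b) * j + (eps * (p * b * i) + 0 * (a * q * i))) ^ 2 =
    (1 + a ^ 4) * (1 + p ^ 4) * (i * j) + 2 * eps * (a ^ 2 * q ^ 2 - p ^ 2 * b ^ 2) * (i * j)).
  { clear - Ex Ey He Hj Hi; revert Ex Ey He Hj Hi; cbn [pow]; intros; nsatz. }
  assert (E2 : (a ^ 2 * q ^ 2 + p ^ 2 * b ^ 2) * (i * j) = 1).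
  { clear - Ex Ey Hj Hi; revert Ex Ey Hj Hi; cbn [pow]; intros; nsatz. }
  rewrite E.
  assert (Hij : 0 < i * j) by nra.
  assert (He' : eps = 1 \/ eps = - 1) by (destruct (Rle_lt_dec 0 eps); [left|right]; nra).
  assert (Ha : 0 <= a ^ 2 * q ^ 2) by (apply Rmult_le_pos; apply pow2_ge_0).
  assert (Hp : 0 <= p ^ 2 * b ^ 2) by (apply Rmult_le_pos; apply pow2_ge_0).
  assert (Ha4 : 0 <= a ^ 4) by (replace (a ^ 4) with ((a ^ 2) ^ 2) by ring; apply pow2_ge_0).
  assert (Hp4 : 0 <= p ^ 4) by (replace (p ^ 4) with ((p ^ 2) ^ 2) by ring; apply pow2_ge_0).
  assert (F1 : i * j <= (1 + a ^ 4) * (1 + p ^ 4) * (i * j)).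
  { assert (1 <= (1 + a ^ 4) * (1 + p ^ 4)) by nra. nra. }
  assert (X1 : 0 <= a ^ 2 * q ^ 2 * (i * j)) by (apply Rmult_le_pos; lra).
  assert (X2 : 0 <= p ^ 2 * b ^ 2 * (i * j)) by (apply Rmult_le_pos; lra).
  rewrite Rmult_plus_distr_r in E2.
  replace (2 * eps * (a ^ 2 * q ^ 2 - p ^ 2 * b ^ 2) * (i * j)) with
    (2 * eps * (a ^ 2 * q ^ 2 * (i * j) - p ^ 2 * b ^ 2 * (i * j))) by ring.
  destruct He' as [-> | ->]; lra.
Qed.

(** The square of [csl_log] is the product of [csl_inv + csl] and [csl_inv - csl], and each factor
    obeys the same lower bound. *)
Lemma csl_log_large (s d : R -> R) (z : C) :
  lemniscate_pair s d -> csl_den s z <> 0 ->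
  / csl_den s z - 2 <= Cmod (csl_log s d z) ^ 2.
Proof.
  intros HL HQ.
  pose proof (csl_amplitude_large s d 1 z HL ltac:(ring) HQ) as A1.
  pose proof (csl_amplitude_large s d (-1) z HL ltac:(ring) HQ) as A2.
  destruct (csl_relations s d z HL HQ) as [_ E].
  assert (E' : (csl_log s d z * csl_log s d z = (csl_inv s d z + RtoC 1 * csl s d z) * (csl_inv s d z + RtoC (-1) * csl s d z))%C)
    by (rewrite E; ring).
  apply (f_equal Cmod) in E'; rewrite !Cmod_mult in E'.
  set (u := Cmod (csl_log s d z)) in *.
  pose proof (Cmod_ge_0 (csl_inv s d z + RtoC 1 * csl s d z)%C) as P1.
  pose proof (Cmod_ge_0 (csl_inv s d z + RtoC (-1) * csl s d z)%C) as P2.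
  revert E' A1 A2 P1 P2; generalize (Cmod (csl_inv s d z + RtoC 1 * csl s d z)%C),
    (Cmod (csl_inv s d z + RtoC (-1) * csl s d z)%C); intros x y E' A1 A2 P1 P2.
  set (t := / csl_den s z - 2) in *.
  replace (u ^ 2) with (x * y) by (rewrite <- E'; ring).
  destruct (Rle_lt_dec t 0) as [L|L]; [nra|].
  destruct (Rle_lt_dec t (x * y)) as [|L2]; [assumption|exfalso].
  assert (t * t <= x ^ 2 * y ^ 2) by (apply Rmult_le_compat; lra).
  assert (x ^ 2 * y ^ 2 = (x * y) * (x * y)) by ring.
  assert (0 <= x * y) by nra. nra.
Qed.

(** * The Ginzburg-Landau equation *)

Lemma is_derive_pair (f g : R -> R) (x a b : R) :
  is_derive f x a -> is_derive g x b ->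
  is_derive (K := R_AbsRing) (V := C_R_NormedModule) (fun t => (f t, g t)) x (a, b).
Proof.
  intros Hf Hg; split; [apply (is_linear_scal_l (K := R_AbsRing) (V := C_R_NormedModule) (a, b))|].
  intros y Hy; assert (E : x = y) by (apply is_filter_lim_locally_unique; exact Hy); subst y.
  intros [eps He].
  destruct (proj1 (is_derive_iff _ _ _) Hf (eps / 2)) as [d1 [Hd1 H1]]; [lra|].
  destruct (proj1 (is_derive_iff _ _ _) Hg (eps / 2)) as [d2 [Hd2 H2]]; [lra|].
  exists (mkposreal _ (Rmin_glb_lt _ _ _ Hd1 Hd2)); intros y Hy'.
  assert (Hy2 : Rabs (y - x) < Rmin d1 d2) by exact Hy'.
  specialize (H1 y (Rlt_le_trans _ _ _ Hy2 (Rmin_l _ _))).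
  specialize (H2 y (Rlt_le_trans _ _ _ Hy2 (Rmin_r _ _))).
  change (sqrt (Rabs (f y - f x - (y - x) * a) ^ 2 + Rabs (g y - g x - (y - x) * b) ^ 2)
    <= eps * Rabs (y - x)).
  set (u := Rabs (f y - f x - (y - x) * a)) in *; set (v := Rabs (g y - g x - (y - x) * b)) in *.
  assert (0 <= u) by apply Rabs_pos; assert (0 <= v) by apply Rabs_pos.
  pose proof (Rabs_pos (y - x)).
  apply Rle_trans with (sqrt ((u + v) ^ 2)).
  - apply sqrt_le_1; nra.
  - rewrite sqrt_pow2 by lra; lra.
Qed.

Lemma antiderivative_exists (h : R -> R) (a b : R) :
  a < b -> (forall x, a < x < b -> continuous h x) ->
  exists phi : R -> R, forall x, a < x < b -> is_derive phi x (h x).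
Proof.
  intros Hab Hc; set (c := (a + b) / 2); exists (fun x => RInt h c x); intros x Hx.
  apply (is_derive_RInt h (fun x => RInt h c x) c x); [|apply Hc, Hx].
  assert (Hd : 0 < Rmin (x - a) (b - x)) by (apply Rmin_glb_lt; lra).
  exists (mkposreal _ Hd); intros y Hy.
  assert (Hy2 : Rabs (y - x) < Rmin (x - a) (b - x)) by exact Hy.
  pose proof (Rmin_l (x - a) (b - x)); pose proof (Rmin_r (x - a) (b - x)).
  apply Rabs_lt_between in Hy2.
  apply (RInt_correct h), (ex_RInt_continuous h); intros z Hz; apply Hc.
  unfold Rmin, Rmax, c in Hz; destruct (Rle_dec ((a + b) / 2) y); lra.
Qed.

Lemma is_derive_Re (f : C -> C) (x : R) (l : C) :
  is_cderive f (RtoC x) l -> is_derive (fun y => Re (f (RtoC y))) x (Re l).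
Proof.
  intros H.
  assert (E : forall y, (RtoC 0 + RtoC y * RtoC 1)%C = RtoC y) by (intros y; ring).
  assert (H' : is_cderive f (RtoC 0 + RtoC x * RtoC 1)%C l) by (rewrite E; exact H).
  pose proof (path_der_line f (RtoC 0) (RtoC 1) l x H' (RtoC 1)) as D; cbv beta in D.
  replace (Re (RtoC 1 * (RtoC 1 * l))%C) with (Re l) in D by (unfold Re, Cmult, RtoC; simpl; ring).
  revert D; apply is_derive_ext; intros y; rewrite E; unfold Re, Cmult, RtoC; simpl; ring.
Qed.

Lemma is_derive_Im (f : C -> C) (x : R) (l : C) :
  is_cderive f (RtoC x) l -> is_derive (fun y => Im (f (RtoC y))) x (Im l).
Proof.
  intros H.
  pose proof (is_derive_Re _ x _ (is_cderive_scal (- Ci)%C f (RtoC x) l H)) as D; cbv beta in D.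
  replace (Re (- Ci * l)%C) with (Im l) in D by (unfold Re, Im, Cmult, Copp, Ci; simpl; ring).
  revert D; apply is_derive_ext; intros y; unfold Re, Im, Cmult, Copp, Ci; simpl; ring.
Qed.

Lemma derivative_real_on_interval (f : C -> C) (a b : R) (l : R -> C) :
  (forall x, a < x < b -> is_cderive f (RtoC x) (l x)) ->
  (forall x, a < x < b -> Im (f (RtoC x)) = 0) ->
  forall x, a < x < b -> Im (l x) = 0.
Proof.
  intros H H0 x Hx; pose proof (is_derive_Im f x (l x) (H x Hx)) as D.
  assert (Hd : 0 < Rmin (x - a) (b - x)) by (apply Rmin_glb_lt; lra).
  assert (D0 : is_derive (fun y => Im (f (RtoC y))) x 0).
  { apply is_derive_ext_loc with (fun _ => 0); [|apply is_derive_Rconst].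
    exists (mkposreal _ Hd); intros y Hy.
    assert (Hy2 : Rabs (y - x) < Rmin (x - a) (b - x)) by exact Hy.
    pose proof (Rmin_l (x - a) (b - x)); pose proof (Rmin_r (x - a) (b - x)).
    apply Rabs_lt_between in Hy2; symmetry; apply H0; lra. }
  apply is_derive_unique in D; apply is_derive_unique in D0; congruence.
Qed.

Lemma complex_of_real (z : C) : Im z = 0 -> z = RtoC (Re z).
Proof. destruct z as [u v]; unfold Im, Re, RtoC; simpl; intros ->; reflexivity. Qed.

Ltac side_conditions :=
  repeat match goal with
  | |- _ /\ _ => split
  | |- True => exact I
  | |- ex_derive _ _ => eexists; eassumption
  | |- _ => first [assumption | lra]
  end.

(* The polar form of the wave turns the equation divided by p into its real and
   imaginary parts in the frame rotating with the phase. *)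
Lemma cgle_of_real_system (gr : R) (m m1 m2 ps ps1 phi : R -> R) (a b : R)
    (p q r : C) (gamma c omega : R) :
  special_parameters gr p q r gamma c omega ->
  (forall y, a < y < b -> 0 < m y /\ is_derive m y (m1 y) /\ is_derive m1 y (m2 y) /\
     is_derive ps y (ps1 y) /\ is_derive phi y (ps y + c * s_r p / 2) /\
     2 * m y * m2 y - m1 y ^ 2 - 4 * m y ^ 2 * ps y ^ 2 = 0 /\
     m y * ps1 y + ps y * m1 y - gr * m y + m y ^ 3 = 0) ->
  forall x t, a < x - c * t < b ->
  cgle_at p q r gamma
    (fun x t : R => (RtoC (sqrt (m (x - c * t)))%R *
       (cos (phi (x - c * t) - omega * t), sin (phi (x - c * t) - omega * t))%R)%C) x t.
Proof.
  intros (Hp & Hr & Hq & Hcs & Hg) H x t Hx.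
  set (kappa := c * s_r p / 2) in *.
  set (Ax := fun y : R => let xi := y - c * t in let th := phi xi - omega * t in
    let R := sqrt (m xi) in let R1 := m1 xi / (2 * R) in let T := ps xi + kappa in
    (R1 * cos th - R * T * sin th, R1 * sin th + R * T * cos th) : C).
  set (xi := x - c * t) in *; set (th := phi xi - omega * t).
  (* [R], [R1], [R2] are the modulus of the wave and its derivatives; [T] is the full phase
     gradient, with the shift [kappa] restored. *)
  set (R := sqrt (m xi)); set (R1 := m1 xi / (2 * R)); set (T := ps xi + kappa).
  set (R2 := m2 xi / (2 * R) - m1 xi ^ 2 / (4 * R ^ 3)).
  set (Axx := (R2 * cos th - 2 * R1 * T * sin th - R * ps1 xi * sin th - R * T ^ 2 * cos th,
    R2 * sin th + 2 * R1 * T * cos th + R * ps1 xi * cos th - R * T ^ 2 * sin th) : C).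
  set (At := (- c * (R1 * cos th - R * T * sin th) + omega * R * sin th,
    - c * (R1 * sin th + R * T * cos th) - omega * R * cos th) : C).
  exists Ax, Axx, At.
  assert (Hloc : locally x (fun y => a < y - c * t < b)).
  { assert (Hd : 0 < Rmin (xi - a) (b - xi)) by (apply Rmin_glb_lt; lra).
    exists (mkposreal _ Hd); intros y Hy.
    assert (Hy2 : Rabs (y - x) < Rmin (xi - a) (b - xi)) by exact Hy.
    pose proof (Rmin_l (xi - a) (b - xi)); pose proof (Rmin_r (xi - a) (b - xi)).
    apply Rabs_lt_between in Hy2; unfold xi in *; lra. }
  destruct (H xi Hx) as (Hm & Dm & Dm1 & Dps & Dphi & E1 & E2).
  assert (HR : 0 < R) by (apply sqrt_lt_R0, Hm).
  assert (HRR : R * R = m xi) by (apply sqrt_sqrt; lra).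
  split; [|split; [|split]].
  - revert Hloc; apply filter_imp; intros y Hy.
    destruct (H _ Hy) as (Hm' & Dm' & _ & _ & Dphi' & _).
    assert (HR' : 0 < sqrt (m (y - c * t))) by (apply sqrt_lt_R0, Hm').
    pose proof (is_derive_unique _ _ _ Dm') as Um; pose proof (is_derive_unique _ _ _ Dphi') as Uphi.
    apply (is_derive_ext (K := R_AbsRing) (V := C_R_NormedModule)) with
      (fun s => (sqrt (m (s - c * t)) * cos (phi (s - c * t) - omega * t),
                 sqrt (m (s - c * t)) * sin (phi (s - c * t) - omega * t))).
    { intros s; unfold Cmult, RtoC; simpl; f_equal; ring. }
    apply is_derive_pair; auto_derive;
      try solve [side_conditions];
      change (Derive (fun x => m x)) with (Derive m); change (Derive (fun x => phi x)) with (Derive phi);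
      unfold Rminus in Um, Uphi; rewrite Um, Uphi; unfold kappa, Rminus; field; unfold Rminus in HR'; lra.
  - pose proof (is_derive_unique _ _ _ Dm) as Um; pose proof (is_derive_unique _ _ _ Dphi) as Uphi.
    pose proof (is_derive_unique _ _ _ Dm1) as Um1; pose proof (is_derive_unique _ _ _ Dps) as Ups.
    unfold xi, Rminus in Um, Uphi, Um1, Ups, Dm, Dphi, Dm1, Dps, Hm.
    apply is_derive_pair; auto_derive;
      try solve [unfold R, xi, Rminus in HR; side_conditions];
      change (Derive (fun x => m x)) with (Derive m); change (Derive (fun x => phi x)) with (Derive phi);
      change (Derive (fun x => m1 x)) with (Derive m1); change (Derive (fun x => ps x)) with (Derive ps);
      rewrite Um, Uphi, Um1, Ups; unfold R1, R2, T, th, R, xi, kappa, Rminus in *; field; lra.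
  - pose proof (is_derive_unique _ _ _ Dm) as Um; pose proof (is_derive_unique _ _ _ Dphi) as Uphi.
    apply (is_derive_ext (K := R_AbsRing) (V := C_R_NormedModule)) with
      (fun s => (sqrt (m (x - c * s)) * cos (phi (x - c * s) - omega * s),
                 sqrt (m (x - c * s)) * sin (phi (x - c * s) - omega * s))).
    { intros s; unfold Cmult, RtoC; simpl; f_equal; ring. }
    unfold xi, Rminus in Um, Uphi, Dm, Dphi, Hm.
    apply is_derive_pair; auto_derive;
      try solve [unfold R, xi, Rminus in HR; side_conditions];
      change (Derive (fun x => m x)) with (Derive m); change (Derive (fun x => phi x)) with (Derive phi);
      rewrite Um, Uphi; unfold R1, R2, T, th, R, xi, kappa, Rminus in *; field; lra.
  - assert (Hmod : Cmod (RtoC R * (cos th, sin th))%C = R).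
    { rewrite Cmod_mult, Cmod_R, Rabs_right by lra.
      unfold Cmod; simpl fst; simpl snd.
      pose proof (sin2_cos2 th) as S; unfold Rsqr in S.
      replace (cos th ^ 2 + sin th ^ 2) with 1 by (simpl; lra); rewrite sqrt_1; ring. }
    assert (Hq' : q = RtoC 0).
    { replace q with (q / p * p)%C by (field; exact Hp); rewrite Hq; ring. }
    assert (Hr' : r = (Ci * p)%C).
    { replace r with (r / p * p)%C by (field; exact Hp); rewrite Hr; ring. }
    cbv beta; fold xi th R; rewrite Hmod, Hq', Hr'.
    (* In terms of the modulus the system reads [R'' = R ps^2] and
       [R ps' = gr R - R^5 - 2 R' ps]. *)
    assert (F1 : R2 = R * ps xi ^ 2).
    { apply Rmult_eq_reg_l with (4 * R ^ 3); [|apply Rgt_not_eq; assert (0 < R ^ 3) by (apply pow_lt, HR); lra].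
      unfold R2; transitivity (2 * (R * R) * m2 xi - m1 xi ^ 2); [field; lra|].
      rewrite HRR; transitivity (4 * m xi ^ 2 * ps xi ^ 2); [lra|rewrite <- HRR; ring]. }
    assert (F2 : R * ps1 xi = gr * R - R ^ 5 - 2 * R1 * ps xi).
    { apply Rmult_eq_reg_l with R; [|lra].
      unfold R1; transitivity (gr * (R * R) - (R * R) ^ 3 - m1 xi * ps xi); [|field; lra].
      rewrite HRR; transitivity (R * R * ps1 xi); [ring|rewrite HRR; lra]. }
    assert (EP : (/ p)%C = (s_r p, - s_i p)).
    { unfold s_r, s_i, Re, Im; destruct (/ p)%C as [u v]; simpl; f_equal; ring. }
    unfold wave_g in Hg; unfold Cplus, Cmult, Cminus, Copp, Ci, RtoC in Hg; simpl in Hg.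
    injection Hg; intros G2 G1.
    replace (Ci * At + p * Axx + 0 * RtoC (R ^ 2) * (RtoC R * (cos th, sin th)) +
      Ci * p * RtoC (R ^ 4) * (RtoC R * (cos th, sin th)) - Ci * RtoC gamma * (RtoC R * (cos th, sin th)))%C
      with (p * (Axx + Ci * RtoC (R ^ 4) * (RtoC R * (cos th, sin th)) +
        / p * (Ci * At - Ci * RtoC gamma * (RtoC R * (cos th, sin th)))))%C by (field; exact Hp).
    replace (Axx + Ci * RtoC (R ^ 4) * (RtoC R * (cos th, sin th)) +
        / p * (Ci * At - Ci * RtoC gamma * (RtoC R * (cos th, sin th))))%C with (RtoC 0); [ring|].
    rewrite EP; unfold Axx, At; rewrite F1.
    assert (K2 : kappa = c * s_r p / 2) by reflexivity.
    assert (E3 : forall z, R * ps1 xi * z = (gr * R - R ^ 5 - 2 * R1 * ps xi) * z) by (intros z; rewrite F2; reflexivity).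
    rewrite !E3; unfold T.
    set (sr := s_r p) in *; set (si := s_i p) in *; set (co := cos th); set (sn := sin th).
    assert (K1 : c * sr = 2 * kappa) by lra.
    (* Since [c s_i = 0], the real part of [wave_g] loses its [c^2] term; the vanishing of the
       imaginary part is [G2'], as [kappa^2 = c^2 s_r^2 / 4]. *)
    assert (G1' : gr = gamma * sr + omega * si).
    { transitivity (gamma * sr + omega * si + c * si * (c * sr) / 2); [rewrite <- G1; field|rewrite Hcs; field]. }
    assert (G2' : omega * sr - gamma * si + kappa ^ 2 = 0).
    { rewrite <- G2; rewrite K2; field. }
    rewrite G1'; clear - K1 Hcs G2'.
    unfold Cminus, Cplus, Cmult, Copp, Ci, RtoC; cbn [fst snd].
    revert K1 Hcs G2'; generalize (ps xi) R R1 co sn; clear; intros u v w co sn K1 Hcs G2'.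
    symmetry; f_equal.
    + revert G2'; cbn [pow]; intros; nsatz.
    + revert G2'; cbn [pow]; intros; nsatz.
Qed.

(** Real parts of complex derivatives on the axis are real derivatives, and reality on the axis
    removes the imaginary parts. Differentiability of [C_derive M] is assumed separately: as
    [C_derive] is total, the system does not assert that [M''] exists. *)
Lemma wave_solves_cgle (gr : R) (M psi : C -> C) :
  real_on_real_axis M -> real_on_real_axis psi -> amplitude_phase_system gr M psi ->
  (forall z, holomorphic_at M z ->
     ex_derive (K := C_AbsRing) (V := C_NormedModule) (C_derive M) z) ->
  forall (p q r : C) (gamma c omega : R),
    special_parameters gr p q r gamma c omega ->
    forall a b : R, wave_interval M psi a b ->
    exists phi : R -> R,
      (forall xi : R, a < xi < b ->
         is_derive phi xi (Re (psi (RtoC xi)) + c * s_r p / 2)) /\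
      (forall x t : R, a < x - c * t < b ->
         cgle_at p q r gamma (wave M phi c omega) x t).
Proof.
  intros HrM Hrpsi Hsys H2 p q r gamma c omega Hpar a b [Hab HI].
  assert (DM : forall x, a < x < b -> is_cderive M (RtoC x) (C_derive M (RtoC x))).
  { intros x Hx; destruct (HI x Hx) as (A & _); apply is_cderive_C_derive, (locally_C_ex _ _ A). }
  assert (Dpsi : forall x, a < x < b -> is_cderive psi (RtoC x) (C_derive psi (RtoC x))).
  { intros x Hx; destruct (HI x Hx) as (_ & A & _); apply is_cderive_C_derive, (locally_C_ex _ _ A). }
  assert (DM1 : forall x, a < x < b -> is_cderive (C_derive M) (RtoC x) (C_derive (C_derive M) (RtoC x))).
  { intros x Hx; destruct (HI x Hx) as (A & _); apply is_cderive_C_derive, H2, A. }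
  destruct (antiderivative_exists (fun x => Re (psi (RtoC x)) + c * s_r p / 2) a b Hab) as [phi Hphi].
  { intros x Hx; apply (ex_derive_continuous (fun x => Re (psi (RtoC x)) + c * s_r p / 2)).
    eexists; apply (is_derive_plus (V := R_NormedModule)); [apply is_derive_Re, Dpsi, Hx|apply is_derive_Rconst]. }
  exists phi; split; [exact Hphi|].
  apply (cgle_of_real_system gr (fun x => Re (M (RtoC x))) (fun x => Re (C_derive M (RtoC x)))
    (fun x => Re (C_derive (C_derive M) (RtoC x))) (fun x => Re (psi (RtoC x)))
    (fun x => Re (C_derive psi (RtoC x))) phi a b p q r gamma c omega Hpar).
  intros x Hx; destruct (HI x Hx) as (HhM & Hhpsi & Hpos).
  assert (IM : Im (M (RtoC x)) = 0) by (apply HrM, HhM).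
  assert (Ipsi : Im (psi (RtoC x)) = 0) by (apply Hrpsi, Hhpsi).
  assert (IM1 : Im (C_derive M (RtoC x)) = 0).
  { apply (derivative_real_on_interval M a b (fun x => C_derive M (RtoC x)) DM); [|exact Hx].
    intros y Hy; apply HrM, HI, Hy. }
  destruct (Hsys (RtoC x) HhM Hhpsi) as [E1 E2]; cbv zeta in E1, E2.
  rewrite (complex_of_real _ IM), (complex_of_real _ IM1), (complex_of_real _ Ipsi) in E1.
  rewrite (complex_of_real _ IM), (complex_of_real _ IM1), (complex_of_real _ Ipsi) in E2.
  split; [exact Hpos|]; split; [apply is_derive_Re, DM, Hx|]; split; [apply is_derive_Re, DM1, Hx|].
  split; [apply is_derive_Re, Dpsi, Hx|]; split; [apply Hphi, Hx|].
  apply (f_equal Re) in E1; apply (f_equal Re) in E2.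
  revert E1 E2; generalize (Re (M (RtoC x))) (Re (C_derive M (RtoC x))) (Re (psi (RtoC x))).
  generalize (C_derive (C_derive M) (RtoC x)) (C_derive psi (RtoC x)); intros [u1 u2] [v1 v2] m m1 ps E1 E2.
  unfold Re, Cminus, Cplus, Cmult, Copp, RtoC in *; simpl in *; split; lra.
Qed.

(** * The elliptic amplitude, its phase gradient and their algebraic relations *)

Definition amplitude (s d : R -> R) (al eps k : R) (z : C) : C :=
  (RtoC (al / 2) * (csl_inv s d (RtoC k * z) + RtoC eps * csl s d (RtoC k * z)))%C.

Definition phase_gradient (s d : R -> R) (k : R) (z : C) : C :=
  (RtoC (sqrt 3 / 2 * k) * csl_log s d (RtoC k * z))%C.

Lemma lemniscate_amplitude_derivatives (s d : R -> R) (al eps k : R) (z : C) :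
  lemniscate_pair s d -> eps ^ 2 = 1 -> csl_den s (RtoC k * z)%C <> 0 ->
  let S := csl s d (RtoC k * z)%C in let G := csl_inv s d (RtoC k * z)%C in
  let U := csl_log s d (RtoC k * z)%C in
  let V := (RtoC (al / 2) * (G + RtoC (- eps) * S))%C in
  let W := (S * S + G * G)%C in
  is_cderive (amplitude s d al eps k) z (- (RtoC k * (U * V)))%C /\
  is_cderive (fun w => - (RtoC k * (csl_log s d (RtoC k * w) *
    amplitude s d al (- eps) k w)))%C z
    (RtoC (k ^ 2) * (W * V + U * U * amplitude s d al eps k z))%C /\
  is_cderive (phase_gradient s d k) z (- (RtoC (sqrt 3 / 2 * k ^ 2) * W))%C.
Proof.
  intros HL He HQ S G U V W.
  assert (HD : forall e, is_cderive (amplitude s d al e k) z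
    (- (RtoC k * (U * (RtoC (al / 2) * (G + RtoC (- e) * S)))))%C).
  { intros e; destruct (is_cderive_csl s d _ HL HQ) as (D1 & D2 & _).
    pose proof (is_cderive_scal (RtoC (al / 2)) _ _ _ (is_cderive_plus _ _ _ _ _
      (is_cderive_comp_scal (RtoC k) _ z _ D2)
      (is_cderive_scal (RtoC e) _ _ _ (is_cderive_comp_scal (RtoC k) _ z _ D1)))) as D; simpl in D.
    match type of D with is_derive _ _ ?X => match goal with |- is_derive _ _ ?Y => replace Y with X; [exact D|] end end.
    fold S G U; rewrite RtoC_opp; ring. }
  destruct (is_cderive_csl s d _ HL HQ) as (_ & _ & D3).
  pose proof (is_cderive_comp_scal (RtoC k) _ z _ D3) as DU; simpl in DU.
  split; [exact (HD eps)|split].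
  - pose proof (is_cderive_scal (RtoC (-1)) _ _ _ (is_cderive_scal (RtoC k) _ _ _
      (is_cderive_mult _ _ _ _ _ DU (HD (- eps))))) as D; simpl in D.
    apply (is_cderive_ext_loc (fun w => RtoC (-1) * (RtoC k * (csl_log s d (RtoC k * w) *
      amplitude s d al (- eps) k w)))%C); [apply filter_forall; intros w; ring|].
    match type of D with is_derive _ _ ?X => match goal with |- is_derive _ _ ?Y => replace Y with X; [exact D|] end end.
    unfold amplitude; fold S G U; unfold V, W.
    replace (RtoC (k ^ 2)) with (RtoC k * RtoC k)%C by (rewrite <- RtoC_mult; f_equal; ring).
    rewrite !Ropp_involutive, !RtoC_opp; ring.
  - pose proof (is_cderive_scal (RtoC (sqrt 3 / 2 * k)) _ _ _ DU) as D; simpl in D.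
    match type of D with is_derive _ _ ?X => match goal with |- is_derive _ _ ?Y => replace Y with X; [exact D|] end end.
    fold S G; unfold W.
    replace (RtoC (sqrt 3 / 2 * k ^ 2)) with (RtoC (sqrt 3 / 2 * k) * RtoC k)%C
      by (rewrite <- RtoC_mult; f_equal; ring). ring.
Qed.

(** [V] is the amplitude with [eps] reversed, and [M' = - k U V]. The third identity makes [3 V^2]
    the discriminant [3 M^2 - 4 gr] once [al^2 eps = 4 gr / 3]. *)
Lemma amplitude_identities (S G U : C) (al eps : R) :
  eps ^ 2 = 1 -> (S * G = 1)%C -> (U * U = G * G - S * S)%C ->
  let M := (RtoC (al / 2) * (G + RtoC eps * S))%C in
  let V := (RtoC (al / 2) * (G + RtoC (- eps) * S))%C in
  (RtoC 4 * (M * V) = RtoC (al ^ 2) * (U * U))%C /\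
  (RtoC 2 * (M * M + V * V) = RtoC (al ^ 2) * (S * S + G * G))%C /\
  (M * M - V * V = RtoC (al ^ 2 * eps))%C.
Proof.
  intros He H1 H2 M V; unfold M, V.
  assert (He' : (RtoC eps * RtoC eps = 1)%C) by (rewrite <- RtoC_mult; f_equal; simpl in He; lra).
  replace (RtoC (al ^ 2)) with (RtoC 4 * (RtoC (al / 2) * RtoC (al / 2)))%C
    by (rewrite <- !RtoC_mult; f_equal; field).
  replace (RtoC (al ^ 2 * eps)) with (RtoC 4 * (RtoC (al / 2) * RtoC (al / 2)) * RtoC eps * 1)%C
    by (rewrite <- !RtoC_mult; f_equal; field).
  rewrite H2, <- H1, !RtoC_opp; set (a := RtoC (al / 2)).
  split; [|split].
  - transitivity (RtoC 4 * (a * a) * (G * G - (RtoC eps * RtoC eps) * (S * S)))%C; [ring|rewrite He'; ring].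
  - transitivity (RtoC 4 * (a * a) * (G * G + (RtoC eps * RtoC eps) * (S * S)))%C; [ring|rewrite He'; ring].
  - ring.
Qed.

(** In the application [A = al^2], [B = k^2], and [P = 3 k^2 / 4] is the coefficient of [U^2] in the
    square of the phase gradient; the factor [sqrt 3 / 2] there is what [H3] demands. *)
Lemma first_amplitude_identity (M V U W A B P : C) :
  (RtoC 4 * (M * V) = A * (U * U))%C -> (RtoC 2 * (M * M + V * V) = A * W)%C ->
  (RtoC 4 * P = RtoC 3 * B)%C ->
  (RtoC 2 * M * (B * (W * V + U * U * M)) - B * (U * V * (U * V)) - RtoC 4 * (M * M) * (P * (U * U)) = 0)%C.
Proof.
  intros H1 H2 H3.
  transitivity (RtoC (1 / 2) * B * (W * (RtoC 4 * (M * V) - A * (U * U)) + U * U * (A * W - RtoC 2 * (M * M + V * V)))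
    + M * M * (U * U) * (RtoC 3 * B - RtoC 4 * P))%C.
  - rewrite RtoC_div by lra; field; apply RtoC_neq; lra.
  - rewrite H1, H2, H3; ring.
Qed.

(** [P] comes from the derivative of the phase gradient and [Q] from its product with [M']; both are
    [sqrt 3 / 2 k^2], so [H4] and [H5] amount to [4 sqrt 3 k^2 = al^2]. *)
Lemma second_amplitude_identity (M V U W A g P Q : C) :
  (RtoC 4 * (M * V) = A * (U * U))%C -> (RtoC 2 * (M * M + V * V) = A * W)%C ->
  (RtoC 3 * (M * M - V * V) = RtoC 4 * g)%C ->
  (RtoC 8 * P = A)%C -> (RtoC 8 * Q = A)%C ->
  (M * (- (P * W)) - Q * (U * U) * V - g * M + M * M * M = 0)%C.
Proof.
  intros H1 H2 H3 H4 H5.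
  apply (Cmult_cancel_l (RtoC 8)); [apply RtoC_neq; lra|].
  transitivity (- (M * (RtoC 8 * P * W)) - (RtoC 8 * Q) * (U * U) * V - RtoC 8 * g * M + RtoC 8 * (M * M * M))%C; [ring|].
  rewrite H4, H5.
  transitivity (M * (RtoC 2 * (M * M + V * V) - A * W) + V * (RtoC 4 * (M * V) - A * (U * U))
    + RtoC 2 * M * (RtoC 3 * (M * M - V * V) - RtoC 4 * g))%C; [ring|].
  rewrite H1, H2, H3; ring.
Qed.

(** With [A = al^2] and [B = k^2], [H3] is the square of [4 sqrt 3 k^2 = al^2]; [H2] turns each
    factor of the discriminant into [3 V^2]. *)
Lemma first_order_identity (M V U A B g : C) :
  (RtoC 4 * (M * V) = A * (U * U))%C -> (RtoC 3 * (M * M - V * V) = RtoC 4 * g)%C ->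
  (RtoC 48 * (B * B) = A * A)%C ->
  (RtoC 81 * (B * (U * V * (U * V)) * (B * (U * V * (U * V)))) =
   M * M * ((RtoC 3 * (M * M) - RtoC 4 * g) * (RtoC 3 * (M * M) - RtoC 4 * g) * (RtoC 3 * (M * M) - RtoC 4 * g)))%C.
Proof.
  intros H1 H2 H3; rewrite <- H2.
  apply (Cmult_cancel_l (RtoC 48)); [apply RtoC_neq; lra|].
  transitivity (RtoC 81 * (RtoC 48 * (B * B)) * (U * U * (U * U)) * (V * V * (V * V)))%C; [ring|].
  rewrite H3.
  transitivity (RtoC 81 * ((A * (U * U)) * (A * (U * U))) * (V * V * (V * V)))%C; [ring|].
  rewrite <- H1; ring.
Qed.

(** * The elliptic solution *)

Lemma amplitude_meromorphic (s d : R -> R) (al eps k : R) :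
  lemniscate_pair s d -> eps ^ 2 = 1 -> 0 < al -> 0 < k ->
  meromorphic (amplitude s d al eps k) /\
  forall z, holomorphic_at (amplitude s d al eps k) z <-> csl_den s (RtoC k * z)%C <> 0.
Proof.
  intros HL He Hal Hk.
  assert (Ha : RtoC (al / 2) <> RtoC 0) by (apply RtoC_neq; lra).
  set (f := fun z => (csl_inv s d z + RtoC eps * csl s d z)%C).
  assert (Hf : forall z, csl_den s z <> 0 ->
    ex_derive (K := C_AbsRing) (V := C_NormedModule) f z /\ / csl_den s z - 2 <= Cmod (f z) ^ 2).
  { intros z HQ; split; [|apply csl_amplitude_large; assumption].
    destruct (is_cderive_csl s d z HL HQ) as (D1 & D2 & _).
    eexists; apply (is_cderive_plus _ _ _ _ _ D2 (is_cderive_scal (RtoC eps) _ _ _ D1)). }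
  destruct (meromorphic_of_csl_den s d f HL Hf) as [HM HP].
  split; [apply (meromorphic_rescale (RtoC (al / 2)) k f Ha Hk HM)|].
  intros z; split.
  - intros HH E; revert HH; apply pole_not_holomorphic.
    apply (pole_rescale (RtoC (al / 2)) k f z Ha Hk), HP, E.
  - intros HQ; unfold holomorphic_at.
    generalize (locally_rescale k z _ Hk (csl_den_open s d _ HL HQ)); apply filter_imp.
    intros w Hw; apply (ex_cderive_rescale (RtoC (al / 2)) k f), Hf, Hw.
Qed.

Lemma phase_gradient_meromorphic (s d : R -> R) (k : R) :
  lemniscate_pair s d -> 0 < k ->
  meromorphic (phase_gradient s d k) /\
  forall z, csl_den s (RtoC k * z)%C <> 0 -> holomorphic_at (phase_gradient s d k) z.
Proof.
  intros HL Hk.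
  assert (H3 : 0 < sqrt 3) by (apply sqrt_lt_R0; lra).
  assert (Ha : RtoC (sqrt 3 / 2 * k) <> RtoC 0) by (apply RtoC_neq; nra).
  assert (Hf : forall z, csl_den s z <> 0 ->
    ex_derive (K := C_AbsRing) (V := C_NormedModule) (csl_log s d) z /\ / csl_den s z - 2 <= Cmod (csl_log s d z) ^ 2).
  { intros z HQ; split; [|apply csl_log_large; assumption].
    destruct (is_cderive_csl s d z HL HQ) as (_ & _ & D3); eexists; exact D3. }
  split.
  - apply (meromorphic_rescale _ k (csl_log s d) Ha Hk), (meromorphic_of_csl_den s d _ HL Hf).
  - intros z HQ; unfold holomorphic_at.
    generalize (locally_rescale k z _ Hk (csl_den_open s d _ HL HQ)); apply filter_imp.
    intros w Hw; apply (ex_cderive_rescale _ k (csl_log s d)), Hf, Hw.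
Qed.

Lemma csl_real_axis (s d : R -> R) (y : R) :
  s 0 = 0 -> d 0 = 1 ->
  csl s d (RtoC y) = RtoC (s y) /\ csl_inv s d (RtoC y) = RtoC (s y * / s y ^ 2) /\
  Im (csl_log s d (RtoC y)) = 0 /\ csl_den s (RtoC y) = s y ^ 2.
Proof.
  intros H0 H1; unfold csl, csl_inv, csl_log, csl_den, Im, RtoC; cbn [fst snd]; rewrite H0, H1.
  split; [f_equal; [field|ring]|]; split; [f_equal; [|ring]|split; ring].
  replace (s y ^ 2 + 0 ^ 2) with (s y ^ 2) by ring; ring.
Qed.

Lemma amplitude_real_axis (s d : R -> R) (al eps k x : R) :
  s 0 = 0 -> d 0 = 1 ->
  amplitude s d al eps k (RtoC x) =
    RtoC (al / 2 * (s (k * x) * / s (k * x) ^ 2 + eps * s (k * x))).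
Proof.
  intros H0 H1; unfold amplitude; rewrite <- RtoC_mult.
  destruct (csl_real_axis s d (k * x) H0 H1) as (-> & -> & _).
  rewrite <- RtoC_mult, <- RtoC_plus, <- RtoC_mult; reflexivity.
Qed.

(** [csl] and [csl_inv] are built from [s] and [d] of each coordinate separately, so the real period
    acts in both directions and the periods [L / k], [Ci L / k] span a square lattice. *)
Lemma amplitude_elliptic (s d : R -> R) (al eps k L : R) :
  meromorphic (amplitude s d al eps k) -> 0 < k -> 0 < L ->
  (forall x, s (x + L) = s x) -> (forall x, d (x + L) = d x) ->
  elliptic (amplitude s d al eps k).
Proof.
  intros HM Hk HL Hs Hd; split; [exact HM|].
  assert (Hh : L / k <> 0) by (apply Rgt_not_eq, Rdiv_lt_0_compat; assumption).
  assert (Ci0 : Ci <> RtoC 0) by (intros E; injection E; lra).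
  assert (Hh' : RtoC (L / k) <> RtoC 0) by (apply RtoC_neq, Hh).
  exists (RtoC (L / k)), (Ci * RtoC (L / k))%C.
  split; [apply Cmult_neq_0; assumption|]; split.
  { assert (E : (RtoC (L / k) / (Ci * RtoC (L / k)))%C = (- Ci)%C).
    { apply (Cmult_cancel_l Ci); [exact Ci0|].
      transitivity (RtoC 1); [field; split; assumption|].
      unfold Ci, Cmult, Copp, RtoC; simpl; f_equal; ring. }
    rewrite E; unfold Im, Copp, Ci; simpl; lra. }
  split; apply is_period_of_invariant; intros [x y]; unfold amplitude.
  - replace (RtoC k * ((x, y) + RtoC (L / k)))%C with ((k * x + L, k * y) : C)
      by (unfold Cmult, Cplus, RtoC; simpl; f_equal; field; lra).
    replace (RtoC k * (x, y))%C with ((k * x, k * y) : C) by (unfold Cmult, RtoC; simpl; f_equal; ring).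
    unfold csl_inv, csl; cbn [fst snd]; rewrite !Hs, !Hd; reflexivity.
  - replace (RtoC k * ((x, y) + Ci * RtoC (L / k)))%C with ((k * x, k * y + L) : C)
      by (unfold Cmult, Cplus, Ci, RtoC; simpl; f_equal; field; lra).
    replace (RtoC k * (x, y))%C with ((k * x, k * y) : C) by (unfold Cmult, RtoC; simpl; f_equal; ring).
    unfold csl_inv, csl; cbn [fst snd]; rewrite !Hs, !Hd; reflexivity.
Qed.

Lemma amplitude_nonconstant (s d : R -> R) (al eps k : R) :
  lemniscate_pair s d -> s 0 = 0 -> d 0 = 1 -> (forall v, - 1 <= v <= 1 -> exists x, s x = v) ->
  eps ^ 2 = 1 -> 0 < al -> 0 < k -> nonconstant (amplitude s d al eps k).
Proof.
  intros HL H0 H1 Hsur He Hal Hk.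
  destruct (amplitude_meromorphic s d al eps k HL He Hal Hk) as [_ Hhol].
  (* At [s = 1] and [s = 1/2] the bracket [1/s + eps s] equals [1 + eps] and [2 + eps / 2], which
     agree only for [eps = 2]. *)
  destruct (Hsur 1) as [y1 E1]; [lra|]; destruct (Hsur (1 / 2)) as [y2 E2]; [lra|].
  assert (Ky : forall y, k * (y / k) = y) by (intros y; field; lra).
  exists (RtoC (y1 / k)), (RtoC (y2 / k)).
  split; [|split].
  - apply Hhol; rewrite <- RtoC_mult, Ky, (proj2 (proj2 (proj2 (csl_real_axis s d y1 H0 H1)))), E1; lra.
  - apply Hhol; rewrite <- RtoC_mult, Ky, (proj2 (proj2 (proj2 (csl_real_axis s d y2 H0 H1)))), E2; lra.
  - rewrite !amplitude_real_axis, !Ky, E1, E2 by assumption; intros E; injection E; intros E'.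
    apply Rmult_eq_reg_l in E'; [|lra].
    assert (eps = 2) by lra. subst eps; lra.
Qed.

(** Just to the right of the pole at 0 one has [0 < s < 1], so [1/s] dominates [eps s] and the
    amplitude is positive. *)
Lemma amplitude_wave_interval (s d : R -> R) (al eps k : R) :
  lemniscate_pair s d -> s 0 = 0 -> d 0 = 1 -> eps ^ 2 = 1 -> 0 < al -> 0 < k ->
  exists a b, wave_interval (amplitude s d al eps k) (phase_gradient s d k) a b.
Proof.
  intros HL H0 H1 He Hal Hk.
  (* The tolerance 1/2 puts [s y] between [y / 2] and [3 y / 2], and [y < 1/2] then keeps it below
     1. *)
  destruct (proj1 (is_derive_iff _ _ _) (proj1 HL 0) (1 / 2) ltac:(lra)) as [e [He0 Hs]].
  set (h := Rmin e (1 / 2)).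
  assert (Hh : 0 < h) by (apply Rmin_glb_lt; lra).
  assert (Hh1 : h <= e) by apply Rmin_l. assert (Hh2 : h <= 1 / 2) by apply Rmin_r.
  exists 0, (h / k); split; [apply Rdiv_lt_0_compat; assumption|]; intros x Hx.
  set (y := k * x).
  assert (Hy : 0 < y < h).
  { unfold y; split; [nra|]; apply Rmult_lt_reg_r with (/ k); [apply Rinv_0_lt_compat, Hk|].
    replace (k * x * / k) with x by (field; lra); apply Hx. }
  specialize (Hs y); rewrite H0, H1, !Rminus_0_r, Rabs_right in Hs by lra; specialize (Hs ltac:(lra)).
  apply Rabs_le_between in Hs.
  assert (Hsy : 0 < s y < 1) by lra.
  assert (HQ : csl_den s (RtoC k * RtoC x)%C <> 0).
  { rewrite <- RtoC_mult; fold y; rewrite (proj2 (proj2 (proj2 (csl_real_axis s d y H0 H1)))); nra. }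
  split; [apply (amplitude_meromorphic s d al eps k HL He Hal Hk), HQ|].
  split; [apply (phase_gradient_meromorphic s d k HL Hk), HQ|].
  rewrite amplitude_real_axis by assumption; fold y; unfold Re, RtoC; cbn [fst].
  replace (s y * / s y ^ 2) with (/ s y) by (field; lra).
  assert (1 < / s y) by (rewrite <- Rinv_1; apply Rinv_lt_contravar; lra).
  assert (- 1 <= eps <= 1) by nra.
  apply Rmult_lt_0_compat; [lra|nra].
Qed.

Lemma amplitude_first_derivative (s d : R -> R) (al eps k : R) (z : C) :
  lemniscate_pair s d -> eps ^ 2 = 1 -> 0 < k -> csl_den s (RtoC k * z)%C <> 0 ->
  C_derive (amplitude s d al eps k) z =
    (- (RtoC k * (csl_log s d (RtoC k * z) * amplitude s d al (- eps) k z)))%C /\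
  is_cderive (C_derive (amplitude s d al eps k)) z
    (RtoC (k ^ 2) * ((csl s d (RtoC k * z) * csl s d (RtoC k * z) + csl_inv s d (RtoC k * z) * csl_inv s d (RtoC k * z))
       * amplitude s d al (- eps) k z
     + csl_log s d (RtoC k * z) * csl_log s d (RtoC k * z) * amplitude s d al eps k z))%C.
Proof.
  intros HL He Hk HQ.
  split.
  - apply is_cderive_unique, (lemniscate_amplitude_derivatives s d al eps k z HL He HQ).
  - apply (is_cderive_ext_loc (fun w => - (RtoC k * (csl_log s d (RtoC k * w) *
      amplitude s d al (- eps) k w)))%C).
    + generalize (locally_rescale k z _ Hk (csl_den_open s d _ HL HQ)); apply filter_imp.
      intros w Hw; symmetry.
      apply is_cderive_unique, (lemniscate_amplitude_derivatives s d al eps k w HL He Hw).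
    + apply (lemniscate_amplitude_derivatives s d al eps k z HL He HQ).
Qed.

Lemma amplitude_solves (s d : R -> R) (al eps k gr : R) :
  lemniscate_pair s d -> eps ^ 2 = 1 -> 0 < al -> 0 < k ->
  al ^ 2 * eps = 4 * gr / 3 -> 4 * sqrt 3 * k ^ 2 = al ^ 2 ->
  amplitude_phase_system gr (amplitude s d al eps k) (phase_gradient s d k) /\
  first_order_eq gr (amplitude s d al eps k).
Proof.
  intros HL He Hal Hk Hg Hk2.
  destruct (amplitude_meromorphic s d al eps k HL He Hal Hk) as [_ Hhol].
  assert (H33 : sqrt 3 * sqrt 3 = 3) by (apply sqrt_sqrt; lra).
  assert (Hbase : forall z, csl_den s (RtoC k * z)%C <> 0 ->
    (RtoC 4 * (amplitude s d al eps k z * amplitude s d al (- eps) k z) =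
      RtoC (al ^ 2) * (csl_log s d (RtoC k * z) * csl_log s d (RtoC k * z)))%C /\
    (RtoC 2 * (amplitude s d al eps k z * amplitude s d al eps k z
       + amplitude s d al (- eps) k z * amplitude s d al (- eps) k z) =
      RtoC (al ^ 2) * (csl s d (RtoC k * z) * csl s d (RtoC k * z) + csl_inv s d (RtoC k * z) * csl_inv s d (RtoC k * z)))%C /\
    (RtoC 3 * (amplitude s d al eps k z * amplitude s d al eps k z
       - amplitude s d al (- eps) k z * amplitude s d al (- eps) k z) = RtoC 4 * RtoC gr)%C).
  { intros z HQ; destruct (csl_relations s d _ HL HQ) as [R1 R2].
    destruct (amplitude_identities _ _ _ al eps He R1 R2) as (I1 & I2 & I3).
    split; [exact I1|split; [exact I2|]].
    unfold amplitude; rewrite I3, Hg, <- !RtoC_mult; f_equal; field. }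
  split.
  - intros z HM Hpsi; cbv zeta; apply Hhol in HM.
    destruct (Hbase z HM) as (I1 & I2 & I3).
    destruct (amplitude_first_derivative s d al eps k z HL He Hk HM) as [D1 D2].
    apply is_cderive_unique in D2.
    pose proof (proj2 (proj2 (lemniscate_amplitude_derivatives s d al eps k z HL He HM))) as D3; cbv zeta in D3.
    apply is_cderive_unique in D3.
    rewrite D2, D1, D3; unfold phase_gradient.
    set (M := amplitude s d al eps k z) in *; set (V := amplitude s d al (- eps) k z) in *.
    set (U := csl_log s d (RtoC k * z)%C) in *.
    set (W := (csl s d (RtoC k * z) * csl s d (RtoC k * z) + csl_inv s d (RtoC k * z) * csl_inv s d (RtoC k * z))%C) in *.
    split.
    + assert (HP : (RtoC 4 * RtoC (3 / 4 * k ^ 2) = RtoC 3 * RtoC (k ^ 2))%C)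
        by (rewrite <- !RtoC_mult; f_equal; field).
      pose proof (first_amplitude_identity M V U W _ _ _ I1 I2 HP) as E.
      replace (RtoC (3 / 4 * k ^ 2)) with (RtoC (sqrt 3 / 2 * k) * RtoC (sqrt 3 / 2 * k))%C in E.
      2:{ rewrite <- RtoC_mult; f_equal.
          transitivity ((sqrt 3 * sqrt 3) / 4 * k ^ 2); [field|rewrite H33; reflexivity]. }
      replace (RtoC (k ^ 2)) with (RtoC k * RtoC k)%C in * by (rewrite <- RtoC_mult; f_equal; ring).
      refine (eq_trans _ E); unfold Cpow; ring.
    + assert (HP : (RtoC 8 * RtoC (sqrt 3 / 2 * k ^ 2) = RtoC (al ^ 2))%C)
        by (rewrite <- RtoC_mult; f_equal; rewrite <- Hk2; field).
      pose proof (second_amplitude_identity M V U W _ _ _ _ I1 I2 I3 HP HP) as E.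
      replace (RtoC (sqrt 3 / 2 * k ^ 2)) with (RtoC (sqrt 3 / 2 * k) * RtoC k)%C in *
        by (rewrite <- RtoC_mult; f_equal; ring).
      refine (eq_trans _ E); unfold Cpow; ring.
  - intros z HM; apply Hhol in HM.
    destruct (Hbase z HM) as (I1 & I2 & I3).
    destruct (amplitude_first_derivative s d al eps k z HL He Hk HM) as [D1 _]; rewrite D1.
    set (M := amplitude s d al eps k z) in *; set (V := amplitude s d al (- eps) k z) in *.
    set (U := csl_log s d (RtoC k * z)%C) in *.
    assert (HB : (RtoC 48 * (RtoC (k ^ 2) * RtoC (k ^ 2)) = RtoC (al ^ 2) * RtoC (al ^ 2))%C).
    { rewrite <- Hk2, <- !RtoC_mult; f_equal.
      transitivity (16 * (sqrt 3 * sqrt 3) * (k ^ 2 * k ^ 2)); [rewrite H33; ring|ring]. }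
    pose proof (first_order_identity M V U (RtoC (al ^ 2)) (RtoC (k ^ 2)) (RtoC gr) I1 I3 HB) as E.
    apply inv81 in E.
    replace (RtoC (k ^ 2)) with (RtoC k * RtoC k)%C in E by (rewrite <- RtoC_mult; f_equal; ring).
    simpl; transitivity (RtoC k * RtoC k * (U * V * (U * V)) * (RtoC k * RtoC k * (U * V * (U * V))))%C; [ring|].
    rewrite E; ring.
Qed.

Theorem mainTheorem2 (gr : R) (hgr : gr <> 0) :
  (forall M : C -> C, meromorphic M -> first_order_eq gr M -> third_order_eq gr M)
  /\
  exists M psi : C -> C,
    meromorphic M /\ meromorphic psi /\
    real_on_real_axis M /\ real_on_real_axis psi /\
    amplitude_phase_system gr M psi /\
    elliptic M /\ nonconstant M /\ first_order_eq gr M /\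
    (exists a b : R, wave_interval M psi a b) /\
    (forall (p q r : C) (gamma c omega : R),
       special_parameters gr p q r gamma c omega ->
       forall a b : R, wave_interval M psi a b ->
       exists phi : R -> R,
         (forall xi : R, a < xi < b ->
            is_derive phi xi (Re (psi (RtoC xi)) + c * s_r p / 2)) /\
         (forall x t : R, a < x - c * t < b ->
            cgle_at p q r gamma (wave M phi c omega) x t)).
Proof.
  split; [intros M _; apply first_order_implies_third_order, hgr|].
  destruct lemniscate_sine_exists as (s & d & L & HL0 & Hs & Hd & Hsd & HsL & HdL & H0 & H1 & Hsur).
  assert (HL : lemniscate_pair s d) by (split; [exact Hs|split; [exact Hd|exact Hsd]]).
  assert (HG : 0 < Rabs gr) by (apply Rabs_pos_lt, hgr).
  assert (H3 : 0 < sqrt 3) by (apply sqrt_lt_R0; lra).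
  assert (Heps : exists eps, eps ^ 2 = 1 /\ Rabs gr * eps = gr).
  { destruct (Rlt_le_dec gr 0) as [Hn|Hp].
    - exists (-1); rewrite Rabs_left by exact Hn; split; ring.
    - exists 1; rewrite Rabs_right by lra; split; ring. }
  destruct Heps as (eps & He & Hge).
  set (al := sqrt (4 * Rabs gr / 3)).
  assert (Hal : 0 < al) by (apply sqrt_lt_R0; lra).
  assert (Hal2 : al ^ 2 = 4 * Rabs gr / 3) by (apply pow2_sqrt; lra).
  set (k := sqrt (al ^ 2 / (4 * sqrt 3))).
  assert (Hk0 : 0 < al ^ 2 / (4 * sqrt 3)) by (apply Rdiv_lt_0_compat; [apply pow_lt|]; lra).
  assert (Hk : 0 < k) by (apply sqrt_lt_R0, Hk0).
  assert (Hk2 : 4 * sqrt 3 * k ^ 2 = al ^ 2) by (unfold k; rewrite pow2_sqrt by lra; field; lra).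
  assert (Hg : al ^ 2 * eps = 4 * gr / 3) 
    by (rewrite Hal2; transitivity (4 * (Rabs gr * eps) / 3); [field|rewrite Hge; reflexivity]).
  destruct (amplitude_meromorphic s d al eps k HL He Hal Hk) as [HM Hhol].
  destruct (phase_gradient_meromorphic s d k HL Hk) as [Hpsi _].
  destruct (amplitude_solves s d al eps k gr HL He Hal Hk Hg Hk2) as [Hsys Hfirst].
  assert (HrM : real_on_real_axis (amplitude s d al eps k)).
  { intros x _; rewrite amplitude_real_axis by assumption; reflexivity. }
  assert (Hrpsi : real_on_real_axis (phase_gradient s d k)).
  { intros x _; unfold phase_gradient; rewrite <- RtoC_mult.
    destruct (csl_real_axis s d (k * x) H0 H1) as (_ & _ & E & _).
    rewrite (complex_of_real _ E), <- RtoC_mult; reflexivity. }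
  exists (amplitude s d al eps k), (phase_gradient s d k).
  split; [exact HM|split; [exact Hpsi|split; [exact HrM|split; [exact Hrpsi|split; [exact Hsys|]]]]].
  split; [apply (amplitude_elliptic s d al eps k L); assumption|].
  split; [apply amplitude_nonconstant; assumption|].
  split; [exact Hfirst|].
  split; [apply amplitude_wave_interval; assumption|].
  apply (wave_solves_cgle gr); try assumption.
  intros z Hz; apply Hhol in Hz; eexists.
  apply (amplitude_first_derivative s d al eps k z HL He Hk Hz).
Qed.
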